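(* Under the assumptions of the context, \[ \Phi^{\mathcal X,\infty,\mathcal T}(a,\mathbf C)=\mathcal P^{\mathbb R^+,\mathcal T}(a,\mathbf C)=\mathcal H^{\mathbb R^+,\mathcal T}(a,\mathbf C)=\Psi^{\mathcal X,\infty,\mathcal T}(a,\mathbf C). \] In particular, there is a sequence of models in $\mathcal M^{\mathbb R^+,\mathcal T}(\mathbf C)$ whose model-based prices $\phi$ converge to $\Psi^{\mathcal X,\infty,\mathcal T}(a,\mathbf C)$, and there is a super-replicating semi-static strategy whose cost equals $\mathcal H^{\mathbb R^+,\mathcal T}(a,\mathbf C)$, i.e. is the lowest among all super-replicating semi-static strategies.
   Context: Fix $N\ge1$, $J\ge1$, times $0=t_0<t_1<\dots<t_N=T$, $\mathcal T=\{t_1,\dots,t_N\}$, $s_0>0$, strikes $0=x_0<x_1<\dots<x_J$ (discounted prices, zero interest). Call prices $\mathbf C=(c_{j,n})_{0\le j\le J,1\le n\le N}$ (payoff $(X_{t_n}-x_j)^+$ at $t_n$, $c_{0,n}=s_0$) satisfy: $s_0=c_{0,n}>c_{1,n}>\dots>c_{J,n}>0$; $1>\frac{c_{0,n}-c_{1,n}}{x_1}>\frac{c_{1,n}-c_{2,n}}{x_2-x_1}>\dots>\frac{c_{J-1,n}-c_{J,n}}{x_J-x_{J-1}}>0$; $c_{j,n+1}>c_{j,n}$ for $1\le j\le J$, $1\le n\le N-1$. Let $\hat p_{0,n}=1-\frac{s_0-c_{1,n}}{x_1}$, $\hat p_{j,n}=\frac{c_{j-1,n}-c_{j,n}}{x_j-x_{j-1}}-\frac{c_{j,n}-c_{j+1,n}}{x_{j+1}-x_j}$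 ($1\le j<J$), $\hat p_{J,n}=\frac{c_{J-1,n}-c_{J,n}}{x_J-x_{J-1}}$, $\hat p_{J+1,n}=c_{J,n}$. The payoff $a:[0,\infty)\times\mathcal T\to[0,\infty)$ is convex in its first argument with $\ell_n:=\lim_{x\uparrow\infty}a(x,t_n)/x<R<\infty$ for each $n$. Models: $\mathcal M^{\mathbb R^+,\mathcal T}(\mathbf C)$ is the set of filtered probability spaces $(\mathcal F_{t_n})_{0\le n\le N}$ (not necessarily generated by $X$) with an adapted martingale $(X_{t_n})$, $X_{t_0}=s_0$, $X_{t_n}\ge0$, $\mathbb E[(X_{t_n}-x_j)^+]=c_{j,n}$ for all $j,n$; $\phi(M)=\sup_\tau\mathbb E^M[a(X_\tau,\tau)]$ over stopping times with values in $\mathcal T$; $\mathcal P^{\mathbb R^+,\mathcal T}(a,\mathbf C)=\sup_M\phi(M)$. Strategies: a semi-static strategy holds a static portfolio of bonds, stock and traded calls (cost $H$ computed from $\mathbf C$) and bounded stock holdings $\Theta^1_{t_n}(x_{t_1},\dots,x_{t_n})$ over $[t_n,t_{n+1}]$ before exercise and $\Theta^2_{t_n}(x_{t_1},\dots,x_{t_n},\rho)$ from the exercise date $\rho\in\mathcal T$ on ($1\le n\le N-1$). It super-replicates if its terminal payoff is $\ge a(x_\rho,\rho)$ for all paths in $[0,\infty)^N$ and all $\rho\in\mathcal T$. $\mathcal H^{\mathbb R^+,\mathcal T}(a,\mathbf C)$ is the infimum of costs of super-replicating strategies. Hedging LP $\mathbf L_H^{\mathcal X,\infty,\mathcal T}$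 (value $\Psi^{\mathcal X,\infty,\mathcal T}(a,\mathbf C)$): over reals $e^1_{j,n},e^2_{j,n},v_{j,n}$ ($0\le j\le J+1$, $1\le n\le N$), $d^1_{j,n},d^2_{j,n}$ ($1\le n\le N-1$), $e^1_{j,N}=e^2_{j,1}=0$, minimise $\sum_n\sum_{j=0}^{J+1}(e^1_{j,n}+e^2_{j,n})\hat p_{j,n}+\sum_{j=0}^{J+1}v_{j,N}\hat p_{j,N}$ subject to $v_{j,n}\ge0$ and: (i) $v_{j,n}\ge a(x_j,t_n)$ ($0\le j\le J$), $v_{J+1,n}\ge\ell_n$; (ii) $e^1_{j,n}+e^2_{k,n+1}+(x_k-x_j)d^1_{j,n}\ge0$ ($0\le j,k\le J$), $e^1_{J+1,n}-d^1_{J+1,n}\ge0$, $e^2_{J+1,n+1}+d^1_{j,n}\ge0$ ($0\le j\le J$), $e^1_{J+1,n}+e^2_{J+1,n+1}\ge0$; (iii) $e^1_{j,n}+e^2_{k,n+1}+(x_k-x_j)d^2_{j,n}-v_{j,n}+v_{k,n+1}\ge0$ ($0\le j,k\le J$), $e^1_{J+1,n}-d^2_{J+1,n}-v_{J+1,n}\ge0$, $e^2_{J+1,n+1}+d^2_{j,n}+v_{J+1,n+1}\ge0$ ($0\le j\le J$), $e^1_{J+1,n}+e^2_{J+1,n+1}-v_{J+1,n}+v_{J+1,n+1}\ge0$ ($1\le n\le N$ in (i), $1\le n\le N-1$ in (ii),(iii)). Pricing LP $\mathbf L_P^{\mathcal X,\infty,\mathcal T}$ (value $\Phi^{\mathcal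 X,\infty,\mathcal T}(a,\mathbf C)$): over $f_{j,n}\ge0$ ($0\le j\le J+1$, $1\le n\le N$) and $g^\delta_{j,k,n}\ge0$ ($\delta\in\{1,2\}$, $0\le j,k\le J+1$, $1\le n\le N-1$), maximise $\sum_{n}\sum_{j=0}^{J}a(x_j,t_n)f_{j,n}+\sum_nf_{J+1,n}\ell_n$ subject to: (a) $\sum_{k=0}^{J}(g^1_{j,k,n}+g^2_{j,k,n})=\hat p_{j,n}$ ($0\le j\le J$) and $\sum_{k=0}^{J+1}(g^1_{J+1,k,n}+g^2_{J+1,k,n})=\hat p_{J+1,n}$, $1\le n\le N-1$; (b) $\sum_{i=0}^{J}(g^1_{i,j,n-1}+g^2_{i,j,n-1})=\hat p_{j,n}$ ($0\le j\le J$) and $\sum_{i=0}^{J+1}(g^1_{i,J+1,n-1}+g^2_{i,J+1,n-1})=\hat p_{J+1,n}$, $2\le n\le N$; (c),(d) for $\delta=1,2$, $1\le n\le N-1$: $\sum_{k=0}^{J}(x_k-x_j)g^\delta_{j,k,n}+g^\delta_{j,J+1,n}=0$ ($0\le j\le J$) and $\sum_{k=0}^{J}g^\delta_{J+1,k,n}=0$; (e) $f_{j,1}-\sum_{k=0}^Jg^2_{j,k,1}\le0$ ($0\le j\le J$), $f_{J+1,1}-\sum_{k=0}^{J+1}g^2_{J+1,k,1}\le0$; for $1<n<N$: $f_{j,n}-\sum_{k=0}^Jg^2_{j,k,n}+\sum_{i=0}^Jg^2_{i,j,n-1}\le0$ ($0\le j\le J$) and $f_{J+1,n}-\sum_{k=0}^{J+1}g^2_{J+1,k,n}+\sum_{i=0}^{J+1}g^2_{i,J+1,n-1}\le0$;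 $f_{j,N}+\sum_{i=0}^Jg^2_{i,j,N-1}\le\hat p_{j,N}$ ($0\le j\le J$) and $f_{J+1,N}+\sum_{i=0}^{J+1}g^2_{i,J+1,N-1}\le\hat p_{J+1,N}$. *)

(* Defs.v *)
From HB Require Import structures.
From mathcomp Require Import all_boot all_order all_algebra.
From mathcomp Require Import all_classical all_reals all_analysis.
Set Implicit Arguments. Unset Strict Implicit. Unset Printing Implicit Defensive.
Import Order.TTheory GRing.Theory Num.Theory.
Local Open Scope classical_set_scope.
Local Open Scope ring_scope.

(* Conventions: time t_n is represented by its index n
   (1 <= n <= N), strike x_j by [x j] (0 <= j <= J), call price c_{j,n}
   by [c j n], the payoff a(y, t_n) by [a y n], l_n by [l n].
   The index J.+1 stands for the "point at infinity". *)

Section Defs.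
Variable R : realType.

Definition slope (x : nat -> R) (c : nat -> nat -> R) (j n : nat) : R :=
  (c j.-1 n - c j n) / (x j - x j.-1).

Definition phat (J : nat) (s0 : R) (x : nat -> R) (c : nat -> nat -> R)
    (j n : nat) : R :=
  if j == 0%N then 1 - (s0 - c 1%N n) / x 1%N
  else if (j < J)%N then slope x c j n - slope x c j.+1 n
  else if j == J then slope x c J n
  else c J n.

Definition hedgeLP_feasible (N J : nat) (x : nat -> R) (a : R -> nat -> R)
    (l : nat -> R) (e1 e2 v d1 d2 : nat -> nat -> R) : Prop :=
  [/\ (forall j, (j <= J.+1)%N -> e1 j N = 0 /\ e2 j 1%N = 0),
      (forall j n, (j <= J.+1)%N -> (1 <= n <= N)%N -> 0 <= v j n),
      (forall n, (1 <= n <= N)%N ->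
         (forall j, (j <= J)%N -> a (x j) n <= v j n) /\ l n <= v J.+1 n),
      (forall n, (1 <= n < N)%N ->
         [/\ (forall j k, (j <= J)%N -> (k <= J)%N ->
                0 <= e1 j n + e2 k n.+1 + (x k - x j) * d1 j n),
             0 <= e1 J.+1 n - d1 J.+1 n,
             (forall j, (j <= J)%N -> 0 <= e2 J.+1 n.+1 + d1 j n) &
             0 <= e1 J.+1 n + e2 J.+1 n.+1]) &
      (forall n, (1 <= n < N)%N ->
         [/\ (forall j k, (j <= J)%N -> (k <= J)%N ->
                0 <= e1 j n + e2 k n.+1 + (x k - x j) * d2 j n - v j n + v k n.+1),
             0 <= e1 J.+1 n - d2 J.+1 n - v J.+1 n,
             (forall j, (j <= J)%N -> 0 <= e2 J.+1 n.+1 + d2 j n + v J.+1 n.+1) &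
             0 <= e1 J.+1 n + e2 J.+1 n.+1 - v J.+1 n + v J.+1 n.+1])].

Definition hedgeLP_obj (N J : nat) (s0 : R) (x : nat -> R)
    (c : nat -> nat -> R) (e1 e2 v : nat -> nat -> R) : R :=
  \sum_(1 <= n < N.+1) \sum_(0 <= j < J.+2)
      (e1 j n + e2 j n) * phat J s0 x c j n
  + \sum_(0 <= j < J.+2) v j N * phat J s0 x c j N.

Definition Psi (N J : nat) (s0 : R) (x : nat -> R) (c : nat -> nat -> R)
    (a : R -> nat -> R) (l : nat -> R) : \bar R :=
  ereal_inf [set y | exists e1 e2 v d1 d2,
    hedgeLP_feasible N J x a l e1 e2 v d1 d2 /\
    y = (hedgeLP_obj N J s0 x c e1 e2 v)%:E].

Definition LP_mart (J : nat) (x : nat -> R) (g : nat -> nat -> nat -> R)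
    (n : nat) : Prop :=
  (forall j, (j <= J)%N ->
     \sum_(0 <= k < J.+1) (x k - x j) * g j k n + g j J.+1 n = 0) /\
  \sum_(0 <= k < J.+1) g J.+1 k n = 0.

Definition pricingLP_feasible (N J : nat) (s0 : R) (x : nat -> R)
    (c : nat -> nat -> R) (f : nat -> nat -> R)
    (g1 g2 : nat -> nat -> nat -> R) : Prop :=
  let p := phat J s0 x c in
  [/\ (forall j n, (j <= J.+1)%N -> (1 <= n <= N)%N -> 0 <= f j n) /\
      (forall j k n, (j <= J.+1)%N -> (k <= J.+1)%N -> (1 <= n < N)%N ->
         0 <= g1 j k n /\ 0 <= g2 j k n),
      (forall n, (1 <= n < N)%N ->
         (forall j, (j <= J)%N ->
            \sum_(0 <= k < J.+1) (g1 j k n + g2 j k n) = p j n) /\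
         \sum_(0 <= k < J.+2) (g1 J.+1 k n + g2 J.+1 k n) = p J.+1 n),
      (forall n, (2 <= n <= N)%N ->
         (forall j, (j <= J)%N ->
            \sum_(0 <= i < J.+1) (g1 i j n.-1 + g2 i j n.-1) = p j n) /\
         \sum_(0 <= i < J.+2) (g1 i J.+1 n.-1 + g2 i J.+1 n.-1) = p J.+1 n),
      (forall n, (1 <= n < N)%N -> LP_mart J x g1 n /\ LP_mart J x g2 n) &
      (forall n, (1 <= n < N)%N ->
         (forall j, (j <= J)%N ->
            f j n - \sum_(0 <= k < J.+1) g2 j k n
              + (if (1 < n)%N then \sum_(0 <= i < J.+1) g2 i j n.-1 else 0)
            <= 0) /\
         f J.+1 n - \sum_(0 <= k < J.+2) g2 J.+1 k n
           + (if (1 < n)%N then \sum_(0 <= i < J.+2) g2 i J.+1 n.-1 else 0)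
         <= 0) /\
      ((forall j, (j <= J)%N ->
          f j N + (if (1 < N)%N then \sum_(0 <= i < J.+1) g2 i j N.-1 else 0)
          <= p j N) /\
        f J.+1 N + (if (1 < N)%N then \sum_(0 <= i < J.+2) g2 i J.+1 N.-1 else 0)
          <= p J.+1 N)].

Definition pricingLP_obj (N J : nat) (x : nat -> R) (a : R -> nat -> R)
    (l : nat -> R) (f : nat -> nat -> R) : R :=
  \sum_(1 <= n < N.+1) \sum_(0 <= j < J.+1) a (x j) n * f j n
  + \sum_(1 <= n < N.+1) f J.+1 n * l n.

Definition Phi (N J : nat) (s0 : R) (x : nat -> R) (c : nat -> nat -> R)
    (a : R -> nat -> R) (l : nat -> R) : \bar R :=
  ereal_sup [set y | exists f g1 g2,
    pricingLP_feasible N J s0 x c f g1 g2 /\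
    y = (pricingLP_obj N J x a l f)%:E].

Record model := Model {
  mdl_disp : measure_display;
  mdl_Omega : measurableType mdl_disp;
  mdl_P : probability mdl_Omega R;
  mdl_F : nat -> set (set mdl_Omega);
  mdl_X : nat -> mdl_Omega -> R }.
Arguments mdl_P : clear implicits.
Arguments mdl_F : clear implicits.
Arguments mdl_X : clear implicits.

Definition is_model (N J : nat) (s0 : R) (x : nat -> R) (c : nat -> nat -> R)
    (M : model) : Prop :=
  let P := mdl_P M in let F := mdl_F M in let X := mdl_X M in
  [/\
      (forall n, (n <= N)%N -> sigma_algebra setT (F n) /\ F n `<=` measurable) /\
      (forall n, (n < N)%N -> F n `<=` F n.+1),
      (forall n, (n <= N)%N -> forall B : set R, measurable B ->
         F n (X n @^-1` B)) /\
      (forall n, (n <= N)%N -> P.-integrable setT (EFin \o X n)),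
      (forall n, (n < N)%N -> forall A, F n A ->
         (\int[P]_(w in A) (X n.+1 w)%:E = \int[P]_(w in A) (X n w)%:E)%E),
      (forall w, X 0%N w = s0) /\ (forall n w, (1 <= n <= N)%N -> 0 <= X n w) &
      (forall j n, (j <= J)%N -> (1 <= n <= N)%N ->
         (\int[P]_w (Num.max (X n w - x j) 0)%:E = (c j n)%:E)%E)].

Definition is_stopping_time (N : nat) (M : model) (tau : mdl_Omega M -> nat)
    : Prop :=
  (forall w, (1 <= tau w <= N)%N) /\
  (forall n, (1 <= n <= N)%N -> mdl_F M n [set w | tau w = n]).

Arguments is_stopping_time : clear implicits.

Definition phi (N : nat) (a : R -> nat -> R) (M : model) : \bar R :=
  ereal_sup [set y | exists tau, is_stopping_time N M tau /\
    y = (\int[mdl_P M]_w (a (mdl_X M (tau w) w) (tau w))%:E)%E].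

Definition Pmodel (N J : nat) (s0 : R) (x : nat -> R) (c : nat -> nat -> R)
    (a : R -> nat -> R) : \bar R :=
  ereal_sup [set y | exists M, is_model N J s0 x c M /\ y = phi N a M].

(* beta : bonds; lam j n : number of calls with strike x_j, maturity t_n
   (j = 0 is the stock, a call with strike 0);
   th1 n path : holding over [t_n, t_{n+1}] before exercise,
   th2 n path rho : holding over [t_n, t_{n+1}] once exercised at rho <= n;
   paths are maps n |-> x_{t_n}. *)
Definition nonneg_path (N : nat) (path : nat -> R) : Prop :=
  forall n, (1 <= n <= N)%N -> 0 <= path n.

Definition superreplicates (N J : nat) (x : nat -> R) (a : R -> nat -> R)
    (beta : R) (lam : nat -> nat -> R) (th1 : nat -> (nat -> R) -> R)
    (th2 : nat -> (nat -> R) -> nat -> R) : Prop :=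
  [/\
      (forall n path path', (1 <= n < N)%N ->
         (forall k, (1 <= k <= n)%N -> path k = path' k) ->
         th1 n path = th1 n path' /\ (forall rho, th2 n path rho = th2 n path' rho)),
      (exists K : R, forall n path, (1 <= n < N)%N -> nonneg_path N path ->
         `|th1 n path| <= K /\
         (forall rho, (1 <= rho <= N)%N -> `|th2 n path rho| <= K)) &
      (forall path rho, nonneg_path N path -> (1 <= rho <= N)%N ->
         a (path rho) rho <=
           beta + \sum_(1 <= n < N.+1) \sum_(0 <= j < J.+1)
                     lam j n * Num.max (path n - x j) 0
           + \sum_(1 <= n < N)
               (if (n < rho)%N then th1 n path else th2 n path rho)
                 * (path n.+1 - path n))].

Definition strategy_cost (N J : nat) (c : nat -> nat -> R) (beta : R)
    (lam : nat -> nat -> R) : R :=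
  beta + \sum_(1 <= n < N.+1) \sum_(0 <= j < J.+1) lam j n * c j n.

Definition Hsuper (N J : nat) (x : nat -> R) (c : nat -> nat -> R)
    (a : R -> nat -> R) : \bar R :=
  ereal_inf [set y | exists beta lam th1 th2,
    superreplicates N J x a beta lam th1 th2 /\
    y = (strategy_cost N J c beta lam)%:E].

End Defs.

(* Main.v *)
Require Import Defs.
From HB Require Import structures.
From mathcomp Require Import all_boot all_order all_algebra.
From mathcomp Require Import all_classical all_reals all_analysis.
From mathcomp Require Import ring lra.
Import Order.TTheory GRing.Theory Num.Theory.
Import numFieldNormedType.Exports.
Local Open Scope classical_set_scope.
Local Open Scope ring_scope.
Set Implicit Arguments.
Unset Strict Implicit.
Unset Printing Implicit Defensive.

(* For each of the two regimes (before and after exercise) the hedge sees one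
   period at a time, so both linear programs are instances of one finite linear
   program on the nodes x_0, ..., x_J and a further node; the further node is
   either a large number K or the point at infinity.

   An optimal hedge of the limit program extends to a super-replicating strategy
   whose dynamic holdings are step functions of the current price, which bounds
   the super-replication price and every model price from above.

   Conversely, a hedge of the grid with node K, after replacing the values at K
   by slopes, is a hedge of the limit program up to an error that vanishes as K
   tends to infinity.  By duality, optimal solutions of the pricing program on
   the grid have almost the limit value; read as the transition masses of a
   Markov chain with an exercise flag, they are models that fit the call prices
   exactly.  Since such a model has finite support, it also bounds from below
   the cost of strategies with non-measurable holdings. *)

(** * Farkas' lemma and linear programming duality *)

(** The number [phat J.+1 n], which is [c J n], is not a probability but the price of one unit of
    slope beyond [x J]. The node [K] has weight [c J n / (K - x J)]: the mass disappears as [K]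
    grows while its contribution to the first moment stays. A solution of the limit program can
    therefore not be read directly as a model, and models only approach the value. The passage to
    the limit is made on the hedging side because hedges can be controlled there. Every one-period
    cost is nonnegative and at most the total cost, and the weight at [x J] stays above a fixed
    [del]. This bounds the slack of a hedge at [x J], and turning values at [K] into slopes divides
    that bound by [K - x J]. One-period costs are nonnegative because the weights increase in convex
    order with the date; this enters through a convex envelope placed between the two halves of a
    hedge, so no martingale coupling has to be constructed. A solution of the pricing program may
    exercise only part of the mass at a node. The exercise flag must then be part of the
    information, so the filtration is larger than the one generated by prices. *)

Section LinearProgramming.
Variable R : realFieldType.

Lemma sum_option (T : finType) (F : option T -> R) :
  \sum_o F o = F None + \sum_i F (Some i).
Proof.
by rewrite ![index_enum _]unlock [@Finite.enum in LHS]unlock/= big_cons big_map.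
Qed.

Implicit Types V : lmodType R.

(* Induction on the number of functionals (Bartl's proof), which needs no
   finite-dimensionality of [V]. *)
Lemma farkas V (m : nat) (A : nat -> V -> R) (C : V -> R) :
  (forall i, (i < m)%N -> scalar (A i)) -> scalar C ->
  (forall y, (forall i, (i < m)%N -> A i y <= 0) -> C y <= 0) ->
  exists2 lam : nat -> R, (forall i, (i < m)%N -> 0 <= lam i) &
    forall y, C y = \sum_(i < m) lam i * A i y.
Proof.
elim: m A C => [|m IHm] A C linA linC AC.
  exists (fun=> 0) => // y; rewrite big_ord0.
  have C0 : C 0 = 0.
    by have := linC (-1) 0 0; rewrite scaler0 addr0 mulN1r addNr.
  have CN : C (- y) = - C y.
    by have := linC (-1) y 0; rewrite scaleN1r addr0 C0 addr0 mulN1r.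
  apply/eqP; rewrite eq_le AC //= -oppr_le0 -CN AC //.
have linAm i : (i < m)%N -> scalar (A i) by move=> im; apply/linA/ltnW.
have [AmC|] := pselect (forall y, (forall i, (i < m)%N -> A i y <= 0) -> C y <= 0).
  have [lam lam0 CE] := IHm A C linAm linC AmC.
  exists (fun i => if (i < m)%N then lam i else 0) => [i _|y].
    by case: ifP => // /lam0.
  rewrite big_ord_recr /= ltnn mul0r addr0 CE.
  by apply: eq_bigr => i _; rewrite ltn_ord.
move=> /existsNP[z /not_implyP[Az /negP]]; rewrite -ltNge => Cz.
have Amz : 0 < A m z.
  rewrite ltNge; apply: contraTN Cz => Amz; rewrite -leNgt; apply: AC => i.
  by rewrite ltnS leq_eqVlt => /predU1P[->//|]; apply: Az.
(* [y - al y *: z] is the projection of [y] along [z] onto the kernel of [A m]; [A'] and [C'] are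
   the functionals after this projection, where the last constraint has become trivial. *)
pose al y := A m y / A m z.
pose A' i y := A i y - A i z * al y.
pose C' y := C y - C z * al y.
have linA' i : (i < m)%N -> scalar (A' i).
  move=> im k u v; rewrite /A' /al (linAm i im) (linA m (ltnSn m)).
  by field; apply/lt0r_neq0.
have linC' : scalar C'.
  move=> k u v; rewrite /C' /al linC (linA m (ltnSn m)).
  by field; apply/lt0r_neq0.
have projE (f : V -> R) : scalar f -> forall y, f (- al y *: z + y) = f y - f z * al y.
  by move=> linf y; rewrite linf; ring.
have [y Ay|lam lam0 CE] := IHm A' C' linA' linC'.
  rewrite /C' -projE //; apply: AC => i; rewrite ltnS leq_eqVlt.
  move=> /predU1P[->|im]; last by rewrite projE; [exact: Ay|exact: linAm].
  rewrite projE; last exact: linA.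
  by rewrite /al mulrC divfK ?lt0r_neq0// subrr.
(* The last multiplier is forced by evaluating the identity at [z]; it is nonnegative because
   [A j z <= 0] for [j < m] while [0 < C z]. *)
exists (fun i => if (i < m)%N then lam i else
   (C z - \sum_(j < m) lam j * A j z) / A m z) => [i _|y].
  case: ifP => [/lam0//|_]; rewrite divr_ge0 ?(ltW Amz)// subr_ge0.
  apply: le_trans (ltW Cz); apply: sumr_le0 => j _.
  by rewrite mulr_ge0_le0 ?lam0 ?Az.
rewrite big_ord_recr /= ltnn.
have -> : C y = C' y + C z * al y by rewrite /C' subrK.
rewrite CE (eq_bigr (fun i : 'I_m => lam i * A i y - lam i * A i z * al y)); last first.
  by move=> i _; rewrite mulrBr mulrA.
rewrite sumrB -mulr_suml.
rewrite [in RHS](eq_bigr (fun i : 'I_m => lam i * A i y)); last first.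
  by move=> i _; rewrite ltn_ord.
rewrite /al.
by field; apply/lt0r_neq0.
Qed.

Lemma farkas_fin V (I : finType) (A : I -> V -> R) (C : V -> R) :
  (forall i, scalar (A i)) -> scalar C ->
  (forall y, (forall i, A i y <= 0) -> C y <= 0) ->
  exists2 lam : I -> R, (forall i, 0 <= lam i) &
    forall y, C y = \sum_i lam i * A i y.
Proof.
move=> linA linC AC.
have [i0 _|I0] := pickP (@predT I); last first.
  have [//|y _|lam _ CE] := @farkas V 0 (fun _ _ => 0) C _ linC.
    by apply: AC => i; have := I0 i.
  exists (fun=> 0) => // y; rewrite CE big_ord0 big1 // => i.
  by have := I0 i.
pose B i := A (nth i0 (enum I) i).
have Benum i : B (enum_rank i) = A i by rewrite /B nth_enum_rank.
have [||lam lam0 CE] := @farkas V #|I| B C _ linC.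
- by move=> *; exact: linA.
- move=> y By; apply: AC => i; rewrite -Benum; exact: By.
exists (fun i => lam (enum_rank i)) => [i|y]; first exact: lam0.
rewrite CE (reindex (@enum_rank I)); last by apply: onW_bij; exact: enum_rank_bij.
by apply: eq_bigr => i _; rewrite Benum.
Qed.

Lemma farkas_affine V (I : finType) (A : I -> V -> R) (b : I -> R) :
  (forall i, scalar (A i)) ->
  (forall y, ~ forall i, b i <= A i y) ->
  exists lam : I -> R, [/\ forall i, 0 <= lam i,
    forall y, \sum_i lam i * A i y = 0 & \sum_i lam i * b i = 1].
Proof.
move=> linA infeas.
have A0 i : A i 0 = 0.
  by have := linA i (-1) 0 0; rewrite scaler0 addr0 mulN1r addNr.
have [i||y yA|lam lam0 CE] := @farkas_fin (V * R^o)%type I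
   (fun i z => b i * z.2 - A i z.1) (fun z => z.2).
- by move=> k [u s] [v t] /=; rewrite (linA i) (_ : k *: s = k * s)//; ring.
- by move=> k u v.
- rewrite leNgt; apply/negP => y0.
  apply: (infeas (y.2^-1 *: y.1)) => i.
  have := linA i y.2^-1 y.1 0; rewrite addr0 A0 addr0 => ->.
  rewrite ler_pdivlMl// mulrC.
  by rewrite -subr_le0 yA.
exists lam; split=> // [y|].
  have /= := CE (y, 0); under eq_bigr do rewrite mulr0 sub0r mulrN.
  by rewrite sumrN => /esym/eqP; rewrite oppr_eq0 => /eqP.
have /= := CE (0, 1); under eq_bigr do rewrite mulr1 A0 subr0.
by move=> <-.
Qed.

End LinearProgramming.

Section LinearProgrammingDuality.
Variables (R : realType) (V : lmodType R) (I : finType).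
Variables (A : I -> V -> R) (b : I -> R) (C : V -> R).
Hypotheses (linA : forall i, scalar (A i)) (linC : scalar C).

Let feasible y := forall i, b i <= A i y.

Let C0 : C 0 = 0.
Proof. by have := linC (-1) 0 0; rewrite scaler0 addr0 mulN1r addNr. Qed.

Let A0 i : A i 0 = 0.
Proof. by have := linA i (-1) 0 0; rewrite scaler0 addr0 mulN1r addNr. Qed.

(** Homogenisation again, now with the row [0 <= s], indexed by [None]. Its multiplier is what turns
    the identity at [(0, 1)] into the inequality for [m]. *)
Lemma lp_dual_exists (m : R) y0 : feasible y0 ->
  (forall y, feasible y -> m <= C y) ->
  exists lam : I -> R, [/\ forall i, 0 <= lam i,
    forall y, C y = \sum_i lam i * A i y & m <= \sum_i lam i * b i].
Proof.
move=> y0f Cm.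
have [[i|]||y yA|lam lam0 CE] := @farkas_fin R (V * R^o)%type (option I)
   (fun o z => if o is Some i then b i * z.2 - A i z.1 else - z.2)
   (fun z => m * z.2 - C z.1).
- by move=> k [u s] [v t] /=; rewrite (linA i) (_ : k *: s = k * s)//; ring.
- by move=> k [u s] [v t] /=; rewrite (_ : k *: s = k * s)//; ring.
- by move=> k [u s] [v t] /=; rewrite linC (_ : k *: s = k * s)//; ring.
- have := yA None; rewrite oppr_le0 le_eqVlt => /predU1P[y2|y2].
    rewrite -y2 mulr0 sub0r oppr_le0.
    have yAi i : 0 <= A i y.1 by have := yA (Some i); rewrite -y2 mulr0 sub0r oppr_le0.
    rewrite leNgt; apply/negP => Cy.
    (* For [s = 0] the vector is a recession direction. If it decreased [C], then moving from [y0]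
       by [k] along it would give the value [m - 1], below the lower bound. *)
    pose k := (C y0 - m + 1) / - C y.1.
    have k0 : 0 <= k.
      by rewrite divr_ge0 ?oppr_ge0 ?(ltW Cy)// addr_ge0// subr_ge0 Cm.
    have /Cm : feasible (k *: y.1 + y0).
      move=> i; rewrite (linA i); apply: le_trans (y0f i) _.
      by rewrite lerDr mulr_ge0.
    rewrite linC /k invrN mulrN mulNr divfK ?lt_eqF//; lra.
  rewrite subr_le0.
  have /Cm : feasible (y.2^-1 *: y.1).
    move=> i; have := linA i y.2^-1 y.1 0; rewrite addr0 A0 addr0 => ->.
    by rewrite ler_pdivlMl// mulrC -subr_le0 (yA (Some i)).
  have := linC y.2^-1 y.1 0; rewrite addr0 C0 addr0 => ->.
  by rewrite ler_pdivlMl// mulrC.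
exists (lam \o Some); split=> [i|y|]; first exact: lam0.
  have /= := CE (y, 0); rewrite mulr0 sub0r sum_option/= oppr0 mulr0 add0r.
  under eq_bigr do rewrite mulr0 sub0r mulrN.
  by rewrite sumrN => /oppr_inj.
have /= := CE (0, 1); rewrite mulr1 C0 subr0 sum_option/= mulrN1.
under eq_bigr do rewrite mulr1 A0 subr0.
by move=> ->; rewrite gerDr oppr_le0.
Qed.

Lemma lp_strong_duality (m : R) y0 : feasible y0 ->
  (forall y, feasible y -> m <= C y) ->
  exists y lam, [/\ feasible y, forall i, 0 <= lam i,
    forall y, C y = \sum_i lam i * A i y & C y = \sum_i lam i * b i].
Proof.
move=> y0f Cm.
pose S := [set C y | y in [set y | feasible y]].
have S0 : S !=set0 by exists (C y0), y0.
have Sm : lbound S m by move=> _ [y yf <-]; exact: Cm.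
have Sinf : has_inf S by split => //; exists m.
have CS y : feasible y -> inf S <= C y.
  by move=> yf; apply: ge_inf; [exists m|exists y].
have weak lam y : (forall i, 0 <= lam i) -> feasible y ->
    \sum_i lam i * b i <= \sum_i lam i * A i y.
  by move=> lam0 yf; apply: ler_sum => i _; rewrite ler_wpM2l.
(* Attainment without compactness: otherwise the constraints together with [C y <= inf S] are
   infeasible. A certificate [mu] with [mu None = 0] contradicts the feasibility of [y0]; with
   [mu None > 0] it raises the lower bound of [S] by the inverse of [mu None]. *)
have [y [yf Cy]] : exists y, feasible y /\ C y <= inf S.
  apply: contrapT => nexy.
  have [[i|]|y yA|mu [mu0 muA mub]] := @farkas_affine R V (option I)
    (fun o y => if o is Some i then A i y else - C y)
    (fun o => if o is Some i then b i else - inf S).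
  - exact: linA.
  - by move=> k u v; rewrite linC; ring.
  - apply: nexy; exists y; split => [i|]; first exact: (yA (Some i)).
    by have := yA None; rewrite lerN2.
  have {muA}muA y : \sum_i mu (Some i) * A i y = mu None * C y.
    by have := muA y; rewrite sum_option /= mulrN addrC => /eqP; rewrite subr_eq0 => /eqP.
  rewrite sum_option/= mulrN in mub.
  have := mu0 None; rewrite le_eqVlt => /predU1P[mu00|mu00].
    have := weak (mu \o Some) y0 (fun i => mu0 _) y0f.
    by move: mub; rewrite /= muA -mu00; lra.
  suff : inf S + (mu None)^-1 <= inf S.
    by rewrite gerDl leNgt invr_gt0 mu00.
  apply: lb_le_inf => // _ [y yf <-].
  have := weak (mu \o Some) y (fun i => mu0 _) yf; rewrite /= muA => H.
  rewrite -(ler_pM2l mu00) mulrDr divff ?gt_eqF//; lra.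
have [lam [lam0 CE lamb]] := lp_dual_exists y0f CS.
exists y, lam; split=> //; apply/eqP; rewrite eq_le (le_trans Cy lamb) /=.
by rewrite CE weak.
Qed.

End LinearProgrammingDuality.

(** * The linear program for exercise at a finite number of dates *)

Section SumLemmas.
Variable V : nmodType.

Lemma sum_ord_if (F : nat -> V) a b K : (b <= K)%N ->
  \sum_(i < K) (if (a <= i < b)%N then F i else 0) = \sum_(a <= i < b) F i.
Proof.
move=> bK; rewrite big_geq_mkord (big_ord_widen_cond K (fun i => a <= i)%N F)//.
by rewrite [in RHS]big_mkcond.
Qed.

Lemma sum_nat_last (F : nat -> V) N : (1 <= N)%N ->
  \sum_(1 <= n < N.+1) (if (n < N)%N then F n else 0) = \sum_(1 <= n < N) F n.
Proof.
move=> N1; rewrite big_nat_recr//= ltnn addr0.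
by apply: eq_big_nat => n /andP[_ ->].
Qed.

Lemma sum_nat_shift (F : nat -> V) N : (1 <= N)%N ->
  \sum_(1 <= n < N) F n.+1 = \sum_(1 <= n < N.+1) (if (1 < n)%N then F n else 0).
Proof.
move=> N1; rewrite [RHS]big_ltn ?ltnS//= add0r [RHS]big_add1/=.
by apply: eq_big_nat => n /andP[n1 _]; rewrite ltnS n1.
Qed.

Lemma sum_nat_only (F : nat -> V) N : (1 <= N)%N ->
  \sum_(1 <= n < N.+1) (if (n < N)%N then 0 else F n) = F N.
Proof.
move=> N1; rewrite big_nat_recr//= ltnn big_nat big1 ?add0r//.
by move=> n /andP[_ ->].
Qed.

End SumLemmas.

Lemma sum_pair_swap (V : nmodType) (T1 T2 : finType) (F : T1 * T2 -> V) :
  \sum_i F i = \sum_n \sum_j F (j, n).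
Proof. by rewrite exchange_big pair_bigA; apply: eq_bigr => -[]. Qed.

Lemma sum_quad (V : nmodType) (T1 T2 T3 : finType) (F : T1 * T2 * T3 * bool -> V) :
  \sum_i F i = \sum_n \sum_j \sum_k (F (j, k, n, false) + F (j, k, n, true)).
Proof.
transitivity (\sum_jk \sum_n \sum_b F (jk, n, b)).
  by rewrite !pair_bigA; apply: eq_bigr => -[[[]]].
rewrite exchange_big; apply: eq_bigr => n _; rewrite [RHS]pair_bigA /=.
by apply: eq_bigr => -[j k] _; rewrite big_bool addrC.
Qed.

Lemma sum_mul0 (R : pzRingType) (X : nat -> nat -> R) a b M :
  \sum_(a <= n < b) \sum_(0 <= j < M) 0 * X j n = 0.
Proof. by rewrite big1 // => n _; rewrite big1 // => j _; rewrite mul0r. Qed.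

Lemma sum_delta2 (R : pzRingType) (X : nat -> nat -> R) a b M j0 n0 :
  \sum_(a <= n < b) \sum_(0 <= j < M) ((j == j0) && (n == n0))%:R * X j n =
  if (j0 < M)%N && (a <= n0 < b)%N then X j0 n0 else 0.
Proof.
have [/andP[jM nab]|] := ifPn.
  rewrite (bigD1_seq n0) ?iota_uniq ?mem_index_iota //= (bigD1_seq j0) ?iota_uniq ?mem_index_iota//=.
  rewrite !eqxx mul1r big1 => [|j /negPf->]; last by rewrite mul0r.
  rewrite big1 ?addr0// => n /negPf nn0; rewrite big1// => j _.
  by rewrite nn0 andbF mul0r.
move=> H; rewrite big_nat big1// => n nab; rewrite big_nat big1// => j /= jM.
case: eqP => [jj0|]; case: eqP => [nn0|]; rewrite ?mul0r//.
by move: H; rewrite -jj0 -nn0 jM nab.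
Qed.

Section ExerciseLP.
Variables (R : realType) (N M : nat).
Variables (al be ga : nat -> nat -> R) (p w : nat -> nat -> R).

(* The common shape of the hedging LP on a finite grid and of its limit: the
   inequality for the move from node [j] to node [k] carries the weights
   [al j k], [be j k] and [ga j k], so that the node at infinity is covered by
   a special choice of these weights. *)
Definition grid_hedge (e1 e2 v d1 d2 : nat -> nat -> R) :=
  (forall j k n, (j < M)%N -> (k < M)%N -> (1 <= n < N)%N ->
    0 <= al j k * e1 j n + be j k * e2 k n.+1 + ga j k * d1 j n /\
    0 <= al j k * (e1 j n - v j n) + be j k * (e2 k n.+1 + v k n.+1)
         + ga j k * d2 j n) /\
  (forall j n, (j < M)%N -> (1 <= n <= N)%N -> w j n <= v j n).

Definition grid_cost (e1 e2 v : nat -> nat -> R) : R :=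
  \sum_(1 <= n < N) (\sum_(0 <= j < M) e1 j n * p j n
                     + \sum_(0 <= j < M) e2 j n.+1 * p j n.+1)
  + \sum_(0 <= j < M) v j N * p j N.

Definition grid_pricing (f : nat -> nat -> R) (g1 g2 : nat -> nat -> nat -> R) :=
  [/\ forall j n, (j < M)%N -> (1 <= n <= N)%N -> 0 <= f j n,
      forall j k n, (j < M)%N -> (k < M)%N -> (1 <= n < N)%N ->
        0 <= g1 j k n /\ 0 <= g2 j k n,
      forall j n, (j < M)%N -> (1 <= n < N)%N ->
        \sum_(0 <= k < M) al j k * (g1 j k n + g2 j k n) = p j n /\
        \sum_(0 <= i < M) be i j * (g1 i j n + g2 i j n) = p j n.+1,
      forall j n, (j < M)%N -> (1 <= n < N)%N ->
        \sum_(0 <= k < M) ga j k * g1 j k n = 0 /\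
        \sum_(0 <= k < M) ga j k * g2 j k n = 0 &
      forall j n, (j < M)%N -> (1 <= n <= N)%N ->
        f j n + (if (1 < n)%N then \sum_(0 <= i < M) be i j * g2 i j n.-1 else 0)
        <= if (n < N)%N then \sum_(0 <= k < M) al j k * g2 j k n else p j N].

Definition grid_price (f : nat -> nat -> R) : R :=
  \sum_(1 <= n < N.+1) \sum_(0 <= j < M) w j n * f j n.

Hypothesis N1 : (1 <= N)%N.

(** The pairing of multipliers with the constraints of a hedge. The first index of [y] selects the
    variable (0 to 4 for [e1], [e2], [v], [d1], [d2]), so that hedges become elements of a single
    module. *)
Let rows (y : nat -> nat -> nat -> R) (f : nat -> nat -> R)
    (g1 g2 : nat -> nat -> nat -> R) : R :=
  \sum_(1 <= n < N) \sum_(0 <= j < M) \sum_(0 <= k < M)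
    (g1 j k n * (al j k * y 0%N j n + be j k * y 1%N k n.+1 + ga j k * y 3 j n)
     + g2 j k n * (al j k * (y 0%N j n - y 2 j n)
                   + be j k * (y 1%N k n.+1 + y 2 k n.+1) + ga j k * y 4 j n))
  + \sum_(1 <= n < N.+1) \sum_(0 <= j < M) f j n * y 2 j n.

(** The coefficient of the variable [v] in [rows]: mass exercised at the date, plus exercised mass
    flowing in, minus exercised mass flowing out. *)
Let slack2 (f : nat -> nat -> R) (g2 : nat -> nat -> nat -> R) j n :=
  f j n + (if (1 < n)%N then \sum_(0 <= i < M) be i j * g2 i j n.-1 else 0)
  - (if (n < N)%N then \sum_(0 <= k < M) al j k * g2 j k n else 0).

Let rows_transpose y f g1 g2 : rows y f g1 g2 =
  \sum_(1 <= n < N) \sum_(0 <= j < M)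
     y 0%N j n * (\sum_(0 <= k < M) al j k * (g1 j k n + g2 j k n))
  + \sum_(1 <= n < N) \sum_(0 <= j < M)
     y 1%N j n.+1 * (\sum_(0 <= i < M) be i j * (g1 i j n + g2 i j n))
  + \sum_(1 <= n < N) \sum_(0 <= j < M)
     y 3 j n * (\sum_(0 <= k < M) ga j k * g1 j k n)
  + \sum_(1 <= n < N) \sum_(0 <= j < M)
     y 4 j n * (\sum_(0 <= k < M) ga j k * g2 j k n)
  + \sum_(1 <= n < N.+1) \sum_(0 <= j < M) y 2 j n * slack2 f g2 j n.
Proof.
rewrite /rows /slack2.
have -> : \sum_(1 <= n < N.+1) \sum_(0 <= j < M) y 2 j n * slack2 f g2 j n =
   \sum_(1 <= n < N.+1) \sum_(0 <= j < M) f j n * y 2 j n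
   + \sum_(1 <= n < N) \sum_(0 <= j < M)
       y 2 j n.+1 * (\sum_(0 <= i < M) be i j * g2 i j n)
   - \sum_(1 <= n < N) \sum_(0 <= j < M)
       y 2 j n * (\sum_(0 <= k < M) al j k * g2 j k n).
  have /= -> := sum_nat_shift (fun n => \sum_(0 <= j < M)
       y 2 j n * (\sum_(0 <= i < M) be i j * g2 i j n.-1)) N1.
  rewrite -(sum_nat_last _ N1).
  rewrite -big_split -sumrB /=; apply: eq_bigr => n _.
  rewrite /slack2; case: ifP => _; case: ifP => _.
  - by rewrite -big_split -sumrB /=; apply: eq_bigr => j _; ring.
  - by rewrite -big_split subr0 /=; apply: eq_bigr => j _; ring.
  - by rewrite addr0 -sumrB; apply: eq_bigr => j _; ring.
  - by rewrite addr0 subr0; apply: eq_bigr => j _; ring.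
rewrite [LHS]addrC -[X in _ = _ + X]addrA [RHS]addrCA; congr (_ + _).
rewrite -sumrN -!big_split /=; apply: eq_bigr => n _.
rewrite (eq_bigr (fun j => \sum_(0 <= k < M) (y 0%N j n * (al j k * (g1 j k n + g2 j k n))
   + y 3 j n * (ga j k * g1 j k n) + y 4 j n * (ga j k * g2 j k n)
   - y 2 j n * (al j k * g2 j k n))
   + \sum_(0 <= k < M) (y 1%N k n.+1 * (be j k * (g1 j k n + g2 j k n))
   + y 2 k n.+1 * (be j k * g2 j k n)))); last first.
  by move=> j _; rewrite -big_split /=; apply: eq_bigr => k _; ring.
rewrite big_split /= [X in _ + X]exchange_big /= -sumrN -!big_split /=.
apply: eq_bigr => j _.
rewrite 4!big_split sumrN /= -!mulr_sumr; ring.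
Qed.

Let cost_transpose (y : nat -> nat -> nat -> R) :
  grid_cost (y 0%N) (y 1%N) (y 2) =
  \sum_(1 <= n < N) \sum_(0 <= j < M) y 0%N j n * p j n
  + \sum_(1 <= n < N) \sum_(0 <= j < M) y 1%N j n.+1 * p j n.+1
  + \sum_(1 <= n < N.+1) \sum_(0 <= j < M)
      y 2 j n * (if (n < N)%N then 0 else p j N).
Proof.
rewrite /grid_cost big_split /=; congr (_ + _).
rewrite -(sum_nat_only (fun n => \sum_(0 <= j < M) y 2 j n * p j N)) //.
apply: eq_bigr => n _; case: ifP => // _; rewrite big1// => j _.
by rewrite mulr0.
Qed.

Lemma grid_weak_duality e1 e2 v d1 d2 f g1 g2 :
  (forall j n, (j < M)%N -> (1 <= n <= N)%N -> 0 <= w j n) ->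
  grid_hedge e1 e2 v d1 d2 -> grid_pricing f g1 g2 ->
  grid_price f <= grid_cost e1 e2 v.
Proof.
move=> w0 [rw vw] [f0 g0 AB Cg E].
pose y c := match c with 0%N => e1 | 1%N => e2 | 2%N => v | 3%N => d1 | _ => d2 end.
apply: (@le_trans _ _ (rows y f g1 g2)).
  rewrite /rows; apply: ler_wpDl.
    rewrite big_nat; apply: sumr_ge0 => n nN; rewrite big_nat; apply: sumr_ge0 => j jM.
    rewrite big_nat; apply: sumr_ge0 => k kM /=.
    have [? ?] := rw j k n jM kM nN; have [? ?] := g0 j k n jM kM nN.
    by rewrite addr_ge0 ?mulr_ge0.
  apply: ler_sum_nat => n nN; apply: ler_sum_nat => j jM.
  by rewrite mulrC ler_wpM2l ?f0// vw.
rewrite rows_transpose -[grid_cost e1 e2 v]/(grid_cost (y 0%N) (y 1%N) (y 2)) cost_transpose.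
rewrite [X in _ + X + _ + _ <= _]big_nat [X in _ + X + _ <= _]big_nat.
rewrite [X in _ + X + _ + _ <= _]big1 ?addr0; last first.
  move=> n nN; rewrite big_nat big1// => j jM.
  by rewrite (Cg j n jM nN).1 mulr0.
rewrite [X in _ + X + _ <= _]big1 ?addr0; last first.
  move=> n nN; rewrite big_nat big1// => j jM.
  by rewrite (Cg j n jM nN).2 mulr0.
apply: lerD; first apply: lerD.
- apply: ler_sum_nat => n nN; apply: ler_sum_nat => j jM.
  by rewrite (AB j n jM nN).1.
- apply: ler_sum_nat => n nN; apply: ler_sum_nat => j jM.
  by rewrite (AB j n jM nN).2.
apply: ler_sum_nat => n nN; apply: ler_sum_nat => j jM.
have nN' : (1 <= n <= N)%N by rewrite -ltnS.
(* The pricing constraint on [f] is only an inequality, so the sign of [v] matters here; it comes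
   from [0 <= w <= v]. *)
apply: ler_wpM2l.
  exact: le_trans (w0 j n jM nN') (vw j n jM nN').
rewrite /slack2; have := E j n jM nN'.
case: (ltnP n N) => _; lra.
Qed.

Let sums_eq0 (X0 X1 X2 X3 X4 : nat -> nat -> R) :
  (forall y : nat -> nat -> nat -> R,
    \sum_(1 <= n < N) \sum_(0 <= j < M) y 0%N j n * X0 j n
    + \sum_(1 <= n < N) \sum_(0 <= j < M) y 1%N j n.+1 * X1 j n
    + \sum_(1 <= n < N.+1) \sum_(0 <= j < M) y 2 j n * X2 j n
    + \sum_(1 <= n < N) \sum_(0 <= j < M) y 3 j n * X3 j n
    + \sum_(1 <= n < N) \sum_(0 <= j < M) y 4 j n * X4 j n = 0) ->
  [/\ forall j n, (j < M)%N -> (1 <= n < N)%N ->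
        [/\ X0 j n = 0, X1 j n = 0, X3 j n = 0 & X4 j n = 0] &
      forall j n, (j < M)%N -> (1 <= n <= N)%N -> X2 j n = 0].
Proof.
move=> H.
split=> j0 n0 j0M n0N.
  split.
  - have := H (fun c j n => [&& c == 0, j == j0 & n == n0]%N%:R).
    by rewrite /= sum_delta2 j0M n0N !sum_mul0 !addr0.
  (* The second variable enters at [n.+1], hence the shifted test function. *)
  - have := H (fun c j n => [&& c == 1, j == j0 & n.-1 == n0]%N%:R).
    by rewrite /= sum_delta2 j0M n0N !sum_mul0 add0r !addr0.
  - have := H (fun c j n => [&& c == 3, j == j0 & n == n0]%N%:R).
    by rewrite /= sum_delta2 j0M n0N !sum_mul0 !add0r addr0.
  - have := H (fun c j n => [&& c == 4, j == j0 & n == n0]%N%:R).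
    by rewrite /= sum_delta2 j0M n0N !sum_mul0 !add0r.
have := H (fun c j n => [&& c == 2, j == j0 & n == n0]%N%:R).
by rewrite /= sum_delta2 j0M ltnS n0N !sum_mul0 !add0r !addr0.
Qed.


Lemma grid_strong_duality e1 e2 v d1 d2 : (0 < M)%N ->
  grid_hedge e1 e2 v d1 d2 ->
  (forall e1 e2 v d1 d2, grid_hedge e1 e2 v d1 d2 -> 0 <= grid_cost e1 e2 v) ->
  exists e1 e2 v d1 d2 f g1 g2, [/\ grid_hedge e1 e2 v d1 d2,
    grid_pricing f g1 g2 & grid_cost e1 e2 v = grid_price f].
Proof.
move=> M0 he cost0.
pose W := nat -> nat -> nat -> R^o.
(* Dates range over ['I_N.+1]; those outside the range of a constraint carry the trivial row
   [0 <= 0]. The boolean distinguishes the rows before ([false]) and after ([true]) exercise. *)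
pose I := ('I_M * 'I_M * 'I_N.+1 * bool + 'I_M * 'I_N.+1)%type.
pose A (i : I) (y : W) : R := match i with
  | inl (j, k, n, dl) => if (1 <= n < N)%N then
      if dl then al j k * (y 0%N j n - y 2 j n) + be j k * (y 1%N k n.+1 + y 2 k n.+1)
                 + ga j k * y 4 j n
      else al j k * y 0%N j n + be j k * y 1%N k n.+1 + ga j k * y 3 j n
      else 0
  | inr (j, n) => if (1 <= n < N.+1)%N then y 2 j n else 0 end.
pose b (i : I) : R := match i with
  | inl _ => 0 | inr (j, n) => if (1 <= n < N.+1)%N then w j n else 0 end.
pose C (y : W) : R := grid_cost (y 0%N) (y 1%N) (y 2).
have linA i : scalar (A i).
  move=> k u u'; rewrite /A; case: i => [[[[j k'] n] dl]|[j n]]; case: ifP => _.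
  - have E c j' n' : (k *: u + u') c j' n' = k * u c j' n' + u' c j' n' by [].
    by case: dl; rewrite !E; ring.
  - by rewrite mulr0 addr0.
  - by [].
  - by rewrite mulr0 addr0.
have linC : scalar C.
  move=> k u u'; rewrite /C !cost_transpose.
  have E a' b' (Y : nat -> nat -> R) c (g : nat -> nat) :
      \sum_(a' <= n < b') \sum_(0 <= j < M) (k *: u + u') c j (g n) * Y j n =
      k * (\sum_(a' <= n < b') \sum_(0 <= j < M) u c j (g n) * Y j n)
      + \sum_(a' <= n < b') \sum_(0 <= j < M) u' c j (g n) * Y j n.
    rewrite mulr_sumr -big_split /=; apply: eq_bigr => n _.
    rewrite mulr_sumr -big_split /=; apply: eq_bigr => j _.
    by rewrite mulrA -mulrDl.
  rewrite (E _ _ p 0%N id) (E _ _ (fun j n => p j n.+1) 1%N succn).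
  rewrite (E _ _ (fun j n => if (n < N)%N then 0 else p j N) 2 id).
  ring.
have feasP y : (forall i, b i <= A i y) <->
    grid_hedge (y 0%N) (y 1%N) (y 2) (y 3) (y 4).
  split=> [yA|[rw vw] [[[[j k] n] dl]|[j n]]].
  - split=> [j k n jM kM nN|j n jM nN].
      have nN' : (n < N.+1)%N by case/andP: nN => _ /ltnW.
      have := yA (inl (Ordinal jM, Ordinal kM, Ordinal nN', false)).
      have := yA (inl (Ordinal jM, Ordinal kM, Ordinal nN', true)).
      by rewrite /= nN.
    have nN' : (n < N.+1)%N by case/andP: nN.
    have := yA (inr (Ordinal jM, Ordinal nN')).
    by rewrite /= ltnS nN.
  - rewrite /A /b; case: ifPn => // nN.
    have [] := rw j k n (ltn_ord _) (ltn_ord _) nN.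
    by case: dl.
  - by rewrite /A /b; case: ifPn => // nN; apply: vw.
pose y0 : W := fun c => match c with 0%N => e1 | 1%N => e2 | 2%N => v | 3%N => d1 | _ => d2 end.
have y0f : forall i, b i <= A i y0 by apply/feasP.
have [y [lam [yf lam0 CE Clam]]] := @lp_strong_duality R W I A b C linA linC 0 y0
   y0f (fun y yf => cost0 _ _ _ _ _ ((feasP y).1 yf)).
pose i0 : 'I_M := Ordinal M0.
pose oM (j : nat) : 'I_M := insubd i0 j.
have oME (j : 'I_M) : oM j = j by rewrite /oM valKd.
pose g1 j k n := lam (inl (oM j, oM k, inord n, false)).
pose g2 j k n := lam (inl (oM j, oM k, inord n, true)).
pose f j n := lam (inr (oM j, inord n)).
have sumI (z : W) : \sum_i lam i * A i z = rows z f g1 g2.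
  rewrite big_sumType /= /rows; congr (_ + _).
    rewrite sum_quad -(@sum_ord_if _ _ 1 _ _ (leqnSn N)); apply: eq_bigr => n _.
    case: ifPn => [nN|_]; last first.
      by rewrite big1// => j _; rewrite big1// => k _; rewrite !mulr0 addr0.
    rewrite [RHS]big_mkord; apply: eq_bigr => j _; rewrite [RHS]big_mkord.
    by apply: eq_bigr => k _; rewrite /g1 /g2 !oME inord_val.
  rewrite -(@sum_ord_if _ _ 1 _ _ (leqnn N.+1)).
  rewrite sum_pair_swap /=.
  apply: eq_bigr => n _; case: ifPn => nN; last by rewrite big1// => j _; rewrite mulr0.
  rewrite [RHS]big_mkord; apply: eq_bigr => j _.
  by rewrite /f !oME inord_val.
have sumb : \sum_i lam i * b i = grid_price f.
  rewrite big_sumType /= big1 ?add0r; last by move=> [[[j k] n] dl] _; rewrite mulr0.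
  rewrite /grid_price -(@sum_ord_if _ _ 1 _ _ (leqnn N.+1)).
  rewrite sum_pair_swap /=.
  apply: eq_bigr => n _; case: ifPn => nN; last by rewrite big1// => j _; rewrite mulr0.
  rewrite [RHS]big_mkord; apply: eq_bigr => j _.
  by rewrite /f !oME inord_val mulrC.
(* The dual identity holds for all [z], so the coefficients of each variable agree. As [v] is a free
   variable of the module, even the exercise constraint comes out as an equality. *)
have [X E] : [/\ forall j n, (j < M)%N -> (1 <= n < N)%N ->
     [/\ p j n - \sum_(0 <= k < M) al j k * (g1 j k n + g2 j k n) = 0,
         p j n.+1 - \sum_(0 <= i < M) be i j * (g1 i j n + g2 i j n) = 0,
         - \sum_(0 <= k < M) ga j k * g1 j k n = 0 &
         - \sum_(0 <= k < M) ga j k * g2 j k n = 0] &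
     forall j n, (j < M)%N -> (1 <= n <= N)%N ->
      (if (n < N)%N then 0 else p j N) - slack2 f g2 j n = 0].
  apply: sums_eq0 => z.
  have := CE z; rewrite sumI rows_transpose /C cost_transpose => H.
  have S a' b' (Y Y' Z : nat -> nat -> R) :
      \sum_(a' <= n < b') \sum_(0 <= j < M) Y j n * (Y' j n - Z j n) =
      \sum_(a' <= n < b') \sum_(0 <= j < M) Y j n * Y' j n
      - \sum_(a' <= n < b') \sum_(0 <= j < M) Y j n * Z j n.
    rewrite -sumrB; apply: eq_bigr => n _; rewrite -sumrB; apply: eq_bigr => j _.
    by rewrite mulrBr.
  have SN a' b' (Y Z : nat -> nat -> R) :
      \sum_(a' <= n < b') \sum_(0 <= j < M) Y j n * - Z j n =
      - \sum_(a' <= n < b') \sum_(0 <= j < M) Y j n * Z j n.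
    rewrite -sumrN; apply: eq_bigr => n _; rewrite -sumrN; apply: eq_bigr => j _.
    by rewrite mulrN.
  rewrite (S _ _ _ p) (S _ _ (fun j n => z 1%N j n.+1) (fun j n => p j n.+1)).
  rewrite (S _ _ _ (fun j n => if (n < N)%N then 0 else p j N)) !SN.
  move: H; lra.
exists (y 0%N), (y 1%N), (y 2), (y 3), (y 4), f, g1, g2; split.
- exact/feasP.
- split.
  + by move=> *; exact: lam0.
  + by move=> *; split; exact: lam0.
  + by move=> j n jM nN; have [/subr0_eq-> /subr0_eq-> _ _] := X j n jM nN.
  + move=> j n jM nN; have [_ _ /eqP + /eqP] := X j n jM nN.
    by rewrite !oppr_eq0 => /eqP-> /eqP->.
  + move=> j n jM nN; have := E j n jM nN; rewrite /slack2.
    by case: ifP => _; lra.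
- by rewrite -sumb -Clam.
Qed.

End ExerciseLP.

(** * Piecewise linear interpolation on the strikes *)

Section PiecewiseLinear.
Variables (R : realType) (J : nat) (x : nat -> R).

Definition seg_slope (E : nat -> R) (j : nat) : R :=
  if (j < J)%N then (E j.+1 - E j) / (x j.+1 - x j) else E J.+1.

Definition increment (F : nat -> R) (j : nat) : R :=
  F j - (if j == 0%N then 0 else F j.-1).

(* Interpolates [E j] at [x j] for [j <= J] and has slope [E J.+1] beyond [x J];
   it is written as a portfolio of calls. *)
Definition pwl (E : nat -> R) (y : R) : R :=
  E 0%N + \sum_(0 <= j < J.+1) increment (seg_slope E) j * Num.max (y - x j) 0.

Definition pwc (D : nat -> R) (y : R) : R :=
  \sum_(0 <= j < J.+1) increment D j * (x j <= y)%R%:R.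

Definition in_seg (j : nat) (y : R) :=
  [/\ (j <= J)%N, x j <= y & (j < J)%N -> y < x j.+1].

Lemma sum_increment F m : \sum_(0 <= j < m.+1) increment F j = F m.
Proof.
elim: m => [|m IH]; first by rewrite big_nat1 /increment subr0.
by rewrite big_nat_recr //= IH /increment/= addrC subrK.
Qed.

Lemma sum_by_parts (F u : nat -> R) m :
  \sum_(0 <= j < m.+1) increment F j * u j =
  \sum_(0 <= j < m) F j * (u j - u j.+1) + F m * u m.
Proof.
elim: m => [|m IH]; first by rewrite big_nat1 big_geq// add0r /increment subr0.
by rewrite big_nat_recr //= IH [in RHS]big_nat_recr//= /increment/=; ring.
Qed.

Lemma increment_add F G j :
  increment (fun j => F j + G j) j = increment F j + increment G j.
Proof. by rewrite /increment; case: ifP => _; ring. Qed.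

Lemma seg_slope_add E F j :
  seg_slope (fun j => E j + F j) j = seg_slope E j + seg_slope F j.
Proof. by rewrite /seg_slope; case: ifP => // _; ring. Qed.

Lemma eq_increment F G m : (forall j, (j <= m)%N -> F j = G j) ->
  forall j, (j <= m)%N -> increment F j = increment G j.
Proof.
by move=> FG [|j] jm; rewrite /increment/= !FG// ltnW.
Qed.

Lemma pwl_add E F y : pwl (fun j => E j + F j) y = pwl E y + pwl F y.
Proof.
rewrite /pwl addrACA -big_split/=; congr (_ + _); apply: eq_bigr => j _.
rewrite -mulrDl -increment_add; congr (_ * _).
by apply: (@eq_increment _ _ j) => // i _; exact: seg_slope_add.
Qed.

Lemma pwl_0 y : pwl (fun=> 0) y = 0.
Proof.
have H i : seg_slope (fun=> 0) i = 0.
  by rewrite /seg_slope; case: ifP => _; rewrite ?subrr ?mul0r.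
rewrite /pwl add0r big1 // => j _.
by rewrite /increment !H if_same subr0 mul0r.
Qed.

Lemma pwl_opp E y : pwl (fun j => - E j) y = - pwl E y.
Proof.
apply/eqP; rewrite -subr_eq0 opprK -pwl_add -(pwl_0 y); apply/eqP.
by congr (pwl _ y); apply/funext => j; rewrite addNr.
Qed.

Hypotheses (x00 : x 0%N = 0) (xS : forall j, (j < J)%N -> x j < x j.+1).

Lemma grid_le i j : (i <= j <= J)%N -> x i <= x j.
Proof.
move=> /andP[ij]; elim: j ij => [|j IH]; first by rewrite leqn0 => /eqP->.
rewrite leq_eqVlt => /predU1P[->//|]; rewrite ltnS => ij jJ.
by rewrite (le_trans (IH ij (ltnW jJ)))// ltW// xS.
Qed.

Lemma grid_lt i j : (i < j <= J)%N -> x i < x j.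
Proof.
case: j => // j /andP[ij jJ]; apply: (@le_lt_trans _ _ (x j)); last exact: xS.
by rewrite grid_le// -ltnS ij ltnW.
Qed.

Lemma grid_ge0 j : (j <= J)%N -> 0 <= x j.
Proof. by move=> jJ; rewrite -x00 grid_le. Qed.

Lemma in_seg_exists y : 0 <= y -> exists j, in_seg j y.
Proof.
move=> y0.
suff H m : (m <= J)%N -> x m <= y \/ exists j, in_seg j y.
  by have [Jy|//] := H J (leqnn J); exists J; split => //; rewrite ltnn.
elim: m => [_|m IH mJ]; first by left; rewrite x00.
have [my|] := IH (ltnW mJ); last by right.
have [ym|my'] := ltP y (x m.+1); last by left.
by right; exists m; split => //; exact: ltnW.
Qed.

Lemma in_seg_grid j : (j <= J)%N -> in_seg j (x j).
Proof. by move=> jJ; split => // /xS. Qed.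

Lemma in_seg_le j y i : in_seg j y -> (i <= J)%N -> (x i <= y) = (i <= j)%N.
Proof.
move=> [jJ jy yj] iJ; apply/idP/idP => [iy|ij]; last first.
  by rewrite (le_trans _ jy)// grid_le// ij.
rewrite leqNgt; apply/negP => ji.
have jJ' : (j < J)%N := leq_trans ji iJ.
have := yj jJ'; rewrite ltNge; apply/negP; rewrite negbK.
by rewrite (le_trans _ iy)// grid_le// ji.
Qed.

Lemma pwc_seg D j y : in_seg j y -> pwc D y = D j.
Proof.
move=> sy; have [jJ _ _] := sy; rewrite /pwc (@big_cat_nat _ _ _ j.+1) //=.
rewrite [X in _ + X]big_nat [X in _ + X]big1 ?addr0 => [|i /andP[ji iJ]]; last first.
  by rewrite (in_seg_le sy)// leqNgt ji mulr0.
rewrite -[RHS]sum_increment; apply: eq_big_nat => i /andP[_ ij].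
have ij' : (i <= j)%N by rewrite -ltnS.
by rewrite (in_seg_le sy (leq_trans ij' jJ)) ij' mulr1.
Qed.

Lemma pwl_seg E j y : in_seg j y -> pwl E y = E j + seg_slope E j * (y - x j).
Proof.
move=> sy; have [jJ _ _] := sy; rewrite /pwl (@big_cat_nat _ _ _ j.+1) //=.
rewrite [X in _ + (_ + X)]big_nat [X in _ + (_ + X)]big1 ?addr0 => [|i /andP[ji iJ]]; last first.
  rewrite max_r ?mulr0// subr_le0 ltW// ltNge (in_seg_le sy)// -ltnNge//.
rewrite (_ : \sum_(0 <= i < j.+1) _ =
    \sum_(0 <= i < j.+1) increment (seg_slope E) i * (y - x i)); last first.
  apply: eq_big_nat => i /andP[_ ij].
  have ij' : (i <= j)%N by rewrite -ltnS.
  by rewrite max_l// subr_ge0 (in_seg_le sy (leq_trans ij' jJ)).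
elim: j jJ {sy} => [_|j IH jJ]; first by rewrite big_nat1 /increment/= subr0.
rewrite big_nat_recr//= addrA IH ?(ltnW jJ)// /increment/=.
have : seg_slope E j * (x j.+1 - x j) = E j.+1 - E j.
  by rewrite /seg_slope jJ divfK// subr_eq0 gt_eqF// xS.
lra.
Qed.

Lemma pwl_grid E j : (j <= J)%N -> pwl E (x j) = E j.
Proof. by move=> jJ; rewrite (pwl_seg E (in_seg_grid jJ)) subrr mulr0 addr0. Qed.

Lemma seg_convex_comb j y : (j < J)%N -> in_seg j y ->
  exists t, [/\ 0 <= t <= 1, y = t * x j + (1 - t) * x j.+1 &
    forall E, pwl E y = t * E j + (1 - t) * E j.+1].
Proof.
move=> jJ sy; have [_ jy yj] := sy; have {}yj := yj jJ.
have d0 : 0 < x j.+1 - x j by rewrite subr_gt0 xS.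
exists ((x j.+1 - y) / (x j.+1 - x j)); split.
- by rewrite divr_ge0 ?(ltW d0) ?subr_ge0 ?(ltW yj)//= ler_pdivrMr// mul1r lerD2l lerN2.
- by field; rewrite gt_eqF.
- by move=> E; rewrite (pwl_seg E sy) /seg_slope jJ; field; rewrite gt_eqF.
Qed.

Lemma pwl_ge_affine E A B z : (forall k, (k <= J)%N -> A + B * x k <= E k) ->
  B <= E J.+1 -> 0 <= z -> A + B * z <= pwl E z.
Proof.
move=> AE BE /in_seg_exists[j sz]; have [jJ jz _] := sz.
have := jJ; rewrite leq_eqVlt => /predU1P[jE|jJ'].
  rewrite (pwl_seg E sz) /seg_slope jE ltnn; have := AE _ jJ; rewrite jE.
  have : (E J.+1 - B) * (z - x J) >= 0 by rewrite mulr_ge0 ?subr_ge0// -jE.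
  lra.
have [t [/andP[t0 t1] zE ->]] := seg_convex_comb jJ' sz.
have -> : A + B * z = t * (A + B * x j) + (1 - t) * (A + B * x j.+1) by rewrite zE; ring.
by rewrite lerD// ler_wpM2l ?subr_ge0// AE.
Qed.

(* On a segment, [- pwl e] lies below one of the affine minorants of [pwl g] with
   slopes [- d j.+1] and [- d j], or else extends to an affine minorant itself. *)
Lemma semistatic_hedge (e g d : nat -> R) :
  (forall j k, (j <= J)%N -> (k <= J)%N -> 0 <= e j + g k + (x k - x j) * d j) ->
  (forall j, (j <= J)%N -> 0 <= g J.+1 + d j) -> 0 <= e J.+1 + g J.+1 ->
  exists D : nat -> R, forall y z, 0 <= y -> 0 <= z ->
    0 <= pwl e y + pwl g z + (z - y) * pwc D y.
Proof.
move=> egd gd eg.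
have gz j z : (j <= J)%N -> 0 <= z -> 0 <= e j + pwl g z + (z - x j) * d j.
  move=> jJ z0.
  have := @pwl_ge_affine g (- e j + x j * d j) (- d j) z.
  suff : - e j + x j * d j + - d j * z <= pwl g z by lra.
  apply: pwl_ge_affine => // [k kJ|].
    have := egd j k jJ kJ; lra.
  have := gd j jJ; lra.
pose D j := if (j < J)%N && (seg_slope e j <= d j.+1) then d j.+1
            else if d j <= seg_slope e j then d j else seg_slope e j.
exists D => y z /in_seg_exists[j sy] z0.
have [jJ jy yj] := sy; rewrite (pwc_seg D sy) (pwl_seg e sy).
rewrite /D; case: ifPn => [/andP[jJ' sd]|sd].
  have := gz j.+1 z jJ' z0.
  have : seg_slope e j * (x j.+1 - x j) = e j.+1 - e j.
    by rewrite /seg_slope jJ' divfK// subr_eq0 gt_eqF// xS.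
  have : 0 <= (d j.+1 - seg_slope e j) * (x j.+1 - y).
    by rewrite mulr_ge0// subr_ge0// ltW// yj.
  lra.
case: ifPn => [sd'|]; last rewrite -ltNge => sd'.
  have := gz j z jJ z0.
  have : 0 <= (seg_slope e j - d j) * (y - x j) by rewrite mulr_ge0// subr_ge0.
  lra.
suff : - e j + x j * seg_slope e j + - seg_slope e j * z <= pwl g z by lra.
apply: pwl_ge_affine => // [k kJ|]; last first.
  have := jJ; rewrite leq_eqVlt => /predU1P[->|jJ'].
    by rewrite /seg_slope ltnn; move: eg; lra.
  have := gd j.+1 jJ'; move: sd; rewrite jJ' /= -ltNge; lra.
(* The slope [- seg_slope e j] now lies strictly between [- d j.+1] and [- d j]. To the left of the
   segment the line is below the one through [x j] with slope [- d j], to the right it is below the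
   one through [x j.+1] with slope [- d j.+1]. *)
have [kj|jk] := leqP k j.
  have := egd j k jJ kJ.
  have : 0 <= (d j - seg_slope e j) * (x j - x k).
    by rewrite mulr_ge0// subr_ge0 ?(ltW sd')// grid_le// kj.
  lra.
have jJ' := leq_trans jk kJ.
have := egd j.+1 k jJ' kJ.
move: sd; rewrite jJ' /= -ltNge => sd.
have : 0 <= (seg_slope e j - d j.+1) * (x k - x j.+1).
  by rewrite mulr_ge0// subr_ge0 ?(ltW sd)// grid_le// jk.
have : seg_slope e j * (x j.+1 - x j) = e j.+1 - e j.
  by rewrite /seg_slope jJ' divfK// subr_eq0 gt_eqF// xS.
lra.
Qed.

Lemma pwc_bounded D : exists B, forall y, 0 <= y -> `|pwc D y| <= B.
Proof.
exists (\sum_(0 <= j < J.+1) `|D j|) => y /in_seg_exists[j sy].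
have [jJ _ _] := sy; rewrite (pwc_seg D sy).
rewrite (bigD1_seq j) ?mem_index_iota ?iota_uniq//= lerDl.
by apply: sumr_ge0.
Qed.

Variables (s0 : R) (c : nat -> nat -> R).
Hypothesis J1 : (1 <= J)%N.

(** Summation by parts: the weights are second differences of call prices, and the last one is the
    price of the call with strike [x J], which pays one unit of slope beyond [x J]. *)
Lemma pwl_cost E n : c 0%N n = s0 ->
  E 0%N + \sum_(0 <= j < J.+1) increment (seg_slope E) j * c j n =
  \sum_(0 <= j < J.+2) E j * phat J s0 x c j n.
Proof.
move=> c0; rewrite sum_by_parts.
have H m : (m < J)%N -> \sum_(0 <= j < m.+1) E j * phat J s0 x c j n =
    E 0%N + \sum_(0 <= j < m) seg_slope E j * (c j n - c j.+1 n)
    - E m * slope x c m.+1 n.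
  elim: m => [_|m IH mJ].
    by rewrite big_nat1 big_geq// /phat /slope /= x00 c0 subr0; ring.
  rewrite big_nat_recr//= IH ?(ltnW mJ)// [in RHS]big_nat_recr//= /phat/= mJ.
  rewrite /seg_slope (ltnW mJ) /slope /=.
  have := xS (ltnW mJ); have := xS mJ => ? ?.
  by field; rewrite !subr_eq0 !gt_eqF.
have [m Jm] : exists m, J = m.+1 by case: J J1 => // m _; exists m.
have mJ : (m < J)%N by rewrite Jm.
have := H m mJ; rewrite -Jm => Hm; rewrite big_nat_recr//= big_nat_recr//= Hm.
have -> F : \sum_(0 <= j < J) F j = \sum_(0 <= j < m) F j + F m :> R.
  by rewrite Jm big_nat_recr.
rewrite /phat ltnn eqxx !gtn_eqF ?ltnS// ltnNge leqnSn /=.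
rewrite /seg_slope ltnn mJ /slope.
have := xS mJ; rewrite Jm => ?.
by field; rewrite !subr_eq0 !gt_eqF.
Qed.

End PiecewiseLinear.

(** * The limit linear program *)

Section LimitLP.
Variables (R : realType) (N J : nat) (s0 : R) (x : nat -> R).
Variables (c : nat -> nat -> R) (a : R -> nat -> R) (l : nat -> R).

(* A transition from the node at infinity to a strike contributes only to the
   inequality for the source, and conversely. *)
Definition inf_al (j k : nat) : R := ((j == J.+1) || (k <= J)%N)%:R.
Definition inf_be (j k : nat) : R := ((j <= J)%N || (k == J.+1))%:R.
Definition inf_ga (j k : nat) : R :=
  if (j <= J)%N then (if (k <= J)%N then x k - x j else 1)
  else if (k <= J)%N then -1 else 0.
Definition inf_payoff (j n : nat) : R := if (j <= J)%N then a (x j) n else l n.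

Lemma inf_al_sum j (F : nat -> R) : (j <= J)%N ->
  \sum_(0 <= k < J.+2) inf_al j k * F k = \sum_(0 <= k < J.+1) F k.
Proof.
move=> jJ; rewrite big_nat_recr//= /inf_al ltn_eqF ?ltnS//= ltnn mul0r addr0.
by apply: eq_big_nat => k /andP[_]; rewrite ltnS => ->; rewrite mul1r.
Qed.

Lemma inf_al_sum_last (F : nat -> R) :
  \sum_(0 <= k < J.+2) inf_al J.+1 k * F k = \sum_(0 <= k < J.+2) F k.
Proof. by apply: eq_bigr => k _; rewrite /inf_al eqxx mul1r. Qed.

Lemma inf_be_sum k (F : nat -> R) : (k <= J)%N ->
  \sum_(0 <= j < J.+2) inf_be j k * F j = \sum_(0 <= j < J.+1) F j.
Proof.
move=> kJ; rewrite big_nat_recr//= /inf_be ltn_eqF ?ltnS//= ltnn mul0r addr0.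
by apply: eq_big_nat => j /andP[_]; rewrite ltnS => ->; rewrite mul1r.
Qed.

Lemma inf_be_sum_last (F : nat -> R) :
  \sum_(0 <= j < J.+2) inf_be j J.+1 * F j = \sum_(0 <= j < J.+2) F j.
Proof. by apply: eq_bigr => k _; rewrite /inf_be eqxx orbT mul1r. Qed.

Lemma inf_ga_sum j (F : nat -> R) : (j <= J)%N ->
  \sum_(0 <= k < J.+2) inf_ga j k * F k =
  \sum_(0 <= k < J.+1) (x k - x j) * F k + F J.+1.
Proof.
move=> jJ; rewrite big_nat_recr//= /inf_ga jJ ltnn mul1r; congr (_ + _).
by apply: eq_big_nat => k /andP[_]; rewrite ltnS => ->.
Qed.

Lemma inf_ga_sum_last (F : nat -> R) :
  \sum_(0 <= k < J.+2) inf_ga J.+1 k * F k = - \sum_(0 <= k < J.+1) F k.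
Proof.
rewrite big_nat_recr//= /inf_ga ltnn mul0r addr0 -sumrN.
by apply: eq_big_nat => k /andP[_]; rewrite ltnS => ->; rewrite mulN1r.
Qed.

Let M := J.+2.
Let p := phat J s0 x c.

Hypothesis N1 : (1 <= N)%N.

Lemma hedgeLP_objE e1 e2 v :
  (forall j, (j <= J.+1)%N -> e1 j N = 0 /\ e2 j 1%N = 0) ->
  hedgeLP_obj N J s0 x c e1 e2 v = grid_cost N M p e1 e2 v.
Proof.
move=> e0; rewrite /hedgeLP_obj /grid_cost; congr (_ + _).
rewrite (eq_bigr (fun n => \sum_(0 <= j < J.+2) e1 j n * p j n
   + \sum_(0 <= j < J.+2) e2 j n * p j n)); last first.
  by move=> n _; rewrite -big_split; apply: eq_bigr => j _; rewrite mulrDl.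
rewrite !big_split /=; congr (_ + _).
  rewrite big_nat_recr//= [X in _ + X]big_nat [X in _ + X]big1 ?addr0// => j jJ.
  by rewrite (e0 j _).1// mul0r.
rewrite big_ltn//= big_nat big1 ?add0r => [|j jJ]; first by rewrite big_add1.
by rewrite (e0 j _).2// mul0r.
Qed.

Lemma hedgeLP_grid e1 e2 v d1 d2 : hedgeLP_feasible N J x a l e1 e2 v d1 d2 <->
  [/\ forall j, (j <= J.+1)%N -> e1 j N = 0 /\ e2 j 1%N = 0,
      forall j n, (j <= J.+1)%N -> (1 <= n <= N)%N -> 0 <= v j n &
      grid_hedge N M inf_al inf_be inf_ga inf_payoff e1 e2 v d1 d2].
Proof.
have last k : (k < J.+2)%N -> (k <= J)%N \/ k = J.+1.
  by rewrite ltnS leq_eqVlt => /predU1P[->|]; [right|left; rewrite -ltnS].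
split=> [[e0 v0 va r1 r2]|[e0 v0 [rw vw]]].
- split=> //; split=> [j k n jM kM nN|j n jM nN].
    have [r1a r1b r1c r1d] := r1 n nN; have [r2a r2b r2c r2d] := r2 n nN.
    rewrite /inf_al /inf_be /inf_ga.
    have [jJ|->] := last j jM; have [kJ|->] := last k kM;
      rewrite ?(ltn_eqF (ltnS _ _)) ?jJ ?kJ ?eqxx ?ltnn/= ?orbT ?mul1r.
    + by split; [exact: r1a|have := r2a j k jJ kJ; lra].
    + rewrite ltn_eqF ?ltnS//=; have := r1c j jJ; have := r2c j jJ; lra.
    + rewrite ltn_eqF ?ltnS//=; move: r1b r2b; lra.
    + by split; move: r1d r2d; lra.
  have [va1 va2] := va n nN; rewrite /inf_payoff.
  by have [jJ|->] := last j jM; rewrite ?jJ ?ltnn//; exact: va1.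
- split=> // n nN.
  + split=> [j jJ|]; last by have := vw J.+1 n (ltnSn _) nN; rewrite /inf_payoff ltnn.
    have := vw j n (leqW jJ) nN; rewrite /inf_payoff jJ; apply.
  + split.
    * move=> j k jJ kJ; have [+ _] := rw j k n (leqW jJ) (leqW kJ) nN.
      by rewrite /inf_al /inf_be /inf_ga jJ kJ orbT !mul1r mulrC.
    (* From the node at infinity all finite targets give the same inequality; target 0 stands for
       them all. *)
    * have [+ _] := rw J.+1 0%N n (ltnSn _) isT nN.
      by rewrite /inf_al /inf_be /inf_ga eqxx ltnn /=; lra.
    * move=> j jJ; have [+ _] := rw j J.+1 n (leqW jJ) (ltnSn _) nN.
      rewrite /inf_al /inf_be /inf_ga jJ eqxx ltnn ltn_eqF ?ltnS//=; lra.
    * have [+ _] := rw J.+1 J.+1 n (ltnSn _) (ltnSn _) nN.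
      by rewrite /inf_al /inf_be /inf_ga eqxx ltnn /=; lra.
  + split.
    * move=> j k jJ kJ; have [_] := rw j k n (leqW jJ) (leqW kJ) nN.
      rewrite /inf_al /inf_be /inf_ga jJ kJ orbT !mul1r; lra.
    * have [_] := rw J.+1 0%N n (ltnSn _) isT nN.
      by rewrite /inf_al /inf_be /inf_ga eqxx ltnn /=; lra.
    * move=> j jJ; have [_] := rw j J.+1 n (leqW jJ) (ltnSn _) nN.
      rewrite /inf_al /inf_be /inf_ga jJ eqxx ltnn ltn_eqF ?ltnS//=; lra.
    * have [_] := rw J.+1 J.+1 n (ltnSn _) (ltnSn _) nN.
      by rewrite /inf_al /inf_be /inf_ga eqxx ltnn /=; lra.
Qed.

(* [e1] at the last date and [e2] at the first one are not constrained by
   [grid_hedge] and do not enter [grid_cost]. *)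
Lemma grid_hedge_trim e1 e2 v d1 d2 :
  let e1' j n := if (n < N)%N then e1 j n else 0 in
  let e2' j n := if (1 < n)%N then e2 j n else 0 in
  grid_hedge N M inf_al inf_be inf_ga inf_payoff e1 e2 v d1 d2 ->
  [/\ grid_hedge N M inf_al inf_be inf_ga inf_payoff e1' e2' v d1 d2,
      forall j, (j <= J.+1)%N -> e1' j N = 0 /\ e2' j 1%N = 0 &
      grid_cost N M p e1' e2' v = grid_cost N M p e1 e2 v].
Proof.
move=> e1' e2' [rw vw]; split.
- split=> // j k n jM kM nN; have [r1 r2] := rw j k n jM kM nN.
  by rewrite /e1' /e2'; case/andP: nN => n1 ->; rewrite ltnS n1.
- by move=> j _; rewrite /e1' /e2' ltnn.
- rewrite /grid_cost; congr (_ + _); apply: eq_big_nat => n /andP[n1 nN].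
  by rewrite /e1' /e2' nN ltnS n1.
Qed.

Lemma pricingLP_grid f g1 g2 : pricingLP_feasible N J s0 x c f g1 g2 <->
  grid_pricing N M inf_al inf_be inf_ga p f g1 g2.
Proof.
have last k : (k < J.+2)%N -> (k <= J)%N \/ k = J.+1.
  by rewrite ltnS leq_eqVlt => /predU1P[->|]; [right|left; rewrite -ltnS].
split=> [[[f0 g0] ga gb gc [ge1 ge2]]|[f0 g0 gab gc ge]].
- split.
  + by move=> j n jM nN; exact: f0.
  + by move=> j k n jM kM nN; exact: g0.
  + move=> j n jM nN; have [gaJ gaL] := ga n nN.
    have nN' : (2 <= n.+1 <= N)%N by rewrite ltnS.
    have /= [gbJ gbL] := gb n.+1 nN'.
    have [jJ|->] := last j jM; last by rewrite inf_al_sum_last inf_be_sum_last.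
    by rewrite inf_al_sum// inf_be_sum// gaJ// gbJ.
  + move=> j n jM nN; have [[c1 c1'] [c2 c2']] := gc n nN.
    have [jJ|->] := last j jM; last by rewrite !inf_ga_sum_last c1' c2' oppr0.
    by rewrite !inf_ga_sum// c1// c2.
  + move=> j n jM nN.
    case: (ltnP n N) => [nN'|Nn].
      have n1N : (1 <= n < N)%N by rewrite nN' andbT; case/andP: nN.
      have [e eL] := ge1 n n1N.
      have [jJ|->] := last j jM; last first.
        by rewrite !inf_al_sum_last inf_be_sum_last; move: eL; case: ifP => _; lra.
      by rewrite !inf_al_sum// inf_be_sum//; have := e j jJ; case: ifP => _; lra.
    have -> : n = N by apply/eqP; rewrite eqn_leq Nn andbT; case/andP: nN.
    have [e eL] := ge2.
    have [jJ|->] := last j jM; last by rewrite inf_be_sum_last.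
    by rewrite inf_be_sum//; exact: e.
- split=> //.
  + move=> n nN; split=> [j jJ|].
      by have [+ _] := gab j n (leqW jJ) nN; rewrite inf_al_sum.
    by have [+ _] := gab J.+1 n (ltnSn _) nN; rewrite inf_al_sum_last.
  + move=> [//|n] nN; split=> [j jJ|] /=.
      by have [_] := gab j n (leqW jJ) nN; rewrite inf_be_sum.
    by have [_] := gab J.+1 n (ltnSn _) nN; rewrite inf_be_sum_last.
  + move=> n nN; split; split=> [j jJ|].
    * by have [+ _] := gc j n (leqW jJ) nN; rewrite inf_ga_sum.
    * have [+ _] := gc J.+1 n (ltnSn _) nN; rewrite inf_ga_sum_last => /eqP.
      by rewrite oppr_eq0 => /eqP.
    * by have [_] := gc j n (leqW jJ) nN; rewrite inf_ga_sum.
    * have [_] := gc J.+1 n (ltnSn _) nN; rewrite inf_ga_sum_last => /eqP.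
      by rewrite oppr_eq0 => /eqP.
  + split.
      move=> n nN; have nN' : (1 <= n <= N)%N.
        by case/andP: nN => -> /ltnW ->.
      split=> [j jJ|].
        have := ge j n (leqW jJ) nN'; rewrite inf_be_sum// inf_al_sum//.
        by case/andP: nN => _ ->; case: ifP => _; lra.
      have := ge J.+1 n (ltnSn _) nN'; rewrite inf_be_sum_last inf_al_sum_last.
      by case/andP: nN => _ ->; case: ifP => _; lra.
    have NN : (1 <= N <= N)%N by rewrite N1 leqnn.
    split=> [j jJ|].
      by have := ge j N (leqW jJ) NN; rewrite inf_be_sum// ltnn.
    by have := ge J.+1 N (ltnSn _) NN; rewrite inf_be_sum_last ltnn.
Qed.

Lemma pricingLP_objE f : pricingLP_obj N J x a l f = grid_price N M inf_payoff f.
Proof.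
rewrite /pricingLP_obj /grid_price -big_split /=; apply: eq_bigr => n _.
rewrite [in RHS]big_nat_recr//= /inf_payoff ltnn mulrC; congr (_ + _).
by apply: eq_big_nat => j /andP[_]; rewrite ltnS => ->.
Qed.

End LimitLP.

(** * Finite grids with one large node *)

Lemma sum_mulDl (R : pzRingType) (F G w : nat -> R) m :
  \sum_(0 <= j < m) (F j + G j) * w j =
  \sum_(0 <= j < m) F j * w j + \sum_(0 <= j < m) G j * w j.
Proof. by rewrite -big_split; apply: eq_bigr => j _; rewrite mulrDl. Qed.

Lemma sum_mulBl (R : pzRingType) (F G w : nat -> R) m :
  \sum_(0 <= j < m) (F j - G j) * w j =
  \sum_(0 <= j < m) F j * w j - \sum_(0 <= j < m) G j * w j.
Proof. by rewrite -sumrB; apply: eq_bigr => j _; rewrite mulrBl. Qed.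

(** * Convex envelopes of one-period hedges *)

Section ConvexEnvelope.
Variable R : realType.

(** [phi] is the upper envelope of the lines through [(x j, - e j)] with slope [- d j], and [b k] is
    the slope of a line active at [x k]. It separates [- e] from every [g] that completes [e] and
    [d] to a hedge. *)
Lemma convex_envelope (m : nat) (x e d : nat -> R) :
  exists phi b : nat -> R,
    [/\ forall j, (j <= m)%N -> - e j <= phi j,
        forall i k, (i <= m)%N -> (k <= m)%N -> phi k + b k * (x i - x k) <= phi i &
        forall g : nat -> R, (forall j k, (j <= m)%N -> (k <= m)%N ->
            0 <= e j + g k + (x k - x j) * d j) ->
          forall k, (k <= m)%N -> phi k <= g k].
Proof.
pose line j k := - e j - (x k - x j) * d j.
pose top k : 'I_m.+1 := [arg max_(j > (ord0 : 'I_m.+1)) line j k]%O.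
have topP k j : (j <= m)%N -> line j k <= line (top k) k.
  rewrite -ltnS => jm; rewrite /top; case: Order.TotalTheory.arg_maxP => // i _ /(_ (Ordinal jm)).
  exact.
have topm k : (top k <= m)%N by rewrite -ltnS ltn_ord.
exists (fun k => line (top k) k), (fun k => - d (top k)); split.
- by move=> j jm; have := topP j j jm; rewrite {1}/line subrr mul0r subr0.
- move=> i k im km; apply: le_trans (topP i (top k) _) => //.
  by rewrite /line; lra.
- by move=> g eg k km; have := eg _ k (topm k) km; rewrite /line; lra.
Qed.

End ConvexEnvelope.

Section FiniteGrid.
Variables (R : realType) (N J : nat) (s0 : R) (x : nat -> R).
Variables (c : nat -> nat -> R) (a : R -> nat -> R) (l : nat -> R).
Hypotheses (N1 : (1 <= N)%N) (J1 : (1 <= J)%N).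
Hypotheses (x00 : x 0%N = 0) (xS : forall j, (j < J)%N -> x j < x j.+1).
Hypothesis c0 : forall n, (1 <= n <= N)%N -> c 0%N n = s0.
Hypothesis cJ0 : forall n, (1 <= n <= N)%N -> 0 < c J n.
Hypothesis cS : forall j n, (1 <= j <= J)%N -> (1 <= n < N)%N -> c j n <= c j n.+1.
Let p := phat J s0 x c.
Hypothesis p_ge0 : forall j n, (j <= J)%N -> (1 <= n <= N)%N -> 0 <= p j n.

Variable K : R.
Hypothesis xK : x J < K.

Definition ext_grid (j : nat) : R := if (j <= J)%N then x j else K.

(* The probabilities on the nodes [x 0, ..., x J, K] that reproduce the call
   prices [c j n]. *)
Definition ext_weight (j n : nat) : R :=
  if (j < J)%N then p j n
  else if j == J then p J n - c J n / (K - x J)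
  else c J n / (K - x J).

Definition asym_slope (E : nat -> R) (j : nat) : R :=
  if (j <= J)%N then E j else (E J.+1 - E J) / (K - x J).

Let dK : 0 < K - x J. Proof. by rewrite subr_gt0. Qed.

(** The weight taken from [x J] and put on [K] pairs with the increment of [E] over the last
    segment. So a cost on the grid is a cost of the limit program once the value at [K] is replaced
    by a slope. *)
Lemma ext_weight_sum E n :
  \sum_(0 <= j < J.+2) E j * ext_weight j n =
  \sum_(0 <= j < J.+2) asym_slope E j * p j n.
Proof.
rewrite big_nat_recr//= big_nat_recr//= [in RHS]big_nat_recr//= [in RHS]big_nat_recr//=.
rewrite (eq_big_nat _ _ (F2 := fun j => asym_slope E j * p j n)); last first.
  by move=> j /andP[_ jJ]; rewrite /ext_weight jJ /asym_slope (ltnW jJ).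
rewrite /ext_weight /asym_slope leqnn !ltnn eqxx gtn_eqF// [p J.+1 n]/phat /=.
rewrite gtn_eqF// ltnNge leqnSn /=.
by field; rewrite gt_eqF.
Qed.

Lemma ext_grid_lt j : (j <= J)%N -> ext_grid j < ext_grid j.+1.
Proof.
move=> jJ; rewrite /ext_grid jJ; case: ltnP => [/xS//|Jj].
by have -> : j = J by apply/eqP; rewrite eqn_leq jJ.
Qed.

Lemma ext_price E n : (1 <= n <= N)%N ->
  \sum_(0 <= j < J.+2) E j * ext_weight j n =
  E 0%N + \sum_(0 <= j < J.+1)
    increment (fun i => (E i.+1 - E i) / (ext_grid i.+1 - ext_grid i)) j * c j n.
Proof.
move=> nN; rewrite ext_weight_sum -(pwl_cost x00 xS J1 _ (c0 nN)) {1}/asym_slope /=.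
congr (_ + _); apply: eq_big_nat => j /andP[_]; rewrite ltnS => jJ.
congr (_ * _); apply: (@eq_increment _ _ _ J) => // i iJ.
rewrite /seg_slope /asym_slope /ext_grid iJ; case: (ltnP i J) => // Ji.
have -> : i = J by apply/eqP; rewrite eqn_leq iJ.
by rewrite ltnn.
Qed.

Hypothesis wJ0 : forall n, (1 <= n <= N)%N -> 0 <= ext_weight J n.

Lemma ext_weight_ge0 j n : (j <= J.+1)%N -> (1 <= n <= N)%N -> 0 <= ext_weight j n.
Proof.
move=> jJ nN; rewrite /ext_weight; case: ltnP => [jJ'|Jj]; first exact/p_ge0/nN/ltnW.
case: eqP => _; last by rewrite divr_ge0 ?(ltW dK)// ltW// cJ0.
by have := wJ0 nN; rewrite /ext_weight ltnn eqxx.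
Qed.

(** Convexity makes the slopes of [phi] increase along the grid, so [phi] is a portfolio with
    nonnegative positions in the calls with strikes [x 1], ..., [x J], whose prices do not decrease
    with maturity. The position in strike [x 0] may have any sign, but its price is [s0] at both
    dates. *)
Lemma ext_convex_order (phi b : nat -> R) n : (1 <= n < N)%N ->
  (forall i k, (i <= J.+1)%N -> (k <= J.+1)%N ->
     phi k + b k * (ext_grid i - ext_grid k) <= phi i) ->
  \sum_(0 <= j < J.+2) phi j * ext_weight j n <=
  \sum_(0 <= j < J.+2) phi j * ext_weight j n.+1.
Proof.
move=> nN phib; have nN1 : (1 <= n <= N)%N by case/andP: nN => -> /ltnW.
have nN2 : (1 <= n.+1 <= N)%N by case/andP: nN.
rewrite !ext_price// lerD2l; apply: ler_sum_nat => -[_|j /andP[_ jJ]].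
  by rewrite !c0.
rewrite ler_wpM2l ?cS// /increment /= subr_ge0.
rewrite ltnS in jJ.
have d1 : 0 < ext_grid j.+1 - ext_grid j by rewrite subr_gt0 ext_grid_lt// ltnW.
have d2 : 0 < ext_grid j.+2 - ext_grid j.+1 by rewrite subr_gt0 ext_grid_lt.
apply: (@le_trans _ _ (b j.+1)).
  rewrite ler_pdivrMr//; have := phib j j.+1 (leq_trans (leqnSn j) (leqW jJ)) (leqW jJ); lra.
rewrite ler_pdivlMr//; have := phib j.+2 j.+1 jJ (leqW jJ); lra.
Qed.

Definition pair_cost (e g : nat -> R) (n : nat) : R :=
  \sum_(0 <= j < J.+2) e j * ext_weight j n
  + \sum_(0 <= j < J.+2) g j * ext_weight j n.+1.

(** Inserting [phi] splits the one-period cost into two sums of nonnegative terms and a convex order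
    term. Only the terms at [x J] are kept: the slack there decides how good the slopes towards [K]
    are. *)
Lemma pair_envelope (e g d : nat -> R) n : (1 <= n < N)%N ->
  (forall j k, (j <= J.+1)%N -> (k <= J.+1)%N ->
     0 <= e j + g k + (ext_grid k - ext_grid j) * d j) ->
  exists phi b : nat -> R,
    [/\ forall j, (j <= J.+1)%N -> - e j <= phi j /\ phi j <= g j,
        forall i k, (i <= J.+1)%N -> (k <= J.+1)%N ->
          phi k + b k * (ext_grid i - ext_grid k) <= phi i &
        (e J + phi J) * ext_weight J n + (g J - phi J) * ext_weight J n.+1
          <= pair_cost e g n].
Proof.
move=> nN egd; have [phi [b [ephi phib phig]]] := convex_envelope J.+1 ext_grid e d.
have {}phig := phig g egd.
have nN1 : (1 <= n <= N)%N by case/andP: nN => -> /ltnW.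
have nN2 : (1 <= n.+1 <= N)%N by case/andP: nN.
exists phi, b; split => //; first by move=> j jJ; split; [exact: ephi|exact: phig].
have := ext_convex_order nN phib.
have -> : pair_cost e g n = \sum_(0 <= j < J.+2) (e j + phi j) * ext_weight j n
   + \sum_(0 <= j < J.+2) (g j - phi j) * ext_weight j n.+1
   + (\sum_(0 <= j < J.+2) phi j * ext_weight j n.+1
      - \sum_(0 <= j < J.+2) phi j * ext_weight j n).
  by rewrite (sum_mulDl e phi) (sum_mulBl g phi) /pair_cost; ring.
have H (F w : nat -> R) : (forall j, (j <= J.+1)%N -> 0 <= F j) ->
   (forall j, (j <= J.+1)%N -> 0 <= w j) -> F J * w J <= \sum_(0 <= j < J.+2) F j * w j.
  move=> F0 w0; rewrite (bigD1_seq J) ?mem_index_iota ?iota_uniq//= lerDl.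
  rewrite big_mkcond big_nat; apply: sumr_ge0 => j /andP[_ jJ].
  by case: ifP => // _; rewrite mulr_ge0 ?F0 ?w0.
have H1 := H (fun j => e j + phi j) (ext_weight^~ n).
have H2 := H (fun j => g j - phi j) (ext_weight^~ n.+1).
have F1 j : (j <= J.+1)%N -> 0 <= e j + phi j by move/ephi; lra.
have F2 j : (j <= J.+1)%N -> 0 <= g j - phi j by move/phig; lra.
have := H1 F1 (fun j jJ => ext_weight_ge0 jJ nN1).
have := H2 F2 (fun j jJ => ext_weight_ge0 jJ nN2).
lra.
Qed.

(** Absence of arbitrage over one period, obtained from the envelope where a martingale coupling of
    the weights at the two dates would otherwise serve. *)
Lemma pair_cost_ge0 e g d n : (1 <= n < N)%N ->
  (forall j k, (j <= J.+1)%N -> (k <= J.+1)%N ->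
     0 <= e j + g k + (ext_grid k - ext_grid j) * d j) ->
  0 <= pair_cost e g n.
Proof.
move=> nN egd; have [phi [b [ephi phib]]] := pair_envelope nN egd.
apply: le_trans; have nN1 : (1 <= n <= N)%N by case/andP: nN => -> /ltnW.
have nN2 : (1 <= n.+1 <= N)%N by case/andP: nN.
have [? ?] := ephi J (leqnSn J).
by rewrite addr_ge0// mulr_ge0 ?wJ0//; lra.
Qed.

(** The holdings [d] are replaced by the slopes [- b] of the envelope. As [b j <= b J], the
    condition at infinity has to be checked only at [x J], where weights of at least [del] bound the
    slack by [C / del]; division by [K - x J] gives [kap]. *)
Lemma pair_limit e g d n C del : (1 <= n < N)%N -> 0 < del ->
  (forall n, (1 <= n <= N)%N -> del <= ext_weight J n) ->
  (forall j k, (j <= J.+1)%N -> (k <= J.+1)%N ->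
     0 <= e j + g k + (ext_grid k - ext_grid j) * d j) ->
  pair_cost e g n <= C ->
  let kap := C / del / (K - x J) in
  exists d' : nat -> R,
    [/\ forall j k, (j <= J)%N -> (k <= J)%N -> 0 <= e j + g k + (x k - x j) * d' j,
        forall j, (j <= J)%N -> 0 <= asym_slope g J.+1 + kap + d' j &
        0 <= asym_slope e J.+1 + asym_slope g J.+1 + kap].
Proof.
move=> nN del0 wJ egd gC kap.
have [phi [b [ephi phib C']]] := pair_envelope nN egd.
have nN1 : (1 <= n <= N)%N by case/andP: nN => -> /ltnW.
have nN2 : (1 <= n.+1 <= N)%N by case/andP: nN.
have [eJ gJ] := ephi J (leqnSn J).
have eg : (e J + phi J) + (g J - phi J) <= C / del.
  rewrite ler_pdivlMr//; apply: le_trans (le_trans C' gC).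
  have : 0 <= (e J + phi J) * (ext_weight J n - del).
    by rewrite mulr_ge0 ?subr_ge0 ?wJ//; lra.
  have : 0 <= (g J - phi J) * (ext_weight J n.+1 - del).
    by rewrite mulr_ge0 ?subr_ge0 ?wJ//; lra.
  lra.
have gridJ j : (j <= J)%N -> ext_grid j = x j by rewrite /ext_grid => ->.
have gridK : ext_grid J.+1 = K by rewrite /ext_grid ltnn.
have bmono j : (j <= J)%N -> b j <= b J.
  rewrite leq_eqVlt => /predU1P[->//|jJ].
  have := phib j J (leqW (ltnW jJ)) (leqnSn J).
  have := phib J j (leqnSn J) (leqW (ltnW jJ)).
  rewrite !gridJ ?(ltnW jJ)// => H1 H2.
  have xj : x j < x J by apply: (grid_lt xS); rewrite jJ leqnn.
  have : (b J - b j) * (x J - x j) >= 0 by lra.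
  by rewrite pmulr_lge0 ?subr_gt0// subr_ge0.
exists (fun j => - b j); split.
- move=> j k jJ kJ; have := phib k j (leqW kJ) (leqW jJ).
  rewrite !gridJ//; have := ephi j (leqW jJ); have := ephi k (leqW kJ); lra.
- move=> j jJ; rewrite /asym_slope ltnn /kap -mulrDl subr_ge0 ler_pdivlMr//.
  have : 0 <= (b J - b j) * (K - x J) by rewrite mulr_ge0 ?(ltW dK)// subr_ge0 bmono.
  have := phib J.+1 J (leqnn _) (leqnSn J); rewrite (gridJ _ (leqnn J)) gridK.
  have := ephi J.+1 (leqnn _); lra.
- rewrite /asym_slope ltnn /kap -!mulrDl divr_ge0 ?(ltW dK)//.
  have := egd J.+1 J.+1 (leqnn _) (leqnn _); rewrite subrr mul0r addr0; lra.
Qed.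

End FiniteGrid.

Lemma le_sum_norm (R : realType) (F : nat -> nat -> R) M N j n :
  (j < M)%N -> (1 <= n <= N)%N ->
  F j n <= \sum_(1 <= i < N.+1) \sum_(0 <= k < M) `|F k i|.
Proof.
move=> jM nN; rewrite (bigD1_seq n) ?mem_index_iota ?iota_uniq//=.
rewrite (bigD1_seq j) ?mem_index_iota ?iota_uniq//= -addrA.
apply: le_trans (ler_norm _) _; rewrite lerDl addr_ge0 ?sumr_ge0// => i _.
by rewrite sumr_ge0.
Qed.

(** * Optimal hedges on the grid and in the limit *)

Section OptimalHedges.
Variables (R : realType) (N J : nat) (s0 : R) (x : nat -> R).
Variables (c : nat -> nat -> R) (a : R -> nat -> R) (l : nat -> R).
Hypotheses (N1 : (1 <= N)%N) (J1 : (1 <= J)%N).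
Hypotheses (x00 : x 0%N = 0) (xS : forall j, (j < J)%N -> x j < x j.+1).
Hypothesis c0 : forall n, (1 <= n <= N)%N -> c 0%N n = s0.
Hypothesis cJ0 : forall n, (1 <= n <= N)%N -> 0 < c J n.
Hypothesis cS : forall j n, (1 <= j <= J)%N -> (1 <= n < N)%N -> c j n <= c j n.+1.
Let p := phat J s0 x c.
Hypothesis p_ge0 : forall j n, (j <= J)%N -> (1 <= n <= N)%N -> 0 <= p j n.
Hypothesis a_ge0 : forall y n, (1 <= n <= N)%N -> 0 <= y -> 0 <= a y n.
Hypothesis l_ge0 : forall n, (1 <= n <= N)%N -> 0 <= l n.

Variable K : R.
Hypothesis xK : x J < K.
Local Notation grd := (ext_grid J x K).
Local Notation q := (ext_weight J s0 x c K).
Hypothesis wJ0 : forall n, (1 <= n <= N)%N -> 0 <= q J n.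

Definition ext_hedge := grid_hedge N J.+2 (fun _ _ => 1) (fun _ _ => 1)
  (fun j k => grd k - grd j) (fun j n => a (grd j) n).
Definition ext_pricing := grid_pricing N J.+2 (fun _ _ => 1) (fun _ _ => 1)
  (fun j k => grd k - grd j) q.
Definition inf_hedge := grid_hedge N J.+2 (inf_al R J) (inf_be R J) (inf_ga J x)
  (inf_payoff J x a l).
Definition inf_pricing := grid_pricing N J.+2 (inf_al R J) (inf_be R J) (inf_ga J x) p.

Let dK : 0 < K - x J. Proof. by rewrite subr_gt0. Qed.

Lemma ext_grid_ge0 j : 0 <= grd j.
Proof.
rewrite /ext_grid; case: ifP => jJ; first exact: (grid_ge0 x00 xS).
by rewrite (le_trans _ (ltW xK))// (grid_ge0 x00 xS).
Qed.

Lemma p_all_ge0 j n : (j < J.+2)%N -> (1 <= n <= N)%N -> 0 <= p j n.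
Proof.
rewrite ltnS leq_eqVlt => /predU1P[->|jJ] nN; last exact: p_ge0.
by rewrite /p /phat /= ltnNge leqnSn /= gtn_eqF//= ltW// cJ0.
Qed.

Lemma grid_cost_pairs e1 e2 v :
  grid_cost N J.+2 q e1 e2 v =
  \sum_(1 <= n < N) pair_cost J s0 x c K (e1^~ n) (e2^~ n.+1) n
  + \sum_(0 <= j < J.+2) v j N * q j N.
Proof. by []. Qed.

Lemma ext_hedge_rows e1 e2 v d1 d2 n : ext_hedge e1 e2 v d1 d2 -> (1 <= n < N)%N ->
  (forall j k, (j <= J.+1)%N -> (k <= J.+1)%N ->
     0 <= e1 j n + e2 k n.+1 + (grd k - grd j) * d1 j n) /\
  (forall j k, (j <= J.+1)%N -> (k <= J.+1)%N ->
     0 <= (e1 j n - v j n) + (e2 k n.+1 + v k n.+1) + (grd k - grd j) * d2 j n).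
Proof.
move=> [rw _] nN; split=> j k jJ kJ; have [] := rw j k n jJ kJ nN;
  by rewrite !mul1r.
Qed.

Let vsum (v : nat -> nat -> R) n := \sum_(0 <= j < J.+2) v j n * q j n.

Lemma vsum_ge0 e1 e2 v d1 d2 n : ext_hedge e1 e2 v d1 d2 -> (1 <= n <= N)%N ->
  0 <= vsum v n.
Proof.
move=> [_ vw] nN; rewrite /vsum big_nat sumr_ge0// => j /andP[_ jJ].
have v0 : 0 <= v j n by rewrite (le_trans _ (vw j n jJ nN))// a_ge0// ext_grid_ge0.
by rewrite mulr_ge0// (ext_weight_ge0 cJ0 p_ge0 xK wJ0).
Qed.

(** [pair1] is the cost of a period before exercise; [pair2] is that of a period after it, in which
    [v n] is exchanged for [v n.+1]. *)
Let pair1 e1 e2 n := pair_cost J s0 x c K (e1^~ n) (e2^~ n.+1) n.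
Let pair2 e1 e2 v n := pair1 e1 e2 n - vsum v n + vsum v n.+1.

Let pair2E e1 e2 v n : pair_cost J s0 x c K (fun j => e1 j n - v j n)
   (fun k => e2 k n.+1 + v k n.+1) n = pair2 e1 e2 v n.
Proof.
rewrite /pair2 /pair1 /pair_cost /vsum.
by rewrite (sum_mulBl (e1^~ n) (v^~ n)) (sum_mulDl (e2^~ n.+1) (v^~ n.+1)); ring.
Qed.

Lemma ext_hedge_pairs_ge0 e1 e2 v d1 d2 n : ext_hedge e1 e2 v d1 d2 ->
  (1 <= n < N)%N -> 0 <= pair1 e1 e2 n /\ 0 <= pair2 e1 e2 v n.
Proof.
move=> h nN; have [r1 r2] := ext_hedge_rows h nN.
have H := @pair_cost_ge0 R N J s0 x c J1 x00 xS c0 cJ0 cS p_ge0 K xK wJ0.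
split; first exact: (H _ _ _ _ nN r1).
have := H _ (fun k => e2 k n.+1 + v k n.+1) _ _ nN r2.
by rewrite pair2E.
Qed.

(* Exercising at date [n]: the earlier periods are hedged by [d1], the later
   ones by [d2]. *)
Lemma ext_cost_split e1 e2 v n : (1 <= n <= N)%N ->
  grid_cost N J.+2 q e1 e2 v =
  \sum_(1 <= i < n) pair1 e1 e2 i + \sum_(n <= i < N) pair2 e1 e2 v i + vsum v n.
Proof.
move=> /andP[n1 nN]; rewrite grid_cost_pairs (@big_cat_nat _ _ _ n)//= -addrA -[RHS]addrA.
congr (_ + _); rewrite /pair2.
rewrite [in RHS](eq_bigr (fun i => pair1 e1 e2 i + (vsum v i.+1 - vsum v i))); last first.
  by move=> i _; rewrite addrAC -addrA.
rewrite [in RHS]big_split /= telescope_sumr// -addrA; congr (_ + _).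
by rewrite subrK.
Qed.

Lemma ext_cost_ge0 e1 e2 v d1 d2 : ext_hedge e1 e2 v d1 d2 ->
  0 <= grid_cost N J.+2 q e1 e2 v.
Proof.
move=> h; have NN : (1 <= N <= N)%N by rewrite N1 leqnn.
rewrite (ext_cost_split _ _ _ NN) [X in _ + X + _]big_geq// addr0.
rewrite addr_ge0 ?(vsum_ge0 h)// big_nat sumr_ge0// => n nN.
by have [] := ext_hedge_pairs_ge0 h nN.
Qed.

(** All terms of [ext_cost_split] are nonnegative, so each is at most the total. Exercise at [n]
    yields the bounds on [vsum v n] and [pair2], exercise at [N] the one on [pair1]. *)
Lemma ext_cost_bounds e1 e2 v d1 d2 C n : ext_hedge e1 e2 v d1 d2 ->
  grid_cost N J.+2 q e1 e2 v <= C -> (1 <= n <= N)%N ->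
  vsum v n <= C /\ ((n < N)%N -> pair1 e1 e2 n <= C /\ pair2 e1 e2 v n <= C).
Proof.
move=> h hC nN; have NN : (1 <= N <= N)%N by rewrite N1 leqnn.
have sub_sum (F : nat -> R) b m : (forall i, (b <= i < N)%N -> 0 <= F i) ->
    (b <= m < N)%N -> F m <= \sum_(b <= i < N) F i.
  move=> F0 bm; rewrite (bigD1_seq m) ?mem_index_iota ?iota_uniq//= lerDl.
  by rewrite big_mkcond big_nat sumr_ge0// => i bi; case: ifP => // _; exact: F0.
have n1 : (1 <= n)%N by case/andP: nN.
have P1 i : (1 <= i < N)%N -> 0 <= pair1 e1 e2 i.
  by move=> iN; have [] := ext_hedge_pairs_ge0 h iN.
have P2 i : (n <= i < N)%N -> 0 <= pair2 e1 e2 v i.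
  move=> /andP[ni iN].
  by have [|] := @ext_hedge_pairs_ge0 e1 e2 v d1 d2 i h; rewrite ?iN ?(leq_trans n1).
have S1 : 0 <= \sum_(1 <= i < n) pair1 e1 e2 i.
  rewrite big_nat sumr_ge0// => i /andP[i1 im]; apply: P1; rewrite i1 (leq_trans im)//.
  by case/andP: nN.
have S2 : 0 <= \sum_(n <= i < N) pair2 e1 e2 v i.
  by rewrite big_nat sumr_ge0.
have V0 := vsum_ge0 h nN; have VN := vsum_ge0 h NN.
have E := ext_cost_split e1 e2 v nN; split; first by lra.
move=> nN'; have nN2 : (1 <= n < N)%N by rewrite n1.
split.
  have := ext_cost_split e1 e2 v NN; rewrite [X in _ + X + _]big_geq// addr0.
  have := sub_sum _ 1%N n P1 nN2; lra.
have := sub_sum _ n n P2; rewrite leqnn nN' => /(_ isT); lra.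
Qed.

Lemma ext_optimum : exists e1 e2 v d1 d2 f g1 g2,
  [/\ ext_hedge e1 e2 v d1 d2, ext_pricing f g1 g2 &
      grid_cost N J.+2 q e1 e2 v =
      grid_price N J.+2 (fun j n => a (grd j) n) f].
Proof.
(* A constant above all payoffs on the grid: holding it as [v], with everything else zero, is a
   feasible hedge. *)
pose V := \sum_(1 <= i < N.+1) \sum_(0 <= k < J.+2) `|a (grd k) i|.
apply: (@grid_strong_duality R N J.+2 _ _ _ q _ N1 (fun _ _ => 0)
  (fun _ _ => 0) (fun _ _ => V) (fun _ _ => 0) (fun _ _ => 0)) => //.
  split=> [j k n _ _ _|j n jJ nN]; first by rewrite !mulr0 !mul1r !addr0 !add0r addNr.
  exact: (@le_sum_norm R (fun j n => a (grd j) n)).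
by move=> e1 e2 v d1 d2; exact: ext_cost_ge0.
Qed.

Lemma inf_hedge_rows e1 e2 v d1 d2 n : inf_hedge e1 e2 v d1 d2 -> (1 <= n < N)%N ->
  [/\ forall j k, (j <= J)%N -> (k <= J)%N ->
        0 <= e1 j n + e2 k n.+1 + (x k - x j) * d1 j n,
      forall j, (j <= J)%N -> 0 <= e2 J.+1 n.+1 + d1 j n &
      0 <= e1 J.+1 n + e2 J.+1 n.+1] /\
  [/\ forall j k, (j <= J)%N -> (k <= J)%N ->
        0 <= (e1 j n - v j n) + (e2 k n.+1 + v k n.+1) + (x k - x j) * d2 j n,
      forall j, (j <= J)%N -> 0 <= (e2 J.+1 n.+1 + v J.+1 n.+1) + d2 j n &
      0 <= (e1 J.+1 n - v J.+1 n) + (e2 J.+1 n.+1 + v J.+1 n.+1)].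
Proof.
move=> [rw vw] nN; rewrite /inf_al /inf_be /inf_ga in rw; split; split.
- move=> j k jJ kJ; have [+ _] := rw j k n (leqW jJ) (leqW kJ) nN.
  by rewrite jJ kJ orbT !mul1r.
- move=> j jJ; have [+ _] := rw j J.+1 n (leqW jJ) (ltnSn _) nN.
  by rewrite jJ eqxx ltnn ltn_eqF ?ltnS//=; lra.
- have [+ _] := rw J.+1 J.+1 n (ltnSn _) (ltnSn _) nN.
  by rewrite eqxx ltnn /=; lra.
- move=> j k jJ kJ; have [_] := rw j k n (leqW jJ) (leqW kJ) nN.
  by rewrite jJ kJ orbT !mul1r.
- move=> j jJ; have [_] := rw j J.+1 n (leqW jJ) (ltnSn _) nN.
  by rewrite jJ eqxx ltnn ltn_eqF ?ltnS//=; lra.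
- have [_] := rw J.+1 J.+1 n (ltnSn _) (ltnSn _) nN.
  by rewrite eqxx ltnn /=; lra.
Qed.

(** The interpolants satisfy the hedging inequality at all prices, hence on the grid with node [K].
    Their one-period cost there is unchanged, because their slope beyond [x J] is the value at
    infinity. *)
Lemma inf_pair_ge0 e g d n : (1 <= n < N)%N ->
  (forall j k, (j <= J)%N -> (k <= J)%N -> 0 <= e j + g k + (x k - x j) * d j) ->
  (forall j, (j <= J)%N -> 0 <= g J.+1 + d j) -> 0 <= e J.+1 + g J.+1 ->
  0 <= \sum_(0 <= j < J.+2) e j * p j n + \sum_(0 <= j < J.+2) g j * p j n.+1.
Proof.
move=> nN r1 r2 r3; have [D HD] := semistatic_hedge x00 xS r1 r2 r3.
have E (F : nat -> R) m : \sum_(0 <= j < J.+2) F j * p j m =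
    \sum_(0 <= j < J.+2) pwl J x F (grd j) * q j m.
  rewrite ext_weight_sum//; apply: eq_big_nat => j /andP[_].
  rewrite ltnS leq_eqVlt => /predU1P[->|jJ].
    rewrite /asym_slope ltnn /ext_grid leqnn ltnn (pwl_grid xS)//.
    have sK : in_seg J x J K by split; rewrite ?ltnn// ltW.
    rewrite (pwl_seg xS _ sK) /seg_slope ltnn; congr (_ * _).
    by field; rewrite gt_eqF.
  rewrite ltnS in jJ.
  by rewrite /asym_slope jJ /ext_grid jJ (pwl_grid xS).
rewrite !E.
apply: (@pair_cost_ge0 R N J s0 x c J1 x00 xS c0 cJ0 cS p_ge0 K xK wJ0 _ _
  (fun j => pwc J x D (grd j))) => // j k _ _.
by apply: HD; exact: ext_grid_ge0.
Qed.

Lemma inf_cost_ge0 e1 e2 v d1 d2 : inf_hedge e1 e2 v d1 d2 ->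
  0 <= grid_cost N J.+2 p e1 e2 v.
Proof.
move=> h; rewrite /grid_cost addr_ge0//.
  rewrite big_nat sumr_ge0// => n nN; have [[r1 r2 r3] _] := inf_hedge_rows h nN.
  exact: (inf_pair_ge0 nN r1 r2 r3).
have NN : (1 <= N <= N)%N by rewrite N1 leqnn.
rewrite big_nat sumr_ge0// => j /andP[_ jJ]; rewrite mulr_ge0 ?p_all_ge0//.
apply: le_trans (h.2 j N jJ NN); rewrite /inf_payoff; case: ifP => jJ'.
  by rewrite a_ge0// (grid_ge0 x00 xS).
exact: l_ge0.
Qed.

Lemma inf_optimum : exists e1 e2 v d1 d2 f g1 g2,
  [/\ inf_hedge e1 e2 v d1 d2, inf_pricing f g1 g2 &
      grid_cost N J.+2 p e1 e2 v = grid_price N J.+2 (inf_payoff J x a l) f].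
Proof.
pose V := \sum_(1 <= i < N.+1) \sum_(0 <= k < J.+2) `|inf_payoff J x a l k i|.
have V0 : 0 <= V by rewrite sumr_ge0// => i _; rewrite sumr_ge0.
(* The constant [V] as [v] also acts as a slope at infinity; moving from there to a finite node
   requires [d2 <= - V], hence the holding [- V] at that node. *)
apply: (@grid_strong_duality R N J.+2 _ _ _ p _ N1 (fun _ _ => 0)
  (fun _ _ => 0) (fun _ _ => V) (fun _ _ => 0)
  (fun j _ => if (j <= J)%N then 0 else - V)) => //.
  split=> [j k n jM kM _|j n jJ nN]; last exact: le_sum_norm.
  rewrite /inf_al /inf_be /inf_ga !mulr0 !addr0; split=> //.
  have last i : (i < J.+2)%N -> (J < i)%N -> i = J.+1.
    by rewrite ltnS => iJ Ji; apply/eqP; rewrite eqn_leq iJ.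
  rewrite !add0r; case: (leqP j J) => [jJ|/(last _ jM) ->];
    case: (leqP k J) => [kJ|/(last _ kM) ->] /=.
  - by rewrite orbT /=; lra.
  - by rewrite ltn_eqF ?ltnS//= ?ltnn /=; lra.
  - by rewrite eqxx ?ltn_eqF ?ltnS//= ?ltnn /=; lra.
  - by rewrite eqxx ?orbT /=; lra.
by move=> e1 e2 v d1 d2; exact: inf_cost_ge0.
Qed.


Let kap (C del : R) := C / del / (K - x J).

(* The values at [x J] are within [C / del] of a convex envelope, so the slopes
   towards [K] satisfy the conditions at infinity up to [kap C del]. *)
Lemma inf_hedge_of_ext e1 e2 v d1 d2 C del eta :
  0 < del -> (forall n, (1 <= n <= N)%N -> del <= q J n) ->
  ext_hedge e1 e2 v d1 d2 -> grid_cost N J.+2 q e1 e2 v <= C ->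
  0 < K -> 0 <= eta -> (forall n, (1 <= n <= N)%N -> l n - eta <= a K n / K) ->
  exists e1' e2' v' d1' d2', inf_hedge e1' e2' v' d1' d2' /\
    grid_cost N J.+2 p e1' e2' v' <= grid_cost N J.+2 q e1 e2 v
      + kap C del * (\sum_(1 <= n < N) c J n.+1) + (eta + kap C del) * c J N.
Proof.
move=> del0 wJ h hC K0 eta0 lK.
pose k := kap C del.
have lim1 n : exists d' : nat -> R, (1 <= n < N)%N ->
    [/\ forall j k, (j <= J)%N -> (k <= J)%N ->
          0 <= e1 j n + e2 k n.+1 + (x k - x j) * d' j,
        forall j, (j <= J)%N -> 0 <= asym_slope J x K (e2^~ n.+1) J.+1 + k + d' j &
        0 <= asym_slope J x K (e1^~ n) J.+1 + asym_slope J x K (e2^~ n.+1) J.+1 + k].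
  have [nN|] := boolP (1 <= n < N)%N; last by exists (fun=> 0).
  have [r1 _] := ext_hedge_rows h nN.
  have nN' : (1 <= n <= N)%N by case/andP: nN => -> /ltnW ->.
  have [_ /(_ _)] := ext_cost_bounds h hC nN'.
  case/andP: (nN) => _ nN'' /(_ nN'')[p1 _].
  have [d' Hd'] := pair_limit J1 x00 xS c0 cJ0 cS p_ge0 xK wJ0 nN del0 wJ r1 p1.
  by exists d'.
have lim2 n : exists d' : nat -> R, (1 <= n < N)%N ->
    [/\ forall j k, (j <= J)%N -> (k <= J)%N ->
          0 <= e1 j n - v j n + (e2 k n.+1 + v k n.+1) + (x k - x j) * d' j,
        forall j, (j <= J)%N ->
          0 <= asym_slope J x K (fun j => e2 j n.+1 + v j n.+1) J.+1 + k + d' j &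
        0 <= asym_slope J x K (fun j => e1 j n - v j n) J.+1
             + asym_slope J x K (fun j => e2 j n.+1 + v j n.+1) J.+1 + k].
  have [nN|] := boolP (1 <= n < N)%N; last by exists (fun=> 0).
  have [_ r2] := ext_hedge_rows h nN.
  have nN' : (1 <= n <= N)%N by case/andP: nN => -> /ltnW ->.
  have [_ /(_ _)] := ext_cost_bounds h hC nN'.
  case/andP: (nN) => _ nN'' /(_ nN'')[_ p2].
  have p2' : pair_cost J s0 x c K (fun j => e1 j n - v j n)
      (fun j => e2 j n.+1 + v j n.+1) n <= C by rewrite pair2E.
  have [d' Hd'] := pair_limit J1 x00 xS c0 cJ0 cS p_ge0 xK wJ0 nN del0 wJ r2 p2'.
  by exists d'.
have [D1 HD1] := choice lim1; have [D2 HD2] := choice lim2.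
(* Values at strikes are kept. At infinity [e2] gets the error [k] of [pair_limit]. [v] gets
   [eta + k]: [eta] for replacing the limit slope by [a K n / K], and [k] for subtracting [v J n],
   which is at most [C / del]. *)
pose e1' j n := asym_slope J x K (e1^~ n) j.
pose e2' j n := asym_slope J x K (e2^~ n) j + (if (j <= J)%N then 0 else k).
pose v' j n := asym_slope J x K (v^~ n) j + (if (j <= J)%N then 0 else eta + k).
have C0 : 0 <= C by apply: le_trans hC; exact: ext_cost_ge0 h.
have k0 : 0 <= k by rewrite /k /kap !divr_ge0// ltW.
(* The holdings at the node at infinity are constrained only from above, so the largest admissible
   ones are taken. *)
exists e1', e2', v',
  (fun j n => if (j <= J)%N then D1 n j else e1' J.+1 n),
  (fun j n => if (j <= J)%N then D2 n j else e1' J.+1 n - v' J.+1 n); split; last first.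
  rewrite /grid_cost.
  have E2 n : \sum_(0 <= j < J.+2) e2' j n * p j n =
      \sum_(0 <= j < J.+2) e2 j n * q j n + k * c J n.
    rewrite /e2' sum_mulDl -ext_weight_sum//; congr (_ + _).
    rewrite big_nat_recr//= big_nat big1 ?add0r => [|j /andP[_]]; last first.
      by rewrite ltnS => ->; rewrite mul0r.
    by rewrite ltnn /p /phat /= ltnNge leqnSn /= gtn_eqF.
  have EV n : \sum_(0 <= j < J.+2) v' j n * p j n =
      \sum_(0 <= j < J.+2) v j n * q j n + (eta + k) * c J n.
    rewrite /v' sum_mulDl -ext_weight_sum//; congr (_ + _).
    rewrite big_nat_recr//= big_nat big1 ?add0r => [|j /andP[_]]; last first.
      by rewrite ltnS => ->; rewrite mul0r.
    by rewrite ltnn /p /phat /= ltnNge leqnSn /= gtn_eqF.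
  rewrite EV addrA; apply: lerD => //.
  rewrite [leRHS]addrAC lerD2r mulr_sumr -big_split /=.
  rewrite le_eqVlt; apply/orP; left; apply/eqP; apply: eq_bigr => n _.
  by rewrite E2 -ext_weight_sum// addrA.
have last i : (i < J.+2)%N -> (i <= J)%N \/ i = J.+1.
  by rewrite ltnS leq_eqVlt => /predU1P[->|]; [right|left; rewrite -ltnS].
have asJ F j : (j <= J)%N -> asym_slope J x K F j = F j.
  by rewrite /asym_slope => ->.
have asD F G : asym_slope J x K (fun j => F j + G j) J.+1 =
    asym_slope J x K F J.+1 + asym_slope J x K G J.+1.
  by rewrite /asym_slope ltnn; ring.
have asB F G : asym_slope J x K (fun j => F j - G j) J.+1 =
    asym_slope J x K F J.+1 - asym_slope J x K G J.+1.
  by rewrite /asym_slope ltnn; ring.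
split=> [j i n jM iM nN|j n jM nN].
  have [r1a r1b r1c] := HD1 n nN; have [r2a r2b r2c] := HD2 n nN.
  rewrite asD in r2b; rewrite asB asD in r2c.
  rewrite /inf_al /inf_be /inf_ga.
  have [jJ|->] := last j jM; have [iJ|->] := last i iM.
  - rewrite jJ iJ orbT !mul1r /e1' /e2' /v' iJ jJ !asJ// !addr0.
    by split; [exact: r1a|exact: r2a].
  - rewrite jJ eqxx ltn_eqF ?ltnS//= ltnn /= !mul0r !mul1r /e1' /e2' /v' ltnn.
    have := r1b j jJ; have := r2b j jJ; split; lra.
  - rewrite eqxx iJ [i == _]ltn_eqF ?ltnS//= ltnn /= !mul0r !mul1r; split; lra.
  - rewrite eqxx ltnn /= !mul1r !mul0r !addr0 /e1' /e2' /v' ltnn; split; lra.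
have [jJ|->] := last j jM; rewrite /inf_payoff ?jJ ?ltnn /v' ?jJ ?ltnn.
  rewrite asJ// addr0; have := h.2 j n jM nN.
  by rewrite /ext_grid jJ.
have vJ : v J n <= C / del.
  rewrite ler_pdivlMr//.
  have [VC _] := ext_cost_bounds h hC nN; apply: le_trans VC.
  have v0 i : (i < J.+2)%N -> 0 <= v i n.
    by move=> iJ; rewrite (le_trans _ (h.2 i n iJ nN))// a_ge0// ext_grid_ge0.
  rewrite /vsum (bigD1_seq J) ?mem_index_iota ?iota_uniq//=.
  apply: ler_wpDr; last by rewrite ler_wpM2l ?v0 ?wJ.
  rewrite big_mkcond big_nat sumr_ge0// => i /andP[_ iJ]; case: ifP => // _.
  by rewrite mulr_ge0 ?v0// (ext_weight_ge0 cJ0 p_ge0 xK wJ0).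
have vK := h.2 J.+1 n (ltnSn _) nN.
rewrite /ext_grid ltnn in vK.
rewrite /asym_slope ltnn.
have aK : a K n / K <= a K n / (K - x J).
  rewrite ler_wpM2l ?a_ge0 ?(ltW K0)// lef_pV2 ?posrE// lerBlDr lerDl.
  exact: (grid_ge0 x00 xS).
have := lK n nN.
suff : a K n / (K - x J) <= (v J.+1 n - v J n) / (K - x J) + k by lra.
rewrite /k /kap -mulrDl ler_pM2r ?invr_gt0//; lra.
Qed.

End OptimalHedges.

(** * Discrete models *)

Section MarkovChain.
Variables (R : realType) (S : finType) (N : nat).
Variables (m : nat -> S -> R) (G : nat -> S -> S -> R).
Hypothesis m1_ge0 : forall s, 0 <= m 1%N s.
Hypothesis G_ge0 : forall n s t, (1 <= n < N)%N -> 0 <= G n s t.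
Hypothesis G_out : forall n s, (1 <= n < N)%N -> \sum_t G n s t = m n s.
Hypothesis G_in : forall n t, (1 <= n < N)%N -> \sum_s G n s t = m n.+1 t.

Lemma flow_cond_sum n s (h : S -> R) : (1 <= n < N)%N ->
  m n s * (\sum_t G n s t / m n s * h t) = \sum_t G n s t * h t.
Proof.
move=> nN; rewrite mulr_sumr; apply: eq_bigr => t _.
have [m0|m0] := eqVneq (m n s) 0; last by rewrite mulrA mulrCA divff// mulr1.
have -> : G n s t = 0; last by rewrite !mul0r mulr0.
have /eqP : \sum_t G n s t = 0 by rewrite G_out.
by rewrite psumr_eq0 => [/allP/(_ t)|? _]; rewrite ?mem_index_enum ?G_ge0// => /(_ isT)/eqP.
Qed.

(** Induction on the length: each path is extended by one step with probabilities [G n s t / m n s].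
    States of mass zero, where the quotient is 0, are never reached by paths of nonzero weight. The
    last clause is the Markov property, tested against functions [A] of the path up to date [i]. *)
Lemma markov_chain L : (1 <= L <= N)%N ->
  exists (O : finType) (W : O -> R) (st : nat -> O -> S),
  [/\ forall w, 0 <= W w,
      forall i h, (1 <= i <= L)%N -> \sum_w W w * h (st i w) = \sum_s m i s * h s,
      forall w i, W w != 0 -> (1 <= i < L)%N -> G i (st i w) (st i.+1 w) != 0 &
      forall i (A : O -> R) (h : S -> S -> R), (1 <= i < L)%N ->
        (forall w w', (forall k, (1 <= k <= i)%N -> st k w = st k w') -> A w = A w') ->
        \sum_w W w * A w * h (st i w) (st i.+1 w) =
        \sum_w W w * A w * (\sum_t G i (st i w) t / m i (st i w) * h (st i w) t)].
Proof.
elim: L => // -[_ _|L IH /andP[_ LN]].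
  exists S, (m 1%N), (fun _ w => w); split => //.
  - by move=> i h; rewrite -eqn_leq => /eqP <-.
  - by move=> w i _ /andP[i1]; rewrite ltnS leqn0 => /eqP i0; move: i1; rewrite i0.
  - by move=> i A h /andP[i1]; rewrite ltnS leqn0 => /eqP i0; move: i1; rewrite i0.
have L1N : (1 <= L.+1 < N)%N by [].
have [Om [W [st [W0 marg pos mark]]]] := IH (ltnW LN).
pose tr w t := G L.+1 (st L.+1 w) t / m L.+1 (st L.+1 w).
have mW w : W w != 0 -> m L.+1 (st L.+1 w) != 0.
  move=> Ww; apply/eqP => mw.
  have := marg L.+1 (fun s => (s == st L.+1 w)%:R); rewrite leqnn => /(_ isT).
  rewrite [RHS](bigD1 (st L.+1 w))//= mw mul0r add0r [in RHS]big1; last first.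
    by move=> s /negPf ->; rewrite mulr0.
  move/eqP; rewrite psumr_eq0 => [/allP/(_ w)|w' _]; last by rewrite mulr_ge0.
  by rewrite mem_index_enum eqxx mulr1 (negPf Ww) => /(_ isT).
have m_ge0 w : 0 <= m L.+1 (st L.+1 w).
  by rewrite -G_out// sumr_ge0// => t _; exact: G_ge0.
have tr_ge0 w t : 0 <= tr w t by rewrite divr_ge0// G_ge0.
have Wtr w : \sum_t W w * tr w t = W w.
  have [->|Ww] := eqVneq (W w) 0; first by rewrite big1// => t _; rewrite mul0r.
  by rewrite -mulr_sumr -mulr_suml G_out// divff ?mulr1// mW.
pose W' (wt : Om * S) := W wt.1 * tr wt.1 wt.2.
pose st' i (wt : Om * S) := if i == L.+2 then wt.2 else st i wt.1.
have sumW' (F : Om * S -> R) : \sum_wt W' wt * F wt =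
    \sum_w \sum_t W w * tr w t * F (w, t).
  by rewrite pair_bigA; apply: eq_bigr => -[].
have stE i w t : (i <= L.+1)%N -> st' i (w, t) = st i w.
  by move=> iL; rewrite /st' ltn_eqF.
have stL w t : st' L.+2 (w, t) = t by rewrite /st' eqxx.
exists (Om * S)%type, W', st'; split.
- by move=> [w t]; rewrite /W' mulr_ge0.
- move=> i h /andP[i1]; rewrite leq_eqVlt => /predU1P[->|iL]; rewrite sumW'.
    under eq_bigr do under eq_bigr do rewrite stL -mulrA.
    under eq_bigr do rewrite -mulr_sumr.
    rewrite (marg L.+1 (fun s => \sum_t G L.+1 s t / m L.+1 s * h t)) ?leqnn//.
    rewrite (eq_bigr (fun s => \sum_t G L.+1 s t * h t)); last first.
      by move=> s _; rewrite flow_cond_sum.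
    by rewrite exchange_big; apply: eq_bigr => t _; rewrite -mulr_suml G_in.
  rewrite -marg ?i1//; apply: eq_bigr => w _.
  under eq_bigr do rewrite (stE _ _ _ iL).
  by rewrite -mulr_suml Wtr.
- move=> [w t] i; rewrite /W' /= mulf_eq0 negb_or => /andP[Ww twt] /andP[i1].
  rewrite ltnS leq_eqVlt => /predU1P[->|iL].
    rewrite stL stE//; move: twt; rewrite /tr mulf_eq0 negb_or.
    by case/andP.
  by rewrite !stE// ?(ltnW iL)//; apply: pos => //; rewrite i1.
- move=> i A h /andP[i1]; rewrite ltnS leq_eqVlt => iL HA.
  pose A' w := A (w, st L.+1 w).
  have iL1 : (i <= L.+1)%N by case/predU1P: iL => [->//|/ltnW].
  have AA w t : A (w, t) = A' w.
    apply: HA => k /andP[k1 ki]; rewrite !stE//; exact: leq_trans ki iL1.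
  have A'st w w' : (forall k, (1 <= k <= i)%N -> st k w = st k w') -> A' w = A' w'.
    move=> H; apply: HA => k kn; rewrite !stE ?H//; case/andP: kn => _ ki;
      exact: leq_trans ki iL1.
  have RE : \sum_w W' w * A w *
       (\sum_t G i (st' i w) t / m i (st' i w) * h (st' i w) t) =
     \sum_w W w * A' w * (\sum_t G i (st i w) t / m i (st i w) * h (st i w) t).
    under eq_bigr do rewrite -mulrA.
    rewrite sumW'; apply: eq_bigr => w _.
    under eq_bigr do rewrite AA stE//.
    by rewrite -mulr_suml Wtr mulrA.
  rewrite RE; under eq_bigr do rewrite -mulrA.
  rewrite sumW'; case/predU1P: iL => [iE|iL].
    apply: eq_bigr => w _; rewrite iE.
    under eq_bigr do rewrite AA stE// stL.
    rewrite [RHS]mulr_sumr; apply: eq_bigr => t _.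
    by rewrite /tr; ring.
  rewrite -mark ?i1//; apply: eq_bigr => w _.
  under eq_bigr do rewrite AA !stE// ?(ltnW iL)//.
  by rewrite -mulr_suml Wtr mulrA.
Qed.

End MarkovChain.

Section DiscreteProbability.
Variable R : realType.

(** On [nat] with its discrete structure every set is measurable, so the formula holds for arbitrary
    [D] and nonnegative [f], and models built on it raise no measurability questions. *)
Lemma discrete_probability (n : nat) (W : nat -> R) :
  (forall k, 0 <= W k) -> \sum_(k < n) W k = 1 ->
  exists P : probability nat R, forall (D : set nat) (f : nat -> R),
    (forall k, 0 <= f k) ->
    (\int[P]_(k in D) (f k)%:E = (\sum_(k < n) W k * ((k : nat) \in D)%:R * f k)%:E)%E.
Proof.
move=> W0 W1.
pose mu := msum (fun k => mscale (NngNum (W0 k)) (@dirac _ nat k R)) n.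
have intE (D : set nat) (f : nat -> R) : (forall k, 0 <= f k) ->
    (\int[mu]_(k in D) (f k)%:E = (\sum_(k < n) W k * ((k : nat) \in D)%:R * f k)%:E)%E.
  move=> f0; rewrite ge0_integral_measure_sum//; last by move=> k _; rewrite lee_fin.
  rewrite -sumEFin; apply: eq_bigr => k _.
  rewrite ge0_integral_mscale//; last by move=> i _; rewrite lee_fin.
  by rewrite integral_dirac// diracE !EFinM muleA.
have mu1 : mu setT = 1%E.
  rewrite /mu /msum -W1 -sumEFin; apply: eq_bigr => k _.
  by rewrite -[LHS]/((W k)%:E * \d_(k : nat) [set: nat])%E diracT mule1.
pose mu' : {measure set nat -> \bar R} := mu.
pose P : probability nat R := HB.pack (Measure.sort mu')
  (Measure_isProbability.Build _ _ _ mu' mu1).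
by exists P.
Qed.

End DiscreteProbability.

Lemma markov_chain_nat (R : realType) (S : finType) (N : nat)
    (m : nat -> S -> R) (G : nat -> S -> S -> R) :
  (1 <= N)%N -> (forall s, 0 <= m 1%N s) -> \sum_s m 1%N s = 1 ->
  (forall n s t, (1 <= n < N)%N -> 0 <= G n s t) ->
  (forall n s, (1 <= n < N)%N -> \sum_t G n s t = m n s) ->
  (forall n t, (1 <= n < N)%N -> \sum_s G n s t = m n.+1 t) ->
  exists (r : nat) (W : nat -> R) (st : nat -> nat -> S),
  [/\ forall w, 0 <= W w,
      forall i h, (1 <= i <= N)%N -> \sum_(w < r) W w * h (st i w) = \sum_s m i s * h s,
      forall w i, W w != 0 -> (1 <= i < N)%N -> G i (st i w) (st i.+1 w) != 0 &
      forall i (A : nat -> R) (h : S -> S -> R), (1 <= i < N)%N ->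
        (forall w w', (forall k, (1 <= k <= i)%N -> st k w = st k w') -> A w = A w') ->
        \sum_(w < r) W w * A w * h (st i w) (st i.+1 w) =
        \sum_(w < r) W w * A w * (\sum_t G i (st i w) t / m i (st i w) * h (st i w) t)].
Proof.
move=> N1 m1_ge0 m1_sum G_ge0 G_out G_in.
have NN : (1 <= N <= N)%N by rewrite N1 leqnn.
have [Om [W [st [W0 marg pos mark]]]] := markov_chain m1_ge0 G_ge0 G_out G_in NN.
have [w0 _|O0] := pickP (@predT Om); last first.
  have := marg 1%N (fun=> 1); rewrite N1 => /(_ isT).
  rewrite big1 => [|w]; last by have := O0 w.
  under eq_bigr do rewrite mulr1.
  by move/eqP; rewrite m1_sum eq_sym oner_eq0.
(* Numbers from [#|Om|] on decode to the default path [w0]; the sums run over smaller numbers and do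
   not see them. *)
pose enc k := nth w0 (enum Om) k.
pose dec w := index w (enum Om).
have encK w : enc (dec w) = w by rewrite /enc /dec nth_index// mem_enum.
have sumE (F : Om -> R) : \sum_(k < #|Om|) F (enc k) = \sum_w F w.
  by rewrite -[RHS]big_enum (big_nth w0) big_mkord -cardE.
exists #|Om|, (W \o enc), (fun i k => st i (enc k)); split => //=.
- by move=> i h iN; rewrite (sumE (fun w => W w * h (st i w))) marg.
- by move=> w i; exact: pos.
- move=> i A h iN HA.
  have AE k : A k = A (dec (enc k)) by apply: HA => j _; rewrite encK.
  under eq_bigr do rewrite AE; under [in RHS]eq_bigr do rewrite AE.
  rewrite (sumE (fun w => W w * A (dec w) * h (st i w) (st i.+1 w))).
  rewrite (sumE (fun w => W w * A (dec w) *
    (\sum_t G i (st i w) t / m i (st i w) * h (st i w) t))).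
  apply: mark => // w w' ww'; apply: HA => j ji; rewrite !encK; exact: ww'.
Qed.

(** * From a pricing solution to a chain with an exercise flag *)

Section StoppingChain.
Variables (R : realType) (N J : nat).
Variables (q : nat -> nat -> R) (grd : nat -> R).
Hypothesis N1 : (1 <= N)%N.
Hypothesis q_ge0 : forall j n, (j < J.+2)%N -> (1 <= n <= N)%N -> 0 <= q j n.
Hypothesis q_sum : \sum_(0 <= j < J.+2) q j 1%N = 1.
Local Notation pricing := (grid_pricing N J.+2 (fun _ _ => 1) (fun _ _ => 1)
  (fun j k => grd k - grd j) q).
Local Notation state := ('I_J.+2 * bool)%type.

Lemma sum_state (F : state -> R) :
  \sum_s F s = \sum_(j < J.+2) (F (j, false) + F (j, true)).
Proof.
transitivity (\sum_(j < J.+2) \sum_b F (j, b)).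
  by rewrite pair_bigA; apply: eq_bigr => -[].
by apply: eq_bigr => j _; rewrite big_bool addrC.
Qed.

(* The second component of the state records whether the option has been
   exercised; the exercise decision at a date is randomised so that the masses
   of exercised and live paths are those of the linear program. *)
Lemma stopping_chain f g1 g2 : pricing f g1 g2 ->
  exists (r : nat) (W : nat -> R) (st : nat -> nat -> state),
  [/\ forall w, 0 <= W w,
      forall i h, (1 <= i <= N)%N ->
        \sum_(w < r) W w * h (nat_of_ord (st i w).1) = \sum_(0 <= j < J.+2) h j * q j i,
      forall i (A : nat -> R), (1 <= i < N)%N ->
        (forall w w', (forall k, (1 <= k <= i)%N -> st k w = st k w') -> A w = A w') ->
        \sum_(w < r) W w * A w * (grd (st i.+1 w).1 - grd (st i w).1) = 0,
      forall w i, W w != 0 -> (1 <= i < N)%N -> (st i w).2 -> (st i.+1 w).2 &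
      forall i h, (1 <= i <= N)%N -> (forall j, (j < J.+2)%N -> 0 <= h j) ->
        \sum_(0 <= j < J.+2) h j * f j i <=
        \sum_(w < r) W w * (((st i w).2 && ((i == 1%N) || ~~ (st i.-1 w).2))%:R
                            * h (nat_of_ord (st i w).1))].
Proof.
move=> [f0 g0 AB Cg E].
pose M := J.+2.
have g0' b (j k : 'I_M) n : (1 <= n < N)%N -> 0 <= (if b then g2 else g1) j k n.
  by move=> nN; have [] := g0 j k n (ltn_ord j) (ltn_ord k) nN; case: b.
have A' (j : 'I_M) n : (1 <= n < N)%N ->
    \sum_(k < M) g1 j k n + \sum_(k < M) g2 j k n = q j n.
  move=> nN; have [<- _] := AB j n (ltn_ord j) nN; rewrite big_mkord -big_split.
  by apply: eq_bigr => k _; rewrite mul1r.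
have B' (k : 'I_M) n : (1 <= n < N)%N ->
    \sum_(j < M) g1 j k n + \sum_(j < M) g2 j k n = q k n.+1.
  move=> nN; have [_ <-] := AB k n (ltn_ord k) nN; rewrite big_mkord -big_split.
  by apply: eq_bigr => j _; rewrite mul1r.
(* [m] is the distribution after the exercise decision at date [n], with everything exercised at
   [N]; [pre] below is the distribution on arrival, with everything live at date 1. *)
pose m n (s : state) : R :=
  if (n < N)%N then \sum_(k < M) (if s.2 then g2 else g1) s.1 k n
  else if s.2 then q s.1 n else 0.
pose pre n (s : state) : R :=
  if (1 < n)%N then \sum_(i < M) (if s.2 then g2 else g1) i s.1 n.-1
  else if s.2 then 0 else q s.1 n.
have mE j n : (1 <= n <= N)%N -> m n (j, false) + m n (j, true) = q j n.
  move=> /andP[n1 nN]; rewrite /m /=; case: ltnP => [nN'|_]; last by rewrite add0r.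
  by rewrite A' ?n1.
have preE j n : (1 <= n <= N)%N -> pre n (j, false) + pre n (j, true) = q j n.
  move=> /andP[n1 nN]; rewrite /pre /=; case: ltnP => [n1'|_]; last by rewrite addr0.
  by rewrite B' ?prednK// -ltnS prednK// n1'.
have pre0 n s : (1 <= n <= N)%N -> 0 <= pre n s.
  move=> /andP[n1 nN]; rewrite /pre; case: ltnP => [n1'|_].
    by rewrite sumr_ge0// => i _; apply: g0'; rewrite -ltnS prednK// n1'.
  by case: s.2 => //; rewrite q_ge0 ?n1.
have m0 n s : (1 <= n <= N)%N -> 0 <= m n s.
  move=> /andP[n1 nN]; rewrite /m; case: ltnP => [nN'|_].
    by rewrite sumr_ge0// => i _; apply: g0'; rewrite n1.
  by case: s.2 => //; rewrite q_ge0 ?n1.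
(* The mass newly exercised at date [n]. The pricing constraint says that it is at least [f j n],
   possibly more, which is why the last claim is an inequality. *)
pose u n j := m n (j, true) - pre n (j, true).
have uf n (j : 'I_M) : (1 <= n <= N)%N -> f j n <= u n j.
  move=> nN; have := E j n (ltn_ord j) nN; rewrite /u /m /pre /=.
  have -> : \sum_(0 <= i < M) 1 * g2 i j n.-1 = \sum_(i < M) g2 i j n.-1.
    by rewrite big_mkord; apply: eq_bigr => i _; rewrite mul1r.
  have -> : \sum_(0 <= k < M) 1 * g2 j k n = \sum_(k < M) g2 j k n.
    by rewrite big_mkord; apply: eq_bigr => i _; rewrite mul1r.
  case: (ltnP n N) => [_|Nn]; first by case: ifP => _; lra.
  have -> : n = N by apply/eqP; rewrite eqn_leq Nn andbT; case/andP: nN.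
  by case: ifP => _; lra.
have u0 n j : (1 <= n <= N)%N -> 0 <= u n j.
  by move=> nN; rewrite (le_trans _ (uf n j nN))// f0.
have uE n j : (1 <= n <= N)%N -> m n (j, false) = pre n (j, false) - u n j.
  by move=> nN; have := mE j n nN; have := preE j n nN; rewrite /u; lra.
pose th n j := u n j / pre n (j, false).
have upre n j : (1 <= n <= N)%N -> u n j <= pre n (j, false).
  by move=> nN; rewrite -subr_ge0 -uE ?m0.
have th01 n j : (1 <= n <= N)%N -> 0 <= th n j <= 1.
  move=> nN; rewrite divr_ge0 ?u0 ?pre0//=.
  have [p0|p0] := eqVneq (pre n (j, false)) 0; first by rewrite /th p0 invr0 mulr0.
  by rewrite ler_pdivrMr ?mul1r ?upre// lt_def p0 pre0.
have thE n j : (1 <= n <= N)%N -> pre n (j, false) * th n j = u n j.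
  move=> nN; have [p0|p0] := eqVneq (pre n (j, false)) 0; last by rewrite mulrC divfK.
  by rewrite p0 mul0r; apply/eqP; rewrite eq_le u0//= -p0 upre.
(* The exercised state is absorbing; a live path that arrives at date [n] exercises at its new node
   with conditional probability [th]. *)
pose tr n (s t : state) : R :=
  if s.2 then t.2%:R else if t.2 then th n t.1 else 1 - th n t.1.
pose G n (s t : state) : R := (if s.2 then g2 else g1) s.1 t.1 n * tr n.+1 s t.
have nNS n : (1 <= n < N)%N -> (1 <= n.+1 <= N)%N by case/andP.
have nNW n : (1 <= n < N)%N -> (1 <= n <= N)%N by case/andP => -> /ltnW.
have G_ge0 n s t : (1 <= n < N)%N -> 0 <= G n s t.
  move=> nN; rewrite mulr_ge0 ?g0'// /tr.
  have /andP[t0 t1] := th01 n.+1 t.1 (nNS n nN).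
  by case: s.2; case: t.2; rewrite ?ler01// subr_ge0.
have sumG n s (h : 'I_M -> R) : \sum_t G n s t * h t.1 =
    \sum_(k < M) (if s.2 then g2 else g1) s.1 k n * h k.
  rewrite sum_state; apply: eq_bigr => k _; rewrite /G /tr /=.
  by case: s.2; ring.
have G_out n s : (1 <= n < N)%N -> \sum_t G n s t = m n s.
  move=> nN; have := sumG n s (fun=> 1).
  under eq_bigr do rewrite mulr1; under [X in _ = X -> _]eq_bigr do rewrite mulr1.
  by move=> ->; rewrite /m; case/andP: nN => _ ->.
have G_in n t : (1 <= n < N)%N -> \sum_s G n s t = m n.+1 t.
  move=> nN; have nS := nNS n nN; rewrite sum_state; case: t => k b.
  have preS b' : pre n.+1 (k, b') = \sum_(i < M) (if b' then g2 else g1) i k n.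
    by rewrite /pre /= ltnS; case/andP: nN => ->.
  rewrite big_split /= /G /tr /= -!mulr_suml -(preS false) -(preS true).
  case: b => /=; first by rewrite mulr1 thE// /u subrK.
  by rewrite mulr0 addr0 mulrBr mulr1 thE// uE.
have m1sum : \sum_s m 1%N s = 1.
  rewrite sum_state -q_sum big_mkord; apply: eq_bigr => j _.
  by rewrite mE ?N1.
have m10 s : 0 <= m 1%N s by rewrite m0 ?N1.
have [r [W [st [W0 marg pos mark]]]] :=
  markov_chain_nat N1 m10 m1sum G_ge0 G_out G_in.
have rowG i (s : state) (h : state -> R) : (1 <= i < N)%N -> \sum_t G i s t * h t = 0 ->
    \sum_t G i s t / m i s * h t = 0.
  move=> iN h0; transitivity ((m i s)^-1 * \sum_t G i s t * h t).
    by rewrite mulr_sumr; apply: eq_bigr => t _; ring.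
  by rewrite h0 mulr0.
exists r, W, st; split => //.
- move=> i h iN; rewrite (marg i (fun s => h s.1) iN) sum_state big_mkord.
  by apply: eq_bigr => j _; rewrite -mE//= mulrDr; ring.
- move=> i A iN HA.
  rewrite (mark i A (fun s t => grd t.1 - grd s.1) iN HA) big1// => w _.
  rewrite (@rowG i (st i w) (fun t => grd t.1 - grd (st i w).1))// ?mulr0//.
  rewrite (sumG i (st i w) (fun k => grd k - grd (st i w).1)).
  have [] := Cg (st i w).1 i (ltn_ord _) iN; rewrite !big_mkord => C1 C2.
  by case: (st i w).2; [rewrite -[RHS]C2|rewrite -[RHS]C1];
    apply: eq_bigr => k _; rewrite mulrC.
- move=> w i Ww iN; have := pos w i Ww iN; rewrite /G /tr.
  by case: (st i w).2 => //; case: (st i.+1 w).2; rewrite // mulr0 eqxx.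
move=> i h iN h0.
apply: (@le_trans _ _ (\sum_(j < M) h j * u i j)).
  by rewrite big_mkord; apply: ler_sum => j _; rewrite ler_wpM2l ?h0 ?uf.
(* At date 1 the marginal alone describes exercise. Later the event is a transition from live to
   exercised, computed by the Markov property with [A = 1]. *)
case: i iN => [//|[|i]] iN /=.
  under [leRHS]eq_bigr do rewrite andbT.
  rewrite (marg 1%N (fun s => s.2%:R * h s.1))// sum_state.
  by apply: ler_sum => j _ /=; rewrite mul0r mulr0 add0r mul1r mulrC /u /pre /= subr0.
have iN' : (1 <= i.+1 < N)%N by [].
have /= := mark i.+1 (fun=> 1) (fun s t => (t.2 && ~~ s.2)%:R * h t.1) iN' (fun _ _ _ => erefl).
under eq_bigr do rewrite mulr1; move=> ->.
under [leRHS]eq_bigr do rewrite mulr1.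
rewrite (marg i.+1 (fun s => \sum_t G i.+1 s t / m i.+1 s * ((t.2 && ~~ s.2)%:R * h t.1)) (nNW _ iN')).
under [leRHS]eq_bigr do rewrite (flow_cond_sum G_ge0 G_out)//.
rewrite sum_state.
rewrite [leRHS](eq_bigr (fun j : 'I_M => \sum_(k < M) g1 j k i.+1 * th i.+2 k * h k)); last first.
  move=> j _; rewrite [X in _ + X]big1 ?addr0; last first.
    by move=> t _; rewrite andbF mul0r mulr0.
  rewrite sum_state; apply: eq_bigr => k _; rewrite /G /tr /=; ring.
rewrite exchange_big; apply: ler_sum => k _ /=.
rewrite -mulr_suml -mulr_suml -thE// mulrC.
by rewrite /pre.
Qed.

End StoppingChain.

(** * Models supported on the finite grid *)

Section FiniteModel.
Variables (R : realType) (N J : nat) (s0 : R) (x : nat -> R).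
Variables (c : nat -> nat -> R) (a : R -> nat -> R).
Hypotheses (N1 : (1 <= N)%N) (J1 : (1 <= J)%N) (s0_gt0 : 0 < s0).
Hypotheses (x00 : x 0%N = 0) (xS : forall j, (j < J)%N -> x j < x j.+1).
Hypothesis c0 : forall n, (1 <= n <= N)%N -> c 0%N n = s0.
Hypothesis cJ0 : forall n, (1 <= n <= N)%N -> 0 < c J n.
Let p := phat J s0 x c.
Hypothesis p_ge0 : forall j n, (j <= J)%N -> (1 <= n <= N)%N -> 0 <= p j n.
Hypothesis a_ge0 : forall y n, (1 <= n <= N)%N -> 0 <= y -> 0 <= a y n.

Variable K : R.
Hypothesis xK : x J < K.
Local Notation grd := (ext_grid J x K).
Local Notation q := (ext_weight J s0 x c K).
Hypothesis wJ0 : forall n, (1 <= n <= N)%N -> 0 <= q J n.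

Let grd_ge0 j : 0 <= grd j. Proof. exact: ext_grid_ge0. Qed.

Lemma ext_grid_le i j : (i <= j <= J.+1)%N -> grd i <= grd j.
Proof.
move=> /andP[ij]; elim: j ij => [|j IH]; first by rewrite leqn0 => /eqP->.
rewrite leq_eqVlt => /predU1P[->//|]; rewrite ltnS => ij jJ.
by rewrite (le_trans (IH ij (leqW jJ)))// ltW// (ext_grid_lt xS xK).
Qed.

(** Along the grid the slope of the call payoff jumps only at [x i], by 1, so [ext_price] collapses
    to a single term. *)
Lemma ext_call_price i n : (i <= J)%N -> (1 <= n <= N)%N ->
  \sum_(0 <= j < J.+2) Num.max (grd j - x i) 0 * q j n = c i n.
Proof.
move=> iJ nN; rewrite (ext_price J1 x00 xS c0 xK)//.
have gi : grd i = x i by rewrite /ext_grid iJ.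
rewrite max_r ?add0r; last by rewrite subr_le0 -gi ext_grid_le// leqW.
have slE j : (j <= J)%N -> (Num.max (grd j.+1 - x i) 0 - Num.max (grd j - x i) 0)
    / (grd j.+1 - grd j) = (i <= j)%:R.
  move=> jJ; have d := ext_grid_lt xS xK jJ; case: leqP => [ij|ji].
    rewrite !max_l ?subr_ge0 -?gi ?ext_grid_le ?ij ?(leqW ij) ?(leqW jJ)//.
    by rewrite opprB addrA subrK divff// subr_eq0 gt_eqF.
  rewrite !max_r ?subrr ?mul0r// subr_le0 -gi ext_grid_le// ?ji ?(ltnW ji) leqW//.
have incE j : (j <= J)%N -> increment (fun j => (Num.max (grd j.+1 - x i) 0
    - Num.max (grd j - x i) 0) / (grd j.+1 - grd j)) j = (j == i)%:R.
  case: j => [|j] jJ; rewrite /increment /= !slE// ?(ltnW jJ)// ?subr0.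
    by rewrite leqn0 eq_sym.
  have [->|ij] := eqVneq i j.+1; first by rewrite leqnn ltnn subr0.
  by rewrite [(i <= j.+1)%N]leq_eqVlt (negPf ij) ltnS subrr.
rewrite (bigD1_seq i) ?mem_index_iota ?iota_uniq//= incE// eqxx mul1r.
rewrite big_mkcond big_nat big1 ?addr0// => j /andP[_ jJ].
by case: ifPn => // /negPf ji; rewrite incE// ji mul0r.
Qed.

Lemma ext_mean n : (1 <= n <= N)%N -> \sum_(0 <= j < J.+2) grd j * q j n = s0.
Proof.
move=> nN; rewrite -[RHS](c0 nN) -(ext_call_price (leq0n J) nN); apply: eq_bigr => j _.
by rewrite x00 subr0 max_l ?grd_ge0.
Qed.

Lemma ext_mass n : (1 <= n <= N)%N -> \sum_(0 <= j < J.+2) q j n = 1.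
Proof.
move=> nN; have := ext_price J1 x00 xS c0 xK (fun=> 1) nN.
under eq_bigr do rewrite mul1r.
move=> ->; rewrite big1 ?addr0// => j _.
by rewrite /increment !subrr !mul0r if_same subr0 mul0r.
Qed.

(** The exercise time is the first date with the flag set. Expectations are finite sums over paths,
    so super-replication can be averaged directly: the calls give their prices, and the gains vanish
    because the holdings depend only on the chain so far. *)
Lemma finite_model f g1 g2 :
  grid_pricing N J.+2 (fun _ _ => 1) (fun _ _ => 1) (fun j k => grd k - grd j) q f g1 g2 ->
  exists M : model R,
  [/\ is_model N J s0 x c M,
      ((grid_price N J.+2 (fun j n => a (grd j) n) f)%:E <= phi N a M)%E &
      forall beta lam th1 th2, superreplicates N J x a beta lam th1 th2 ->
        grid_price N J.+2 (fun j n => a (grd j) n) f <= strategy_cost N J c beta lam].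
Proof.
move=> pr; have NN : (1 <= 1 <= N)%N by rewrite N1.
have [r [W [st [W0 marg mart mono stop]]]] := stopping_chain N1
  (fun j n jJ nN => ext_weight_ge0 cJ0 p_ge0 xK wJ0 jJ nN) (ext_mass NN) pr.
have W1 : \sum_(k < r) W k = 1.
  have := marg 1%N (fun=> 1) NN; under eq_bigr do rewrite mulr1; move=> ->.
  by under eq_bigr do rewrite mul1r; rewrite ext_mass.
have [P PE] := discrete_probability W0 W1.
pose same n k k' := forall i, (1 <= i <= n)%N -> st i k = st i k'.
have sameC n k k' : same n k k' -> same n k' k by move=> kk' i iN; rewrite kk'.
(* Events decided by the chain, flag included, up to date [n]. The chain starts at date 1, so [F 0]
   is trivial and the price at date 0 is set to the constant [s0]. *)
pose F n : set (set nat) := [set A | forall k k', same n k k' -> A k -> A k'].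
pose X n k : R := if n == 0%N then s0 else grd (st n k).1.
have X0 n k : 0 <= X n k by rewrite /X; case: ifP => // _; exact: ltW.
have X_same n k k' i : same n k k' -> (i <= n)%N -> X i k = X i k'.
  move=> kk' iN; rewrite /X; case: eqP => // /eqP i0.
  by rewrite kk'// lt0n i0.
have meanX n : (n <= N)%N -> \sum_(k < r) W k * X n k = s0.
  case: n => [_|n nN].
    by rewrite /X /= -mulr_suml W1 mul1r.
  by rewrite /X /= (marg n.+1 grd)// ext_mean.
pose M := @Model R _ _ P F X.
have modelM : is_model N J s0 x c M.
  split=> /=.
  - split=> [n nN|n nN A FA k k' kk']; last first.
      by apply: FA => i /andP[i1 iN]; apply: kk'; rewrite i1 (leqW iN).
    split=> //; split=> [//|A FA k k' kk' [_ nAk]|A FA k k' kk' [i _ Aik]].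
      by split => // /(FA _ _ (sameC _ _ _ kk')).
    by exists i => //; apply: FA kk' Aik.
  - split=> [n nN B _ k k' kk'|n nN] /=.
      by rewrite /preimage/= (X_same n k k').
    apply/integrableP; split; first by [].
    under eq_integral do rewrite gee0_abs ?lee_fin//.
    by rewrite PE// ltry.
  - move=> n nN A FA; rewrite !PE//; congr (_%:E).
    apply/eqP; rewrite -subr_eq0 -sumrB; apply/eqP.
    pose A' k : R := (k \in A)%:R.
    have HA k k' : same n k k' -> A' k = A' k'.
      move=> kk'; rewrite /A'; congr (_%:R); congr nat_of_bool; apply/idP/idP; rewrite !inE.
        exact: FA.
      exact/FA/sameC.
    case: n nN FA HA => [|n] nN FA HA.
      have AE k : A' k = A' 0%N by apply: HA => i /andP[i1]; rewrite leqNgt i1.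
      rewrite (eq_bigr (fun k : 'I_r => A' 0%N * (W k * X 1%N k - W k * X 0%N k))).
        by rewrite -mulr_sumr sumrB !meanX ?subrr ?mulr0.
      by move=> k _; rewrite -/(A' k) AE; ring.
    rewrite -[RHS](mart n.+1 A' nN (HA)); apply: eq_bigr => k _.
    by rewrite /X /= -/(A' k); ring.
  - by split=> // n w nN; exact: X0.
  - move=> j [//|n] jJ nN.
    rewrite PE; last by move=> k; rewrite le_max lexx orbT.
    congr (_%:E); rewrite -(ext_call_price jJ nN) -(marg n.+1 (fun i => Num.max (grd i - x j) 0) nN).
    by apply: eq_bigr => k _; rewrite in_setT mulr1.
(* Date [N] is accepted whatever the flag, so the search succeeds on every path, also on those of
   weight zero. *)
have ex_tau k : exists n, (0 < n)%N && ((N <= n)%N || (st n k).2).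
  by exists N; rewrite N1 leqnn.
pose tau k := ex_minn (ex_tau k).
have tauP k : [/\ (1 <= tau k <= N)%N, (tau k < N)%N -> (st (tau k) k).2 &
    forall i, (1 <= i < tau k)%N -> ~~ (st i k).2].
  rewrite /tau; case: ex_minnP => n /andP[n1 nst] nmin; split.
  - by rewrite n1 nmin// N1 leqnn.
  - by move=> nN; move: nst; rewrite leqNgt nN.
  - move=> i /andP[i1 iN]; apply/negP => sti.
    by have := nmin i; rewrite i1 sti orbT leqNgt iN => /(_ isT).
have tau_same n k k' : same n k k' -> (tau k <= n)%N -> tau k' = tau k.
  move=> kk' tn; have [/andP[t1 tN] tst tmin] := tauP k.
  have [/andP[t1' tN'] tst' tmin'] := tauP k'.
  have [tt'|tt'|//] := ltngtP (tau k') (tau k).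
    have := tmin _ (_ : 1 <= tau k' < tau k)%N; rewrite t1' tt' => /(_ isT).
    rewrite kk' ?t1' ?(leq_trans (ltnW tt'))// tst'//.
    exact: leq_trans tt' tN.
  have := tmin' _ (_ : 1 <= tau k < tau k')%N; rewrite t1 tt' => /(_ isT).
  rewrite -kk' ?t1// tst//.
  exact: leq_trans tt' tN'.
have tauM : @is_stopping_time R N M tau.
  split=> [k|n nN k k' kk' /= tk]; first by have [] := tauP k.
  by rewrite (tau_same _ _ _ kk')// tk.
pose Z k : R := a (X (tau k) k) (tau k).
have Z0 k : 0 <= Z k by rewrite /Z a_ge0//; have [] := tauP k.
have ZE : grid_price N J.+2 (fun j n => a (grd j) n) f <= \sum_(k < r) W k * Z k.
  (* [nu i k] pays when the flag switches on at [i]. On paths of nonzero weight it never switches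
     off, so only [i = tau k] can contribute. *)
  pose nu i k : R := ((st i k).2 && ((i == 1%N) || ~~ (st i.-1 k).2))%:R
                      * a (grd (st i k).1) i.
  apply: (@le_trans _ _ (\sum_(1 <= i < N.+1) \sum_(k < r) W k * nu i k)).
    apply: ler_sum_nat => i iN; apply: (stop i (fun j => a (grd j) i)) => // j _.
    exact: a_ge0.
  rewrite exchange_big; apply: ler_sum => k _ /=; rewrite -mulr_sumr.
  have [->|Wk] := eqVneq (W k) 0; first by rewrite !mul0r.
  rewrite ler_wpM2l//; have [/andP[t1 tN] tst tmin] := tauP k.
  have flag i j : (1 <= i)%N -> (i <= j <= N)%N -> (st i k).2 -> (st j k).2.
    move=> i1 /andP[]; elim: j => [|j IH]; first by rewrite leqn0 => /eqP ->.
    rewrite leq_eqVlt => /predU1P[->//|]; rewrite ltnS => ij jN sti.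
    by apply: mono => //; [rewrite (leq_trans i1 ij)|exact: IH (ltnW jN) sti].
  rewrite (bigD1_seq (tau k)) ?mem_index_iota ?iota_uniq ?t1//=.
  rewrite big_mkcond big_nat big1 ?addr0.
    rewrite /Z /X gtn_eqF// /nu ler_piMl ?a_ge0 ?t1//.
    by case: (_ && _).
  move=> i /andP[i1 iN]; case: ifPn => // it; rewrite /nu.
  have [ti|ti|tE] := ltngtP (tau k) i; last by rewrite tE eqxx in it.
    have fl : (st i.-1 k).2.
      apply: (flag (tau k)) => //.
        by rewrite -ltnS prednK// ti/= (leq_trans (leq_pred _)).
      by apply: tst; apply: leq_trans ti _.
    by rewrite fl orbF gtn_eqF ?andbF ?mul0r//; apply: leq_ltn_trans ti.
  by rewrite (negPf (tmin i _)) ?mul0r// i1.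
exists M; split=> //.
  apply: (@le_trans _ _ (\int[P]_w (Z w)%:E)%E); last first.
    by apply: ereal_sup_ubound; exists tau.
  rewrite PE// lee_fin (le_trans ZE)//.
  by apply: ler_sum => k _; rewrite in_setT mulr1.
move=> beta lam th1 th2 [adapt _ super]; apply: (le_trans ZE).
pose path k i := X i k.
have pathN k : nonneg_path N (path k) by move=> i iN; exact: X0.
pose th n k := if (n < tau k)%N then th1 n (path k) else th2 n (path k) (tau k).
(* The chain up to [n] determines whether [tau <= n] and then the value of [tau]; hence [th n] is an
   admissible test function in the martingale identity [mart]. *)
have thS n k k' : (1 <= n < N)%N -> same n k k' -> th n k = th n k'.
  move=> nN kk'; rewrite /th.
  have pp i : (1 <= i <= n)%N -> path k i = path k' i.
    by case/andP=> _ iN; apply: X_same kk' iN.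
  have [p1 p2] := adapt n _ _ nN pp.
  have [tn|nt] := leqP (tau k) n.
    by rewrite (tau_same _ _ _ kk' tn) ltnNge tn p2.
  have [tn|nt'] := leqP (tau k') n; last by rewrite p1.
  by move: nt; rewrite (tau_same _ _ _ (sameC _ _ _ kk') tn) ltnNge tn.
apply: (@le_trans _ _ (\sum_(k < r) W k * (beta
   + \sum_(1 <= n < N.+1) \sum_(0 <= j < J.+1) lam j n * Num.max (path k n - x j) 0
   + \sum_(1 <= n < N) th n k * (path k n.+1 - path k n)))).
  apply: ler_sum => k _; rewrite ler_wpM2l//.
  have [tN _ _] := tauP k; exact: (super (path k) (tau k) (pathN k) tN).
under eq_bigr do rewrite !mulrDr.
rewrite !big_split /= -mulr_suml W1 mul1r /strategy_cost.
rewrite [X in _ + X <= _](_ : _ = 0) ?addr0.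
  rewrite lerD2l le_eqVlt; apply/orP; left; apply/eqP.
  under eq_bigr do rewrite mulr_sumr; rewrite exchange_big /=.
  rewrite big_nat [RHS]big_nat; apply: eq_bigr => -[//|n] nN.
  under eq_bigr do rewrite mulr_sumr; rewrite exchange_big /=.
  rewrite big_nat [RHS]big_nat; apply: eq_bigr => j /andP[_ jJ].
  rewrite -(ext_call_price jJ nN) -(marg n.+1 (fun i => Num.max (grd i - x j) 0) nN).
  by rewrite mulr_sumr; apply: eq_bigr => k _; rewrite /path /X /=; ring.
under eq_bigr do rewrite mulr_sumr; rewrite exchange_big /= big_nat big1// => -[//|n] nN.
rewrite -[RHS](mart n.+1 (th n.+1) nN (fun w w' => thS n.+1 w w' nN)).
  by apply: eq_bigr => k _; rewrite /path /X /=; ring.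
Qed.

End FiniteModel.

(** * Prices in arbitrary models *)

Section Expectation.
Context d (T : measurableType d) (R : realType) (P : probability T R).

(** Integrability and value travel together, so that the rules of linearity compose without side
    conditions. *)
Definition has_expectation (f : T -> R) (v : R) :=
  P.-integrable setT (EFin \o f) /\ (\int[P]_w (f w)%:E = v%:E)%E.

Lemma has_expectation_cst k : has_expectation (fun=> k) k.
Proof.
split; first exact: finite_measure_integrable_cst.
rewrite (integral_cst P measurableT k%:E) -[RHS]mule1; congr (_ * _)%E.
exact: probability_setT.
Qed.

Lemma has_expectationD f g u v : has_expectation f u -> has_expectation g v ->
  has_expectation (fun w => f w + g w) (u + v).
Proof.
move=> [fi fE] [gi gE]; split; first exact: (integrableD measurableT fi gi).
under eq_integral do rewrite EFinD.
by rewrite (integralD measurableT fi gi) fE gE.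
Qed.

Lemma has_expectationZ k f u : has_expectation f u ->
  has_expectation (fun w => k * f w) (k * u).
Proof.
move=> [fi fE]; split; first exact: (integrableZl measurableT k fi).
under eq_integral do rewrite EFinM.
by rewrite (integralZl measurableT fi) fE.
Qed.

Lemma has_expectation_sum a b (f : nat -> T -> R) (u : nat -> R) :
  (forall i, (a <= i < b)%N -> has_expectation (f i) (u i)) ->
  has_expectation (fun w => \sum_(a <= i < b) f i w) (\sum_(a <= i < b) u i).
Proof.
move=> H; have {}H i : i \in index_iota a b -> has_expectation (f i) (u i).
  by rewrite mem_index_iota; exact: H.
elim: (index_iota a b) H => [_|i s IH H].
  rewrite big_nil (_ : (fun w => _) = fun=> 0); first exact: has_expectation_cst.
  by apply/funext => w; rewrite big_nil.
rewrite big_cons (_ : (fun w => _) = fun w => f i w + \sum_(j <- s) f j w).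
  apply: has_expectationD; first by apply: H; rewrite mem_head.
  by apply: IH => j js; apply: H; rewrite in_cons js orbT.
by apply/funext => w; rewrite big_cons.
Qed.

Lemma has_expectation_indic (A : set T) f : measurable A ->
  P.-integrable setT (EFin \o f) ->
  has_expectation (fun w => (w \in A)%:R * f w) (fine (\int[P]_(w in A) (f w)%:E)%E).
Proof.
move=> mA fi.
have fA : P.-integrable A (EFin \o f).
  exact: (integrableS measurableT mA (@subsetT _ A) fi).
have E : (EFin \o (fun w => (w \in A)%:R * f w)) = ((EFin \o f) \_ A).
  apply/funext => w; rewrite patchE /=.
  by case: ifP => _; rewrite ?mul1r ?mul0r.
split; first by rewrite E; exact: (integrable_mkcond _ mA).1.
rewrite fineK; last exact: (integrable_fin_num mA fA).
rewrite [RHS]integral_mkcond; apply: eq_integral => w _.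
exact: (congr1 (fun h => h w) E).
Qed.

(* Only the upper bound needs to be measurable: the integral of a nonnegative
   function is a supremum over the simple functions below it. *)
Lemma integral_le_expectation f g v : (forall w, 0 <= f w <= g w) ->
  has_expectation g v -> (\int[P]_w (f w)%:E <= v%:E)%E.
Proof.
move=> fg [_ <-].
rewrite ge0_integralTE; last by move=> w; rewrite lee_fin; case/andP: (fg w).
rewrite ge0_integralTE; last first.
  by move=> w; rewrite lee_fin; case/andP: (fg w); exact: le_trans.
apply: ereal_sup_le => _ [h hf <-]; exists h => // w.
by apply: le_trans (hf w) _; rewrite lee_fin; case/andP: (fg w).
Qed.

End Expectation.

Section SigmaAlgebra.
Variables (T : Type) (G : set (set T)).
Hypothesis sG : sigma_algebra setT G.

Lemma sigma_algebraC_set A : G A -> G (~` A).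
Proof. by move=> GA; rewrite -setTD; case: sG => _ + _; apply. Qed.

Lemma sigma_algebraU_set A B : G A -> G B -> G (A `|` B).
Proof.
move=> GA GB; case: sG => _ _ GU.
rewrite (_ : A `|` B = \bigcup_i (if i == 0%N then A else B)).
  by apply: GU => -[|i].
apply/seteqP; split=> w.
  by case=> wA; [exists 0%N|exists 1%N].
by case=> -[|i] _ /=; [left|right].
Qed.

Lemma sigma_algebraI_set A B : G A -> G B -> G (A `&` B).
Proof.
move=> GA GB; rewrite -[A]setCK -[B]setCK -setCU.
by apply/sigma_algebraC_set/sigma_algebraU_set; exact: sigma_algebraC_set.
Qed.

End SigmaAlgebra.

Section ModelPrice.
Variables (R : realType) (N J : nat) (s0 : R) (x : nat -> R).
Variables (c : nat -> nat -> R) (a : R -> nat -> R).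
Hypothesis (x00 : x 0%N = 0).
Hypothesis a_ge0 : forall y n, (1 <= n <= N)%N -> 0 <= y -> 0 <= a y n.

Lemma stopped_le_measurable (M : model R) (tau : mdl_Omega M -> nat) n :
  is_model N J s0 x c M -> is_stopping_time N tau -> (n <= N)%N ->
  mdl_F n [set w | (tau w <= n)%N].
Proof.
move=> [[sF FS] _ _ _ _] [tauN tauF]; elim: n => [|n IH] nN.
  have [[F0 _ _] _] := sF 0%N nN.
  rewrite (_ : [set w | _] = set0)//; apply/seteqP; split=> // w /=.
  by have /andP[+ _] := tauN w; rewrite ltnNge => /negbTE ->.
rewrite (_ : [set w | _] = [set w | (tau w <= n)%N] `|` [set w | tau w = n.+1]).
  apply: sigma_algebraU_set; first exact: (sF n.+1 nN).1.
    by apply: FS => //; apply: IH; exact: ltnW.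
  exact: tauF.
apply/seteqP; split=> w /=; last by case=> [/leqW|->].
by rewrite leq_eqVlt ltnS => /predU1P[|]; [right|left].
Qed.

(** Step functions as holdings make the gains a finite combination of price increments on sets
    [x j <= X n], intersected with [tau <= n] or its complement. These sets lie in [F n], so the
    martingale property on events suffices. *)
Lemma model_price_le (M : model R) (tau : mdl_Omega M -> nat) beta lam
    (D1 D2 : nat -> nat -> R) :
  is_model N J s0 x c M -> is_stopping_time N tau ->
  (forall path rho, nonneg_path N path -> (1 <= rho <= N)%N ->
     a (path rho) rho <=
       beta + \sum_(1 <= n < N.+1) \sum_(0 <= j < J.+1)
                 lam j n * Num.max (path n - x j) 0
       + \sum_(1 <= n < N)
           (if (n < rho)%N then pwc J x (D1 n) (path n) else pwc J x (D2 n) (path n))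
             * (path n.+1 - path n)) ->
  (\int[mdl_P M]_w (a (mdl_X (tau w) w) (tau w))%:E <=
   (strategy_cost N J c beta lam)%:E)%E.
Proof.
move=> isM tauM super.
have [[sF FS] [adapt intX] mart [_ X0] call] := isM.
have [tauN tauF] := tauM.
pose P := mdl_P M; pose X := @mdl_X R M; pose F := @mdl_F R M.
have heC j n : (j <= J)%N -> (1 <= n <= N)%N ->
    has_expectation P (fun w => Num.max (X n w - x j) 0) (c j n).
  move=> jJ nN; have nN' : (n <= N)%N by case/andP: nN.
  split; last exact: call.
  apply/integrableP; split.
    apply/measurable_realfun.measurable_EFinP; apply: measurable_realfun.measurable_maxr => //.
    apply: measurable_realfun.measurable_funB => //; apply/measurable_realfun.measurable_EFinP.
    exact: measurable_int (intX n nN').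
  under eq_integral do rewrite gee0_abs ?lee_fin ?le_max ?lexx ?orbT//.
  by rewrite call// ltry.
have heM (A : set (mdl_Omega M)) n : (1 <= n < N)%N -> F n A ->
    has_expectation P (fun w => (w \in A)%:R * (X n.+1 w - X n w)) 0.
  move=> /andP[n1 nN] FA.
  have mA : measurable A by exact: (sF n (ltnW nN)).2.
  have h1 := has_expectation_indic mA (intX n.+1 nN).
  have h2 := has_expectationZ (-1) (has_expectation_indic mA (intX n (ltnW nN))).
  have := has_expectationD h1 h2.
  rewrite mulN1r mart// subrr; congr has_expectation.
  by apply/funext => w; rewrite /X; ring.
pose A n j := [set w | x j <= X n w].
pose B n := [set w | (tau w <= n)%N].
have FA n j : (n <= N)%N -> F n (A n j).
  move=> nN; rewrite (_ : A n j = X n @^-1` `[x j, +oo[%classic).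
    exact: adapt.
  by apply/seteqP; split=> w; rewrite /A /= in_itv /= andbT.
have FB n : (n <= N)%N -> F n (B n) by exact: stopped_le_measurable isM tauM.
have FAB n j : (n <= N)%N -> F n (A n j `&` B n).
  by move=> nN; apply: sigma_algebraI_set; [exact: (sF n nN).1|exact: FA|exact: FB].
have FAC n j : (n <= N)%N -> F n (A n j `&` ~` B n).
  move=> nN; apply: sigma_algebraI_set; [exact: (sF n nN).1|exact: FA|].
  by apply: sigma_algebraC_set; [exact: (sF n nN).1|exact: FB].
pose Z w := beta
   + \sum_(1 <= n < N.+1) \sum_(0 <= j < J.+1) lam j n * Num.max (X n w - x j) 0
   + \sum_(1 <= n < N) \sum_(0 <= j < J.+1)
      (increment (D1 n) j * ((w \in A n j `&` ~` B n)%:R * (X n.+1 w - X n w))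
       + increment (D2 n) j * ((w \in A n j `&` B n)%:R * (X n.+1 w - X n w))).
have heZ : has_expectation P Z (strategy_cost N J c beta lam
    + \sum_(1 <= n < N) \sum_(0 <= j < J.+1)
       (increment (D1 n) j * 0 + increment (D2 n) j * 0)).
  apply: has_expectationD; first apply: has_expectationD.
  - exact: has_expectation_cst.
  - apply: has_expectation_sum => n nN; apply: has_expectation_sum => j jJ.
    by apply: has_expectationZ; apply: heC.
  apply: has_expectation_sum => n nN; apply: has_expectation_sum => j jJ.
  have nN' : (n <= N)%N by case/andP: nN => _ /ltnW.
  apply: has_expectationD; apply: has_expectationZ; apply: heM => //.
    exact: FAC.
  exact: FAB.
apply: (@integral_le_expectation _ _ R P _ Z); last first.
  move: heZ; rewrite [X in _ + X]big1 ?addr0//.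
  by move=> n _; rewrite big1// => j _; rewrite !mulr0 addr0.
move=> w; have tN := tauN w; apply/andP; split.
  by apply: a_ge0 => //; exact: X0.
have pN : nonneg_path N (fun n => X n w) by move=> n nN; exact: X0.
apply: le_trans (super (fun n => X n w) (tau w) pN tN) _.
rewrite /Z lerD2l le_eqVlt; apply/orP; left; apply/eqP.
apply: eq_big_nat => n nN.
have xA j : (w \in A n j) = (x j <= X n w) by apply/idP/idP; rewrite inE.
have wB : (w \in B n) = (tau w <= n)%N by apply/idP/idP; rewrite inE.
rewrite /pwc; case: ltnP => tn; rewrite mulr_suml; apply: eq_bigr => j _;
  rewrite !in_setI in_setC xA wB.
  by rewrite (leqNgt (tau w)) tn /= andbT andbF /=; ring.
by rewrite tn /= andbT andbF /=; ring.
Qed.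

End ModelPrice.

(** * Convex functions and their asymptotic slope *)

Section AsymptoticSlope.
Variables (R : realType) (f : R -> R) (l : R).
Hypothesis f_conv : forall y z t, 0 <= y -> 0 <= z -> 0 <= t <= 1 ->
  f (t * y + (1 - t) * z) <= t * f y + (1 - t) * f z.
Hypothesis f_lim : f y / y @[y --> +oo] --> l.

Lemma asymptotic_slope_ge0 : (forall y, 0 <= y -> 0 <= f y) -> 0 <= l.
Proof.
move=> f0; rewrite leNgt; apply/negP => l0.
move/cvgrPdist_lt: f_lim => /(_ (- l)); rewrite oppr_gt0 => /(_ l0) nl.
have [y [yl y0]] := filter_ex (filterI nl (nbhs_pinfty_gt (@num_real R 0))).
have : 0 <= f y / y by rewrite divr_ge0 ?f0 ?(ltW y0).
move: yl; rewrite /= ltr_norml => /andP[]; lra.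
Qed.

(** If the chord from [x] to [y] had a slope [r > l], convexity would keep [f] above its extension
    beyond [y], against the limit [l]. *)
Lemma convex_le_asymptote x y : 0 <= x -> x <= y -> f y <= f x + l * (y - x).
Proof.
move=> x0; rewrite le_eqVlt => /predU1P[->|xy]; first by rewrite subrr mulr0 addr0.
rewrite leNgt; apply/negP => H.
have d0 : 0 < y - x by rewrite subr_gt0.
pose r := (f y - f x) / (y - x).
have rE : r * (y - x) = f y - f x by rewrite divfK// gt_eqF.
have lr : l < r by rewrite /r ltr_pdivlMr//; lra.
have fz z : y < z -> f x + r * (z - x) <= f z.
  move=> yz; have zx : 0 < z - x by lra.
  pose t := (z - y) / (z - x).
  have tE : t * (z - x) = z - y by rewrite divfK// gt_eqF.
  have t0 : 0 <= t <= 1.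
    rewrite divr_ge0 ?(ltW zx)//=; last by lra.
    by rewrite ler_pdivrMr// mul1r; lra.
  have := f_conv x0 (_ : 0 <= z) t0.
  have -> : t * x + (1 - t) * z = y by move: tE; lra.
  have z0 : 0 <= z by lra.
  move=> /(_ z0) fy.
  have t1 : (1 - t) * (z - x) = y - x by move: tE; lra.
  have : r * ((1 - t) * (z - x)) <= (1 - t) * (f z - f x) by rewrite t1 rE; lra.
  have t10 : 0 < 1 - t.
    by rewrite -(pmulr_lgt0 _ zx) t1.
  by rewrite mulrCA ler_pM2l//; lra.
(* Half the gap, so that [l + e = r - e]; the threshold for [z] below makes the constant
   [r * x - f x] smaller than [e * z]. *)
pose e := (r - l) / 2.
have e0 : 0 < e by rewrite divr_gt0// subr_gt0.
move/cvgrPdist_lt: f_lim => /(_ e e0) nl.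
have [z [/= zl zB]] := filter_ex (filterI nl
  (nbhs_pinfty_gt (@num_real R (Num.max y ((r * x - f x) / e))))).
move: zB; rewrite /= gt_max => /andP[yz]; rewrite ltr_pdivrMr// => ze.
have z0 : 0 < z by lra.
have : f z / z < l + e by move: zl; rewrite ltr_norml => /andP[]; lra.
rewrite ltr_pdivrMr//; have := fz z yz; move: ze.
have -> : (l + e) * z = (r - e) * z by rewrite /e; congr (_ * _); field.
lra.
Qed.

End AsymptoticSlope.

(** * From a hedge of the limit program to a strategy *)

Section HedgingStrategy.
Variables (R : realType) (N J : nat) (s0 : R) (x : nat -> R).
Variables (c : nat -> nat -> R) (a : R -> nat -> R) (l : nat -> R).
Hypotheses (N1 : (1 <= N)%N) (J1 : (1 <= J)%N).
Hypotheses (x00 : x 0%N = 0) (xS : forall j, (j < J)%N -> x j < x j.+1).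
Hypothesis c0 : forall n, (1 <= n <= N)%N -> c 0%N n = s0.
Hypothesis a_conv : forall y z t n, (1 <= n <= N)%N -> 0 <= y -> 0 <= z -> 0 <= t <= 1 ->
  a (t * y + (1 - t) * z) n <= t * a y n + (1 - t) * a z n.
Hypothesis a_lim : forall n, (1 <= n <= N)%N -> (fun y => a y n / y) @ +oo --> l n.
Let p := phat J s0 x c.

Lemma payoff_le_pwl (v : nat -> R) n y : (1 <= n <= N)%N ->
  (forall j, (j <= J)%N -> a (x j) n <= v j) -> l n <= v J.+1 -> 0 <= y ->
  a y n <= pwl J x v y.
Proof.
move=> nN av lv /(in_seg_exists J x00)[j sy]; have [jJ jy _] := sy.
move: jJ; rewrite leq_eqVlt => /predU1P[jE|jJ].
  rewrite (pwl_seg xS _ sy) jE /seg_slope ltnn; rewrite jE in jy.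
  have := @convex_le_asymptote R (a^~ n) (l n)
    (fun y z t => @a_conv y z t n nN) (a_lim nN) _ _ (grid_ge0 x00 xS (leqnn J)) jy.
  have : l n * (y - x J) <= v J.+1 * (y - x J) by rewrite ler_wpM2r ?subr_ge0.
  have := av J (leqnn J); lra.
have [t [t01 yE ->]] := seg_convex_comb xS jJ sy.
have := @a_conv (x j) (x j.+1) t n nN.
rewrite -yE !(grid_ge0 x00 xS) ?(ltnW jJ)// => /(_ isT isT t01).
case/andP: (t01) => t0 t1.
have : t * a (x j) n <= t * v j by rewrite ler_wpM2l// av// ltnW.
have : (1 - t) * a (x j.+1) n <= (1 - t) * v j.+1 by rewrite ler_wpM2l ?subr_ge0// av.
lra.
Qed.

Lemma inf_hedge_strategy e1 e2 v d1 d2 : inf_hedge N J x a l e1 e2 v d1 d2 ->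
  exists beta lam (D1 D2 : nat -> nat -> R),
    superreplicates N J x a beta lam (fun n path => pwc J x (D1 n) (path n))
      (fun n path _ => pwc J x (D2 n) (path n)) /\
    strategy_cost N J c beta lam = grid_cost N J.+2 p e1 e2 v.
Proof.
move=> h.
have lim1 n : exists D, (1 <= n < N)%N -> forall y z, 0 <= y -> 0 <= z ->
    0 <= pwl J x (e1^~ n) y + pwl J x (e2^~ n.+1) z + (z - y) * pwc J x D y.
  have [nN|] := boolP (1 <= n < N)%N; last by exists (fun=> 0).
  have [[r1 r2 r3] _] := inf_hedge_rows h nN.
  by have [D HD] := semistatic_hedge x00 xS r1 r2 r3; exists D.
have lim2 n : exists D, (1 <= n < N)%N -> forall y z, 0 <= y -> 0 <= z ->
    0 <= (pwl J x (e1^~ n) y - pwl J x (v^~ n) y)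
         + (pwl J x (e2^~ n.+1) z + pwl J x (v^~ n.+1) z) + (z - y) * pwc J x D y.
  have [nN|] := boolP (1 <= n < N)%N; last by exists (fun=> 0).
  have [_ [r1 r2 r3]] := inf_hedge_rows h nN.
  have [D HD] := @semistatic_hedge R J x x00 xS (fun j => e1 j n - v j n)
    (fun j => e2 j n.+1 + v j n.+1) _ r1 r2 r3.
  by exists D => _ y z y0 z0; have := HD y z y0 z0; rewrite !pwl_add pwl_opp.
have [D1 HD1] := choice lim1; have [D2 HD2] := choice lim2.
(* The whole static position with maturity [n]. Of the values [v] only the one at [N] is bought; the
   others cancel along the periods after exercise. *)
pose Et n j := (if (n < N)%N then e1 j n else 0)
  + ((if (1 < n)%N then e2 j n else 0) + (if (n < N)%N then 0 else v j N)).
pose lam j n := increment (seg_slope J x (Et n)) j.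
pose beta := \sum_(1 <= n < N.+1) Et n 0%N.
(* Stated for an arbitrary additive [f], as it is applied both to prices and to terminal payoffs. *)
have EtE (V : zmodType) (f : (nat -> R) -> nat -> V) :
    (forall n F G, f (fun j => F j + G j) n = f F n + f G n) ->
    (forall n, f (fun=> 0) n = 0) ->
    \sum_(1 <= n < N.+1) f (Et n) n =
    \sum_(1 <= n < N) (f (e1^~ n) n + f (e2^~ n.+1) n.+1) + f (v^~ N) N.
  move=> fD f0; rewrite big_split /=.
  rewrite -(sum_nat_last (fun n => f (e1^~ n) n) N1).
  rewrite (sum_nat_shift (fun n => f (e2^~ n) n) N1).
  rewrite -(sum_nat_only (fun n => f (v^~ N) N) N1) -!big_split /=.
  apply: eq_big_nat => n /andP[_ nN]; rewrite /Et !fD addrA.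
  congr (_ + _ + _); [by case: ifP|by case: ifP|case: ltnP => // Nn].
  by have -> : n = N by apply/eqP; rewrite eqn_leq Nn andbT -ltnS.
exists beta, lam, D1, D2; split; last first.
  rewrite /strategy_cost /beta -big_split /=.
  rewrite (eq_big_nat _ _ (F2 := fun n => \sum_(0 <= j < J.+2) Et n j * p j n)).
    rewrite (EtE _ (fun F n => \sum_(0 <= j < J.+2) F j * p j n))//.
      by move=> n F G; rewrite sum_mulDl.
    by move=> n; rewrite big1// => j _; rewrite mul0r.
  by move=> n nN; rewrite (pwl_cost x00 xS J1 _ (c0 nN)).
split.
- move=> n path path' /andP[n1 nN] pp.
  by rewrite (pp n) ?n1 ?leqnn.
- have bnd (D : nat -> nat -> R) : exists B : nat -> R, forall n y, 0 <= y ->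
      `|pwc J x (D n) y| <= B n.
    by have [B HB] := choice (fun n => pwc_bounded x00 xS (D n)); exists B.
  have [B1 HB1] := bnd D1; have [B2 HB2] := bnd D2.
  pose B := \sum_(1 <= i < N.+1) \sum_(0 <= k < 2) `|(if k == 0%N then B1 i else B2 i)|.
  exists B => n path nN pN.
  have nN' : (1 <= n <= N)%N by case/andP: nN => -> /ltnW.
  have pn := pN n nN'.
  split=> [|rho _].
    apply: le_trans (HB1 n _ pn) _.
    exact: (@le_sum_norm R (fun k i => if k == 0%N then B1 i else B2 i) 2 N 0 n).
  apply: le_trans (HB2 n _ pn) _.
  exact: (@le_sum_norm R (fun k i => if k == 0%N then B1 i else B2 i) 2 N 1 n).
- move=> path rho pN rN.
  have -> : beta + \sum_(1 <= n < N.+1) \sum_(0 <= j < J.+1)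
      lam j n * Num.max (path n - x j) 0 =
      \sum_(1 <= n < N) (pwl J x (e1^~ n) (path n) + pwl J x (e2^~ n.+1) (path n.+1))
      + pwl J x (v^~ N) (path N).
    rewrite -(EtE _ (fun F n => pwl J x F (path n))).
    + by rewrite /beta -big_split.
    + by move=> n F G; rewrite pwl_add.
    + by move=> n; rewrite pwl_0.
  rewrite addrAC -big_split /=.
  pose V n := pwl J x (v^~ n) (path n).
  have aV : a (path rho) rho <= V rho.
    apply: payoff_le_pwl => //; last exact: pN.
      by move=> j jJ; have := h.2 j rho (leqW jJ) rN; rewrite /inf_payoff jJ.
    by have := h.2 J.+1 rho (ltnSn _) rN; rewrite /inf_payoff ltnn.
  apply: le_trans aV _; rewrite -lerBlDr -/(V N).
  (* Each period after exercise earns [V n - V n.+1]; together with the static [V N] this telescopes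
     to [V rho], which covers the payoff. *)
  have -> : V rho - V N = \sum_(1 <= n < N) (if (n < rho)%N then 0 else V n - V n.+1).
    case/andP: rN => r1 rN; rewrite (@big_cat_nat _ _ _ rho)//=.
    rewrite big_nat big1 ?add0r => [|n /andP[_ ->]//].
    rewrite (eq_big_nat _ _ (F2 := fun n => - (V n.+1 - V n))); last first.
      by move=> n /andP[rn _]; rewrite ltnNge rn opprB.
    by rewrite sumrN telescope_sumr// opprB.
  apply: ler_sum_nat => n nN.
  have pn : 0 <= path n by apply: pN; case/andP: nN => -> /ltnW.
  have pn1 : 0 <= path n.+1 by apply: pN; case/andP: nN.
  case: ifP => _.
    have := HD1 n nN _ _ pn pn1; lra.
  have := HD2 n nN _ _ pn pn1; rewrite /V; lra.
Qed.

End HedgingStrategy.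

(** * The duality theorem *)

Lemma common_lower_bound (R : realType) (F : nat -> R) N :
  (forall n, (1 <= n <= N)%N -> 0 < F n) ->
  exists2 del, 0 < del & forall n, (1 <= n <= N)%N -> del <= F n.
Proof.
elim: N => [_|N IH F0]; first by exists 1 => // -[].
have [n /andP[n1 nN]|del del0 H] := IH; first by apply: F0; rewrite n1 (leqW nN).
exists (Num.min del (F N.+1)); first by rewrite lt_min del0 F0 /=.
move=> n /andP[n1]; rewrite leq_eqVlt => /predU1P[->|nN]; first by rewrite ge_min lexx orbT.
by rewrite ge_min H ?n1.
Qed.

Lemma near_pinfty_all (R : realType) (Q : nat -> R -> Prop) N :
  (forall n, (1 <= n <= N)%N -> \forall y \near +oo, Q n y) ->
  \forall y \near +oo, forall n, (1 <= n <= N)%N -> Q n y.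
Proof.
elim: N => [_|N IH H]; first by near=> y; move=> -[].
have {}IH : \forall y \near +oo, forall n, (1 <= n <= N)%N -> Q n y.
  by apply: IH => n /andP[n1 nN]; apply: H; rewrite n1 (leqW nN).
have HN : \forall y \near +oo, Q N.+1 y by apply: H; rewrite leqnn.
near=> y => n /andP[n1]; rewrite leq_eqVlt => /predU1P[->|nN].
  by near: y.
have Hy : forall n, (1 <= n <= N)%N -> Q n y by near: y.
by apply: Hy; rewrite n1.
Unshelve. all: by end_near. Qed.

Lemma phat_gt0 (R : realType) (J : nat) (s0 : R) x c j n : x 0%N = 0 ->
  c 0%N n = s0 -> slope x c 1 n < 1 ->
  (forall j, (1 <= j < J)%N -> slope x c j.+1 n < slope x c j n) ->
  0 < slope x c J n -> (j <= J)%N -> 0 < phat J s0 x c j n.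
Proof.
move=> x00 c0 s1 sS sJ jJ; rewrite /phat; case: eqP => [_|/eqP j0].
  by move: s1; rewrite /slope /= c0 x00 subr0; lra.
have [jJ'|Jj] := ltnP j J; first by rewrite subr_gt0 sS// lt0n j0.
by have -> : j == J by rewrite eqn_leq jJ.
Qed.

Section AmericanDuality.
Variables (R : realType) (N J : nat) (s0 : R) (x : nat -> R).
Variables (c : nat -> nat -> R) (a : R -> nat -> R) (l : nat -> R).
Hypotheses (N1 : (1 <= N)%N) (J1 : (1 <= J)%N) (s0_gt0 : 0 < s0).
Hypotheses (x00 : x 0%N = 0) (xS : forall j, (j < J)%N -> x j < x j.+1).
Hypothesis c0 : forall n, (1 <= n <= N)%N -> c 0%N n = s0.
Hypothesis cJ0 : forall n, (1 <= n <= N)%N -> 0 < c J n.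
Hypothesis cS : forall j n, (1 <= j <= J)%N -> (1 <= n < N)%N -> c j n <= c j n.+1.
Let p := phat J s0 x c.
Hypothesis p_gt0 : forall j n, (j <= J)%N -> (1 <= n <= N)%N -> 0 < p j n.
Hypothesis a_ge0 : forall y n, (1 <= n <= N)%N -> 0 <= y -> 0 <= a y n.
Hypothesis a_conv : forall y z t n, (1 <= n <= N)%N -> 0 <= y -> 0 <= z -> 0 <= t <= 1 ->
  a (t * y + (1 - t) * z) n <= t * a y n + (1 - t) * a z n.
Hypothesis a_lim : forall n, (1 <= n <= N)%N -> (fun y => a y n / y) @ +oo --> l n.

Let p_ge0 j n : (j <= J)%N -> (1 <= n <= N)%N -> 0 <= p j n.
Proof. by move=> jJ nN; exact/ltW/p_gt0. Qed.

Let l_ge0 n : (1 <= n <= N)%N -> 0 <= l n.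
Proof.
by move=> nN; apply: (asymptotic_slope_ge0 (a_lim nN)) => y; exact: a_ge0.
Qed.

Let payoff_ge0 j n : (j < J.+2)%N -> (1 <= n <= N)%N -> 0 <= inf_payoff J x a l j n.
Proof.
move=> _ nN; rewrite /inf_payoff; case: ifP => jJ; last exact: l_ge0.
by rewrite a_ge0// (grid_ge0 x00 xS).
Qed.

(** [del] is at most half of every [p J n] and is fixed before [K]. A large [K] then takes at most
    [del] from the weight at [x J], and [(K - x J) * del] can be made as large as desired. *)
Lemma large_node (B eta : R) : 0 < eta -> exists K del,
  [/\ x J < K, 0 < K, B <= (K - x J) * del, 0 < del &
      forall n, (1 <= n <= N)%N ->
        del <= ext_weight J s0 x c K J n /\ l n - eta <= a K n / K].
Proof.
move=> eta0.
have [del del0 delp] : exists2 del, 0 < del & forall n, (1 <= n <= N)%N -> del <= p J n / 2.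
  by apply: common_lower_bound => n nN; rewrite divr_gt0// p_gt0.
pose big n K := c J n / del + x J < K /\ l n - eta <= a K n / K.
have Hn : \forall K \near +oo, forall n, (1 <= n <= N)%N -> big n K.
  apply: near_pinfty_all => n nN.
  have := a_lim nN; move/cvgrPdist_lt => /(_ eta eta0) H.
  apply: filterS2 H (nbhs_pinfty_gt (@num_real R (c J n / del + x J))) => K.
  by rewrite /= ltr_norml => /andP[_ H1] H2; split => //; lra.
have H1 := nbhs_pinfty_gt (@num_real R (x J)).
have H2 := nbhs_pinfty_gt (@num_real R (B / del + x J)).
have [K [/= [xK BK] HK]] := filter_ex (filterI (filterI H1 H2) Hn).
exists K, del; split => //.
- by rewrite (le_lt_trans _ xK)// (grid_ge0 x00 xS).
- by rewrite -ler_pdivrMr// lerBrDr ltW.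
move=> n nN; have [cK lK] := HK n nN; split=> //.
rewrite /ext_weight ltnn eqxx.
have dK : 0 < K - x J by rewrite subr_gt0.
have : c J n / (K - x J) <= del.
  by rewrite ler_pdivrMr// mulrC -ler_pdivrMr// lerBrDr ltW.
have := delp n nN; rewrite -/p; lra.
Qed.

Lemma american_duality_real : exists psi : R,
  [/\ exists e1 e2 v d1 d2, inf_hedge N J x a l e1 e2 v d1 d2 /\
        grid_cost N J.+2 p e1 e2 v = psi,
      exists f g1 g2, inf_pricing N J s0 x c f g1 g2 /\
        grid_price N J.+2 (inf_payoff J x a l) f = psi &
      forall eps, 0 < eps -> exists M : model R,
        [/\ is_model N J s0 x c M, ((psi - eps)%:E <= phi N a M)%E &
            forall beta lam th1 th2, superreplicates N J x a beta lam th1 th2 ->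
              psi - eps <= strategy_cost N J c beta lam]].
Proof.
(* Any admissible grid will do here: it only serves to bound the costs in the limit program from
   below. *)
have [K0 [del0 [xK0 _ _ del00 HK0]]] := large_node 0 ltr01.
have wJ00 n : (1 <= n <= N)%N -> 0 <= ext_weight J s0 x c K0 J n.
  by move=> nN; apply: le_trans (ltW del00) _; have [] := HK0 n nN.
have [e1 [e2 [v [d1 [d2 [f [g1 [g2 [h pr hE]]]]]]]]] :=
  inf_optimum N1 J1 x00 xS c0 cJ0 cS p_ge0 a_ge0 l_ge0 xK0 wJ00.
pose psi := grid_cost N J.+2 p e1 e2 v.
exists psi; split.
- by exists e1, e2, v, d1, d2.
- by exists f, g1, g2.
move=> eps eps0.
have psi0 : 0 <= psi.
  exact: (inf_cost_ge0 N1 J1 x00 xS c0 cJ0 cS p_ge0 a_ge0 l_ge0 xK0 wJ00 h).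
have NN : (1 <= N <= N)%N by rewrite N1 leqnn.
have cN := cJ0 NN.
pose S := \sum_(1 <= n < N) c J n.+1 + c J N.
(* The two errors get [eps / 2] each: [eta * c J N] by this choice, and the slope error times [S] by
   the bound required of [K] below. *)
pose eta := eps / 2 / c J N.
have eta0 : 0 < eta by rewrite !divr_gt0.
have [K [del [xK K0' BK del0' HK]]] := large_node (psi * S / (eps / 2)) eta0.
have wJ0 n : (1 <= n <= N)%N -> 0 <= ext_weight J s0 x c K J n.
  by move=> nN; apply: le_trans (ltW del0') _; have [] := HK n nN.
have [e1' [e2' [v' [d1' [d2' [f' [g1' [g2' [h' pr' hE']]]]]]]]] :=
  ext_optimum N1 J1 x00 xS c0 cJ0 cS p_ge0 a_ge0 xK wJ0.
have psi_le : psi - eps <= grid_cost N J.+2 (ext_weight J s0 x c K) e1' e2' v'.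
  (* A grid value of at least [psi] needs no argument; otherwise [psi] itself is the cost bound [C],
     so the error does not depend on the hedge found on the grid. *)
  have [le|/ltW le] := leP psi (grid_cost N J.+2 (ext_weight J s0 x c K) e1' e2' v').
    lra.
  have [E1 [E2 [V [D1 [D2 [hi]]]]]] := inf_hedge_of_ext N1 J1 x00 xS c0 cJ0 cS p_ge0
    a_ge0 xK wJ0 del0' (fun n nN => (HK n nN).1) h' le K0' (ltW eta0)
    (fun n nN => (HK n nN).2).
  have := grid_weak_duality N1 payoff_ge0 hi pr; rewrite -hE -/psi.
  have etaE : eta * c J N = eps / 2 by rewrite divfK// gt_eqF.
  have : psi / del / (K - x J) * S <= eps / 2.
    have dK : 0 < K - x J by rewrite subr_gt0.
    have -> : psi / del / (K - x J) * S = psi * S / ((K - x J) * del).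
      by field; rewrite !gt_eqF.
    move: BK; rewrite ler_pdivrMr ?divr_gt0// ler_pdivrMr ?mulr_gt0//; lra.
  rewrite /S; lra.
have [M [isM pM sM]] := finite_model N1 J1 s0_gt0 x00 xS c0 cJ0 p_ge0 a_ge0 xK wJ0 pr'.
exists M; split=> //.
  by apply: le_trans pM; rewrite lee_fin -hE'.
move=> beta lam th1 th2 sr; apply: le_trans (sM _ _ _ _ sr).
by rewrite -hE'.
Qed.

End AmericanDuality.

Theorem mainTheorem14 (R : realType) (N J : nat) (s0 : R) (x : nat -> R)
    (c : nat -> nat -> R) (a : R -> nat -> R) (l : nat -> R) :
  (1 <= N)%N -> (1 <= J)%N ->
  0 < s0 ->
  (* strikes 0 = x_0 < x_1 < ... < x_J *)
  x 0%N = 0 -> (forall j, (j < J)%N -> x j < x j.+1) ->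
  (* call prices *)
  (forall n, (1 <= n <= N)%N -> c 0%N n = s0) ->
  (forall j n, (j < J)%N -> (1 <= n <= N)%N -> c j.+1 n < c j n) ->
  (forall n, (1 <= n <= N)%N -> 0 < c J n) ->
  (forall n, (1 <= n <= N)%N -> slope x c 1%N n < 1) ->
  (forall j n, (1 <= j < J)%N -> (1 <= n <= N)%N ->
     slope x c j.+1 n < slope x c j n) ->
  (forall n, (1 <= n <= N)%N -> 0 < slope x c J n) ->
  (forall j n, (1 <= j <= J)%N -> (1 <= n < N)%N -> c j n < c j n.+1) ->
  (* payoff: nonnegative, convex in its first argument on [0, oo) *)
  (forall y n, (1 <= n <= N)%N -> 0 <= y -> 0 <= a y n) ->
  (forall y z t n, (1 <= n <= N)%N -> 0 <= y -> 0 <= z -> 0 <= t <= 1 ->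
     a (t * y + (1 - t) * z) n <= t * a y n + (1 - t) * a z n) ->
  (* l_n = lim_{y -> oo} a(y, t_n) / y exists and is finite *)
  (forall n, (1 <= n <= N)%N -> (fun y => a y n / y) @ +oo --> l n) ->
  [/\ Phi N J s0 x c a l = Pmodel N J s0 x c a,
      Pmodel N J s0 x c a = Hsuper N J x c a,
      Hsuper N J x c a = Psi N J s0 x c a l,
      (exists M : nat -> model R,
         (forall k, is_model N J s0 x c (M k)) /\
         (fun k => phi N a (M k)) @ \oo --> Psi N J s0 x c a l) &
      (exists beta lam th1 th2,
         superreplicates N J x a beta lam th1 th2 /\
         (strategy_cost N J c beta lam)%:E = Hsuper N J x c a)].
Proof.
move=> N1 J1 s0_gt0 x00 xS c0 _ cJ0 s1 sS sJ cS a_ge0 a_conv a_lim.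
have p_gt0 j n : (j <= J)%N -> (1 <= n <= N)%N -> 0 < phat J s0 x c j n.
  move=> jJ nN; apply: phat_gt0 => //; [exact: c0|exact: s1| |exact: sJ].
  by move=> i iJ; exact: sS.
have cS' j n : (1 <= j <= J)%N -> (1 <= n < N)%N -> c j n <= c j n.+1.
  by move=> jJ nN; exact/ltW/cS.
have w_ge0 j n : (j < J.+2)%N -> (1 <= n <= N)%N -> 0 <= inf_payoff J x a l j n.
  move=> _ nN; rewrite /inf_payoff; case: ifP => jJ.
    by rewrite a_ge0// (grid_ge0 x00 xS).
  by apply: (asymptotic_slope_ge0 (a_lim n nN)) => y; exact: a_ge0.
have [psi [[e1 [e2 [v [d1 [d2 [h hE]]]]]] [f [g1 [g2 [pr prE]]]] approx]] :=
  american_duality_real N1 J1 s0_gt0 x00 xS c0 cJ0 cS' p_gt0 a_ge0 a_lim.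
have [beta [lam [D1 [D2 [sr srE]]]]] :=
  inf_hedge_strategy N1 J1 x00 xS c0 a_conv a_lim h.
have PsiE : Psi N J s0 x c a l = psi%:E.
  apply/eqP; rewrite eq_le; apply/andP; split.
    have [h' e0 cE] := grid_hedge_trim s0 c h.
    apply: ereal_inf_lbound; exists (fun j n => if (n < N)%N then e1 j n else 0),
      (fun j n => if (1 < n)%N then e2 j n else 0), v, d1, d2; split; last first.
      by rewrite (hedgeLP_objE s0 x c N1 v e0) cE hE.
    apply/hedgeLP_grid; split; [exact: e0| |exact: h'].
    by move=> j n jJ nN; apply: le_trans (w_ge0 j n jJ nN) (h.2 j n jJ nN).
  apply: le_ereal_inf_tmp => _ [E1 [E2 [V [d1' [d2' [/hedgeLP_grid[e0 v0 h'] ->]]]]]].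
  rewrite (hedgeLP_objE s0 x c N1 V e0) lee_fin -prE.
  exact: (grid_weak_duality N1 w_ge0 h' pr).
have PhiE : Phi N J s0 x c a l = psi%:E.
  apply/eqP; rewrite eq_le; apply/andP; split.
    apply: ge_ereal_sup => _ [F [G1 [G2 [/(pricingLP_grid J s0 x c N1) pr' ->]]]].
    rewrite pricingLP_objE lee_fin -hE.
    exact: (grid_weak_duality N1 w_ge0 h pr').
  apply: ereal_sup_ubound; exists f, g1, g2; split; last by rewrite pricingLP_objE prE.
  exact/pricingLP_grid.
have phi_le M : is_model N J s0 x c M -> (phi N a M <= psi%:E)%E.
  move=> isM; apply: ge_ereal_sup => _ [tau [tauM ->]].
  rewrite -hE -srE; have [_ _ super] := sr.
  exact: (model_price_le a_ge0 isM tauM super).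
have PmodelE : Pmodel N J s0 x c a = psi%:E.
  apply/eqP; rewrite eq_le; apply/andP; split.
    by apply: ge_ereal_sup => _ [M [isM ->]]; exact: phi_le.
  apply/lee_addgt0Pr => eps eps0; have [M [isM pM _]] := approx eps eps0.
  rewrite -leeBlDr// -EFinB (le_trans pM)//.
  by apply: ereal_sup_ubound; exists M.
have HsuperE : Hsuper N J x c a = psi%:E.
  apply/eqP; rewrite eq_le; apply/andP; split.
    apply: ereal_inf_lbound; exists beta, lam; do 2![eexists]; split; first exact: sr.
    by rewrite srE hE.
  apply: le_ereal_inf_tmp => _ [b [la [t1 [t2 [sr' ->]]]]].
  rewrite lee_fin; apply/ler_addgt0Pr => eps eps0.
  have [M [_ _ sM]] := approx eps eps0.
  by rewrite -lerBlDr; exact: sM sr'.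
rewrite PhiE PmodelE HsuperE PsiE; split=> //; last first.
  exists beta, lam; do 2![eexists]; split; first exact: sr.
  by rewrite srE hE.
have appr k : exists M : model R, is_model N J s0 x c M /\
    ((psi - k.+1%:R^-1)%:E <= phi N a M)%E.
  have [|M [isM pM _]] := approx k.+1%:R^-1; first by rewrite invr_gt0.
  by exists M.
have [M HM] := choice appr.
exists M; split=> [k|]; first by have [] := HM k.
apply: (@squeeze_cvge _ _ _ _ (fun k => (psi - k.+1%:R^-1)%:E) _ (cst psi%:E)).
- by near=> k; have [isM ->] := HM k; rewrite phi_le.
- apply: cvg_EFin; first by near=> k.
  rewrite -[X in _ --> X]subr0; apply: cvgB; first exact: cvg_cst.
  exact: cvg_harmonic.
- exact: cvg_cst.
Unshelve. all: by end_near. Qed.
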